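(* Let $S=\{s_0,s_1,\ldots,s_{n-1}\}$ be the Coxeter generators of the hyperoctahedral group $\mathfrak S^B_n$. (i) If $\alpha$ is a pseudo-composition of $n$, then $\mathbf P^B_\alpha\cong\mathcal P_I^S$ as $\mathcal H^B_n(0)$-modules, where $I=\{s_i:i\in D(\alpha)\}$. (ii) Let $\alpha=\alpha^1\oplus\cdots\oplus\alpha^k$ be a generalized pseudo-ribbon of size $n$ whose connected components are a pseudo-composition $\alpha^1$ of $n_1$ and compositions $\alpha^i$ of $n_i$ for $i=2,\ldots,k$. Let $$I=\{s_i:i\in D(\alpha^1\rhd\cdots\rhd\alpha^k)\}\quad\text{and}\quad J=\{s_j:j\in D(0\cdot1^{n_1}\rhd1^{n_2}\rhd\cdots\rhd1^{n_k})\}.$$ Then $\mathbf P^B_\alpha$ is a well-defined $\mathcal H^B_n(0)$-module isomorphic to $\mathcal P_{I,J}^S$. Consequently, $$\mathbf P^B_\alpha\ \cong\ \left(\mathbf P^B_{\alpha^1}\otimes\mathbf P_{\alpha^2}\otimes\cdots\otimes\mathbf P_{\alpha^k}\right)\uparrow_{\mathcal H^B_{n_1,\ldots,n_k}(0)}^{\mathcal H^B_n(0)}\ \cong\ \bigoplus_{\beta\in[\alpha]}\mathbf P^B_\beta .$$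
   Context: $\mathbb F$ is an arbitrary field. $\mathfrak S^B_n$ is the group of signed permutations $w$ of $\{\pm1,\ldots,\pm n\}$ ($w(-i)=-w(i)$), written as words $w(1)\cdots w(n)$, with generators $s_0=\bar12\cdots n$ and $s_i=(i,i+1)(-i,-(i+1))$, $1\le i\le n-1$ (a bar is a minus sign); it is the Coxeter group of type $B_n$. $D(w)=\{i:0\le i\le n-1,\ w(i)>w(i+1)\}$ with $w(0):=0$. $\mathcal H^B_n(0)$ is the $\mathbb F$-algebra generated by $\pi_0,\ldots,\pi_{n-1}$ with $\pi_i^2=\pi_i$ and the braid relations of $\mathfrak S^B_n$; $\overline\pi_i:=\pi_i-1$; $\mathcal H_0^B(0)=\mathbb F$. For $w$ with reduced expression $s_{i_1}\cdots s_{i_r}$, $\pi_w=\pi_{i_1}\cdots\pi_{i_r}$ and $\overline\pi_w=\overline\pi_{i_1}\cdots\overline\pi_{i_r}$. For $I\subseteq S$, $w_0(I)$ is the longest element of the subgroup generated by $I$. $\mathcal P_I^S:=\mathcal H^B_n(0)\overline\pi_{w_0(I)}\pi_{w_0(S\setminus I)}$ and $\mathcal P_{I,J}^S:=\mathcal H^B_n(0)\overline\pi_{w_0(I)}\pi_{w_0(J\setminus I)}$. $\mathcal H_n(0)$ is the analogous type A algebra, generated by $\pi_1,\ldots,\pi_{n-1}$. A composition (of $n$) is a sequence of positive integers (with sum $n$); a pseudo-composition of $n$ is a sequence $\alpha=(\alpha_1,\ldots,\alpha_\ell)$, $\ell\ge1$, with $\alpha_1\ge0$, $\alpha_2,\ldots,\alpha_\ell>0$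 and sum $n$. In both cases $D(\alpha)=\{\alpha_1,\alpha_1+\alpha_2,\ldots,\alpha_1+\cdots+\alpha_{\ell-1}\}$. $1^m=(1,\ldots,1)$ ($m$ parts). For $\alpha=(\alpha_1,\ldots,\alpha_\ell)$ a composition or pseudo-composition and $\beta=(\beta_1,\ldots,\beta_k)$ a composition, $\alpha\cdot\beta=(\alpha_1,\ldots,\alpha_\ell,\beta_1,\ldots,\beta_k)$ and $\alpha\rhd\beta=(\alpha_1,\ldots,\alpha_{\ell-1},\alpha_\ell+\beta_1,\beta_2,\ldots,\beta_k)$; thus $0\cdot1^{n_1}=(0,1,\ldots,1)$. Ribbons: a composition is identified with its ribbon diagram, with rows of lengths $\alpha_1,\ldots,\alpha_\ell$ from bottom to top, the last box of each row directly below the first box of the next row up. A pseudo-composition is identified with its pseudo-ribbon diagram: if $\alpha_1>0$, take the ribbon of $\alpha$ and add an extra box containing $0$ (the 0-box) to the left of the bottom row; if $\alpha_1=0$, take the ribbon of $(\alpha_2,\ldots,\alpha_\ell)$ and add the 0-box directly below the leftmost (lowest) box; the pseudo-composition $(0)$ is the 0-box alone. A generalized pseudo-ribbon $\alpha=\alpha^1\oplus\cdots\oplus\alpha^k$ is a skew diagram with connected components $\alpha^1$ (a pseudo-ribbon) and $\alpha^2,\ldots,\alpha^k$ (ribbons), with $\alpha^{i+1}$ strictly northeast of $\alpha^i$; its size is the number of its boxes other than the 0-box. $[\alpha^1]=\{\alpha^1\}$ and $[\alpha]=\{\beta\cdot\alpha^k,\ \beta\rhd\alpha^k:\beta\in[\alpha^1\oplus\cdots\oplus\alpha^{k-1}]\}$.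 A (type B) standard tableau of generalized pseudo-ribbon shape $\alpha$ of size $n$ is a filling $\tau$ of the boxes other than the 0-box with elements of $\{\pm1,\ldots,\pm n\}$ such that rows increase left to right and columns increase top to bottom, the entry $0$ of the 0-box included, and such that the reading word $w(\tau)$ (rows read from bottom to top, each left to right, omitting the 0-box) is a signed permutation in $\mathfrak S^B_n$. Let $s_0(\tau)$ be $\tau$ with the entry $\pm1$ negated; for $i\ge1$ let $s_i(\tau)$ be $\tau$ with the absolute values of $\pm i$ and $\pm(i+1)$ swapped, signs in their positions unchanged. Say $0$ is a descent of $\tau$ if $-1$ appears in $\tau$; say $i\in\{1,\ldots,n-1\}$ is a descent of $\tau$ if: $i$ and $i+1$ both appear with $i$ in a higher row than $i+1$; or $-i$ and $-(i+1)$ both appear with $-i$ in a lower row than $-(i+1)$; or $i$ and $-(i+1)$ both appear. (Equivalently $i\in D(w(\tau)^{-1})$.) $\mathbf P^B_\alpha$ is the $\mathbb F$-vector space with basis the standard tableaux of shape $\alpha$, with $\overline\pi_i(\tau)=-\tau$ if $i$ is a descent of $\tau$; $\overline\pi_i(\tau)=0$ if $i$ is not a descent of $\tau$ and $s_i(\tau)$ is not standard; $\overline\pi_i(\tau)=s_i(\tau)$ if $i$ is not a descent of $\tau$ and $s_i(\tau)$ is standard. Type A: for a ribbon $\alpha\models m$, $\mathbf P_\alpha$ is the $\mathcal H_m(0)$-module with basis the standard tableaux of shape $\alpha$ (fillings by $1,\ldots,m$, rows increasing left to right, columns increasing top to bottom) and $\overline\pi_i(\tau)=-\tau$, $0$,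 or $s_i(\tau)$ (swap $i$ and $i+1$) according as $i$ is in a higher row than, the same row as, or a lower row than $i+1$. $\mathcal H^B_{n_1,\ldots,n_k}(0)\cong\mathcal H^B_{n_1}(0)\otimes\mathcal H_{n_2}(0)\otimes\cdots\otimes\mathcal H_{n_k}(0)$ is the subalgebra of $\mathcal H^B_n(0)$ generated by the $\pi_i$, $0\le i\le n-1$, with $i\notin\{n_1,n_1+n_2,\ldots,n_1+\cdots+n_{k-1}\}$. $N\uparrow_B^A:=A\otimes_BN$. *)

(* Defs.v *)
From HB Require Import structures.
From mathcomp Require Import all_boot all_order all_fingroup all_algebra.
From mathcomp Require Import generic_quotient ring_quotient finmap boolp.
From mathcomp Require Import monalg.

Set Implicit Arguments.
Unset Strict Implicit.
Unset Printing Implicit Defensive.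

Import Order.TTheory GRing.Theory Num.Theory.

Local Open Scope ring_scope.
Local Open Scope quotient_scope.

(* zext h is the Z-linear extension of h to the free abelian group on K. *)
Section ZExt.
Variables (K : choiceType) (V : zmodType) (h : K -> V).

Definition zext (t : {malg int[K]}) : V := \sum_(k <- msupp t) h k *~ t@_k.

Lemma zextEw (d : {fset K}) t : (msupp t `<=` d)%fset ->
  zext t = \sum_(k <- d) h k *~ t@_k.
Proof.
move=> le; rewrite [LHS](big_fset_incl _ le) => //= x xd /mcoeff_outdom ->.
by rewrite mulr0z.
Qed.

Lemma zext_is_zmod_morphism : zmod_morphism zext.
Proof.
move=> g1 g2; pose d := (msupp g1 `|` msupp g2)%fset.
rewrite !(@zextEw d) ?fsubsetUl ?fsubsetUr ?msuppB_le //.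
by rewrite -sumrB; apply: eq_bigr => k _; rewrite mcoeffB mulrzBr.
Qed.

HB.instance Definition _ :=
  GRing.isZmodMorphism.Build {malg int[K]} V zext zext_is_zmod_morphism.

Lemma zextU k : zext << k >> = h k.
Proof. by rewrite (zextEw msuppU_le) big_seq_fset1 mcoeffUU mulr1z. Qed.

End ZExt.

Lemma zmod_morph_ext (K : choiceType) (V : zmodType)
    (f g : {additive {malg int[K]} -> V}) :
  (forall k, f << k >> = g << k >>) -> f =1 g.
Proof.
move=> fg t; rewrite [t]monalgE !raddf_sum; apply: eq_bigr => k _.
have -> : << t@_k *g k >> = << k >> *~ t@_k :> {malg int[K]}.
  apply/malgP => j; rewrite -[RHS]/(mcoeff j _) raddfMz /= !mcoeffU.
  by case: (k == j); rewrite ?mul0rz // !mulr1n intz.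
by rewrite !raddfMz fg.
Qed.

(* (A, B)-bimodules: bact is a right action of B by A-linear maps. *)
Record bimod (A B : nzRingType) := Bimod {
  bcar :> lmodType A;
  bact : bcar -> B -> bcar;
  bactDl : forall m m' b, bact (m + m') b = bact m b + bact m' b;
  bactDr : forall m b b', bact m (b + b') = bact m b + bact m b';
  bact1 : forall m, bact m 1 = m;
  bactM : forall m b b', bact m (b * b') = bact (bact m b) b';
  bactZ : forall a m b, bact (a *: m) b = a *: bact m b
}.

(* M (x)_B N is the quotient of the free abelian group on M * N by the subgroup
   generated by the biadditivity and balancing relators. *)
Section Tensor.
Variables (A B : nzRingType) (M : bimod A B) (N : lmodType B).

Inductive tensor_rel : {malg int[(M * N)%type]} -> Prop :=
| TensorDl m m' x :
    tensor_rel (<< (m + m', x) >> - << (m, x) >> - << (m', x) >>)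
| TensorDr m x x' :
    tensor_rel (<< (m, x + x') >> - << (m, x) >> - << (m, x') >>)
| TensorM m b x : tensor_rel (<< (bact m b, x) >> - << (m, b *: x) >>).

Definition tensor_sub : {pred {malg int[(M * N)%type]}} := fun t =>
  `[< forall G : {malg int[(M * N)%type]} -> Prop,
        G 0 -> (forall y z, G y -> G z -> G (y - z)) ->
        (forall y, tensor_rel y -> G y) -> G t >].

Lemma tensor_sub_closed : zmod_closed tensor_sub.
Proof.
split=> [|y z /asboolP Gy /asboolP Gz]; apply/asboolP => G G0 GB Grel //.
by apply: (GB); [apply: Gy | apply: Gz].
Qed.

HB.instance Definition _ := GRing.isZmodClosed.Build _ tensor_sub tensor_sub_closed.

Local Notation tensor_quot := (Quotient.quot tensor_sub).

Definition tensor : Type := tensor_quot.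
HB.instance Definition _ := GRing.Zmodule.on tensor.

Definition tpure (m : M) (x : N) : tensor := \pi_tensor_quot << (m, x) >>.

Definition tmap (f : M -> M) (g : N -> N) (t : tensor) : tensor :=
  zext (fun k => tpure (f k.1) (g k.2)) (repr (t : tensor_quot)).

Lemma pi_tensor_rel y : tensor_rel y -> \pi_tensor_quot y = 0.
Proof.
move=> Ry; apply/eqP; rewrite -[0](@pi_zeror _ _ 0 -%R +%R tensor_quot).
by rewrite -Quotient.idealrBE subr0; apply/asboolP => G _ _; apply.
Qed.

Lemma tpureDl m m' x : tpure (m + m') x = tpure m x + tpure m' x.
Proof.
have /pi_tensor_rel := TensorDl m m' x.
by rewrite !raddfB /= -addrA -opprD => /eqP; rewrite subr_eq0 => /eqP.
Qed.

Lemma tpureDr m x x' : tpure m (x + x') = tpure m x + tpure m x'.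
Proof.
have /pi_tensor_rel := TensorDr m x x'.
by rewrite !raddfB /= -addrA -opprD => /eqP; rewrite subr_eq0 => /eqP.
Qed.

Lemma tpureM m b x : tpure (bact m b) x = tpure m (b *: x).
Proof.
have /pi_tensor_rel := TensorM m b x.
by rewrite raddfB /= => /eqP; rewrite subr_eq0 => /eqP.
Qed.

Lemma zext_tensor_sub (V : zmodType) (h : M * N -> V) :
  (forall m m' x, h (m + m', x) = h (m, x) + h (m', x)) ->
  (forall m x x', h (m, x + x') = h (m, x) + h (m, x')) ->
  (forall m b x, h (bact m b, x) = h (m, b *: x)) ->
  forall t, zext h (repr (\pi_tensor_quot t)) = zext h t.
Proof.
move=> hDl hDr hM t; apply/eqP; rewrite -subr_eq0 -raddfB /=.
have /asboolP : repr (\pi_tensor_quot t) - t \in tensor_sub.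
  by rewrite Quotient.idealrBE reprK.
move=> /(_ (fun y => zext h y == 0)); apply; first by rewrite raddf0.
  by move=> y z /eqP y0 /eqP z0; rewrite raddfB /= y0 z0 subrr.
move=> y [] *; rewrite !raddfB /= !zextU ?hDl ?hDr ?hM ?subrr //.
- by rewrite addrAC addrK subrr.
- by rewrite addrAC addrK subrr.
Qed.

Lemma tensor_ext (V : zmodType) (f g : {additive tensor -> V}) :
  (forall m x, f (tpure m x) = g (tpure m x)) -> f =1 g.
Proof.
move=> fg t; rewrite -[t](@reprK _ tensor_quot).
pose q : {additive _ -> tensor_quot} := \pi_tensor_quot.
have fgq : forall k, (f \o q) << k >> = (g \o q) << k >>.
  by case=> m x; apply: fg.
exact: (zmod_morph_ext fgq).
Qed.

Section TensorMap.
Variables (f : M -> M) (g : N -> N).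
Hypothesis fD : forall m m', f (m + m') = f m + f m'.
Hypothesis gD : forall x x', g (x + x') = g x + g x'.
Hypothesis fM : forall m b, f (bact m b) = bact (f m) b.
Hypothesis gZ : forall b x, g (b *: x) = b *: g x.

Lemma tmap_pi t : tmap f g (\pi_tensor_quot t) =
  zext (fun k => tpure (f k.1) (g k.2)) t.
Proof.
apply: zext_tensor_sub => /= *.
- by rewrite fD tpureDl.
- by rewrite gD tpureDr.
- by rewrite fM gZ tpureM.
Qed.

Lemma tmap_pure m x : tmap f g (tpure m x) = tpure (f m) (g x).
Proof. by rewrite tmap_pi zextU. Qed.

Lemma tmap_is_zmod_morphism : zmod_morphism (tmap f g).
Proof.
move=> t u; rewrite -[t](@reprK _ tensor_quot) -[u](@reprK _ tensor_quot).
by rewrite -(raddfB \pi_tensor_quot) !tmap_pi raddfB.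
Qed.

End TensorMap.

Definition tscale (a : A) : tensor -> tensor := tmap (fun m => a *: m) id.

Fact tscale_is_zmod_morphism a : zmod_morphism (tscale a).
Proof.
by apply: tmap_is_zmod_morphism => // *; rewrite ?scalerDr ?bactZ.
Qed.

Lemma tscale_pure a m x : tscale a (tpure m x) = tpure (a *: m) x.
Proof. by rewrite /tscale tmap_pure // => *; rewrite ?scalerDr ?bactZ. Qed.

HB.instance Definition _ a :=
  GRing.isZmodMorphism.Build _ _ (tscale a) (tscale_is_zmod_morphism a).

Fact tscaleA a b t : tscale a (tscale b t) = tscale (a * b) t.
Proof.
apply: (@tensor_ext _ (tscale a \o tscale b) (tscale (a * b))) => m x /=.
by rewrite !tscale_pure scalerA.
Qed.

Fact tscale1 : left_id 1 tscale.
Proof.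
move=> t; apply: (@tensor_ext _ (tscale 1) idfun) => m x /=.
by rewrite tscale_pure scale1r.
Qed.

Fact tscaleDr : right_distributive tscale +%R.
Proof. by move=> a t u; rewrite raddfD. Qed.

Fact tscaleDl t : {morph tscale^~ t : a b / a + b}.
Proof.
move=> a b /=.
apply: (@tensor_ext _ (tscale (a + b)) (tscale a \+ tscale b)) => m x /=.
by rewrite !tscale_pure scalerDl tpureDl.
Qed.

HB.instance Definition _ := GRing.Zmodule_isLmodule.Build A tensor
  tscaleA tscale1 tscaleDr tscaleDl.

End Tensor.

Section Bimodules.

Section Scalars.
Variables (R : comNzRingType) (V : lmodType R).
Fact scalar_bimod_Dl (v v' : V) (c : R) : c *: (v + v') = c *: v + c *: v'.
Proof. exact: scalerDr. Qed.
Fact scalar_bimod_Dr (v : V) (c c' : R) : (c + c') *: v = c *: v + c' *: v.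
Proof. exact: scalerDl. Qed.
Fact scalar_bimod_M (v : V) (c c' : R) : (c * c') *: v = c' *: (c *: v).
Proof. by rewrite scalerA mulrC. Qed.
Fact scalar_bimod_Z (a : R) (v : V) (c : R) : c *: (a *: v) = a *: (c *: v).
Proof. by rewrite !scalerA mulrC. Qed.

Definition scalar_bimod : bimod R R :=
  Bimod scalar_bimod_Dl scalar_bimod_Dr (@scale1r _ V) scalar_bimod_M
        scalar_bimod_Z.
End Scalars.

Section Restriction.
Variables (A B : nzRingType) (i : {rmorphism B -> A}).
Implicit Types (m : A^o) (b : B).
Fact restr_bimod_Dl m m' b : (m + m') * i b = m * i b + m' * i b.
Proof. exact: mulrDl. Qed.
Fact restr_bimod_Dr m b b' : m * i (b + b') = m * i b + m * i b'.
Proof. by rewrite rmorphD mulrDr. Qed.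
Fact restr_bimod_1 m : m * i 1 = m.
Proof. by rewrite rmorph1 mulr1. Qed.
Fact restr_bimod_M m b b' : m * i (b * b') = m * i b * i b'.
Proof. by rewrite rmorphM mulrA. Qed.
Fact restr_bimod_Z (a : A) m b : (a *: m) * i b = a *: (m * i b).
Proof. by rewrite -[LHS]mulrA. Qed.

Definition restr_bimod : bimod A B :=
  @Bimod A B A^o (fun m b => m * i b) restr_bimod_Dl restr_bimod_Dr
    restr_bimod_1 restr_bimod_M restr_bimod_Z.
End Restriction.

End Bimodules.

Definition tensor_F (F : fieldType) (V W : lmodType F) : lmodType F :=
  tensor (scalar_bimod V) W.

Definition tmap_F (F : fieldType) (V W : lmodType F) (f : V -> V) (g : W -> W) :
  tensor_F V W -> tensor_F V W := @tmap F F (scalar_bimod V) W f g.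

Definition induced (A B : nzRingType) (i : {rmorphism B -> A}) (N : lmodType B) :
  lmodType A := tensor (restr_bimod i) N.

Section DirectSum.
Variables (A : nzRingType) (I : finType) (M : I -> lmodType A).

Definition dsum : Type := {dffun forall i, M i}.
HB.instance Definition _ := Choice.on dsum.
Implicit Types u v w : dsum.

Definition dsum0 : dsum := [ffun i => 0].
Definition dsum_opp u : dsum := [ffun i => - u i].
Definition dsum_add u v : dsum := [ffun i => u i + v i].
Definition dsum_scale (a : A) u : dsum := [ffun i => a *: u i].

Fact dsum_addA : associative dsum_add.
Proof. by move=> u v w; apply/ffunP => i; rewrite !ffunE addrA. Qed.
Fact dsum_addC : commutative dsum_add.
Proof. by move=> u v; apply/ffunP => i; rewrite !ffunE addrC. Qed.
Fact dsum_add0 : left_id dsum0 dsum_add.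
Proof. by move=> u; apply/ffunP => i; rewrite !ffunE add0r. Qed.
Fact dsum_addN : left_inverse dsum0 dsum_opp dsum_add.
Proof. by move=> u; apply/ffunP => i; rewrite !ffunE addNr. Qed.

HB.instance Definition _ :=
  GRing.isZmodule.Build dsum dsum_addA dsum_addC dsum_add0 dsum_addN.

Fact dsum_scaleA a b u : dsum_scale a (dsum_scale b u) = dsum_scale (a * b) u.
Proof. by apply/ffunP => i; rewrite !ffunE scalerA. Qed.
Fact dsum_scale1 : left_id 1 dsum_scale.
Proof. by move=> u; apply/ffunP => i; rewrite !ffunE scale1r. Qed.
Fact dsum_scaleDr : right_distributive dsum_scale +%R.
Proof. by move=> a u v; apply/ffunP => i; rewrite !ffunE scalerDr. Qed.
Fact dsum_scaleDl u : {morph dsum_scale^~ u : a b / a + b}.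
Proof. by move=> a b; apply/ffunP => i; rewrite !ffunE scalerDl. Qed.

HB.instance Definition _ := GRing.Zmodule_isLmodule.Build A dsum
  dsum_scaleA dsum_scale1 dsum_scaleDr dsum_scaleDl.

End DirectSum.

Definition lmod_iso (A : nzRingType) (M N : lmodType A) : Prop :=
  exists f : {linear M -> N}, bijective f.

(* The A-module structures on the F-space V in which g i acts as op i. *)
Record hmod_on (F : fieldType) (A : algType F) (V : lmodType F) (I : Type)
    (g : I -> A) (op : I -> V -> V) := HmodOn {
  hact : A -> V -> V;
  hactDl : forall v, {morph hact^~ v : a b / a + b};
  hactDr : right_distributive hact +%R;
  hact1 : left_id 1 hact;
  hactM : forall a b v, hact a (hact b v) = hact (a * b) v;
  hactZ : forall (c : F) a v, hact (c *: a) v = c *: hact a v;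
  hact_gen : forall i, hact (g i) =1 op i
}.

Section HmodOnLmod.
Variables (F : fieldType) (A : algType F) (V : lmodType F) (I : Type).
Variables (g : I -> A) (op : I -> V -> V) (s : hmod_on g op).

Definition hmod_carrier of hmod_on g op : Type := V.
HB.instance Definition _ := GRing.Zmodule.on (hmod_carrier s).
HB.instance Definition _ := GRing.Zmodule_isLmodule.Build A (hmod_carrier s)
  (hactM s) (hact1 s) (hactDr s) (hactDl s).

Definition hmod_lmod : lmodType A := hmod_carrier s.
End HmodOnLmod.

Coercion hmod_lmod : hmod_on >-> GRing.Lmodule.type.

Section LeftIdeal.
Variables (A : nzRingType) (x : A).

Definition lideal_pred : {pred A^o} := fun y => `[< exists a, y = a * x >].

Fact lideal_closed : submod_closed lideal_pred.
Proof.
split=> [|a y z /asboolP[b ->] /asboolP[c ->]]; apply/asboolP.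
  by exists 0; rewrite mul0r.
by exists (a * b + c); rewrite mulrDl -mulrA.
Qed.

HB.instance Definition _ :=
  GRing.isSubmodClosed.Build A A^o lideal_pred lideal_closed.

Record lideal : predArgType :=
  LIdeal { lideal_val : A^o; _ : lideal_val \in lideal_pred }.
HB.instance Definition _ := [isSub for lideal_val].
HB.instance Definition _ := [Choice of lideal by <:].
HB.instance Definition _ := [SubChoice_isSubLmodule of lideal by <:].

End LeftIdeal.

Section AlgebraQuotient.
Variables (F : fieldType) (A : algType F) (R : A -> Prop).

Definition two_sided_ideal : {pred A} := fun x =>
  `[< forall J : A -> Prop,
        J 0 -> (forall y z, J y -> J z -> J (y - z)) ->
        (forall a y, J y -> J (a * y)) -> (forall a y, J y -> J (y * a)) ->
        (forall y, R y -> J y) -> J x >].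

Fact two_sided_ideal_closed : zmod_closed two_sided_ideal.
Proof.
split=> [|y z /asboolP Jy /asboolP Jz]; apply/asboolP => J J0 JB Jl Jr JR //.
by apply: (JB); [apply: Jy | apply: Jz].
Qed.

HB.instance Definition _ :=
  GRing.isZmodClosed.Build _ two_sided_ideal two_sided_ideal_closed.

Lemma two_sided_idealMl a y : y \in two_sided_ideal -> a * y \in two_sided_ideal.
Proof.
move=> /asboolP Jy; apply/asboolP => J J0 JB Jl Jr JR.
by apply: (Jl); apply: Jy.
Qed.

Lemma two_sided_idealMr a y : y \in two_sided_ideal -> y * a \in two_sided_ideal.
Proof.
move=> /asboolP Jy; apply/asboolP => J J0 JB Jl Jr JR.
by apply: (Jr); apply: Jy.
Qed.

Lemma two_sided_ideal_gen y : R y -> y \in two_sided_ideal.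
Proof. by move=> Ry; apply/asboolP => J J0 JB Jl Jr; apply. Qed.

Hypothesis proper : 1 \notin two_sided_ideal.

Local Notation quotI := (Quotient.quot two_sided_ideal).

Definition alg_quot of 1 \notin two_sided_ideal : Type := quotI.
Local Notation Q := (alg_quot proper).
HB.instance Definition _ := GRing.Zmodule.on Q.

(* The operations are locked to keep conversion from unfolding quotients. *)
Fact alg_quot_key : unit. Proof. exact: tt. Qed.
Definition alg_pi : A -> Q := locked_with alg_quot_key \pi_quotI.
Definition alg_quot_mul : Q -> Q -> Q := locked_with alg_quot_key
  (fun x y => alg_pi (repr (x : quotI) * repr (y : quotI))).
Definition alg_quot_scale : F -> Q -> Q := locked_with alg_quot_key
  (fun c x => alg_pi (c *: repr (x : quotI))).

Lemma alg_piP (P : Q -> Prop) : (forall x, P (alg_pi x)) -> forall x, P x.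
Proof.
by move=> Ppi x; rewrite -[x](@reprK _ quotI); move: (Ppi (repr (x : quotI)));
  rewrite /alg_pi unlock.
Qed.

Lemma alg_pi_eq x y : (alg_pi x == alg_pi y) = (x - y \in two_sided_ideal).
Proof. by rewrite Quotient.idealrBE /alg_pi unlock. Qed.

Lemma alg_piK x : repr (alg_pi x : quotI) - x \in two_sided_ideal.
Proof. by rewrite Quotient.idealrBE reprK /alg_pi unlock. Qed.

Lemma alg_pi_is_zmod_morphism : zmod_morphism alg_pi.
Proof. by move=> x y; rewrite /alg_pi unlock raddfB. Qed.

HB.instance Definition _ :=
  GRing.isZmodMorphism.Build A Q alg_pi alg_pi_is_zmod_morphism.

Fact alg_pi_mul x y : alg_quot_mul (alg_pi x) (alg_pi y) = alg_pi (x * y).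
Proof.
rewrite /alg_quot_mul unlock; apply/eqP; rewrite alg_pi_eq.
have [ix iy] := (alg_piK x, alg_piK y).
set x' := repr _ in ix *; set y' := repr _ in iy *.
have -> : x' * y' - x * y = x' * (y' - y) + (x' - x) * y.
  by rewrite mulrBr mulrBl addrA subrK.
by apply: rpredD; [apply: two_sided_idealMl | apply: two_sided_idealMr].
Qed.

Fact alg_pi_scale c x : alg_quot_scale c (alg_pi x) = alg_pi (c *: x).
Proof.
rewrite /alg_quot_scale unlock; apply/eqP; rewrite alg_pi_eq.
rewrite -scalerBr -mulr_algl; apply: two_sided_idealMl; exact: alg_piK.
Qed.

Fact alg_quot_mulA : associative alg_quot_mul.
Proof.
by elim/alg_piP=> x; elim/alg_piP=> y; elim/alg_piP=> z; rewrite !alg_pi_mul mulrA.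
Qed.
Fact alg_quot_mul1x : left_id (alg_pi 1) alg_quot_mul.
Proof. by elim/alg_piP=> x; rewrite alg_pi_mul mul1r. Qed.
Fact alg_quot_mulx1 : right_id (alg_pi 1) alg_quot_mul.
Proof. by elim/alg_piP=> x; rewrite alg_pi_mul mulr1. Qed.
Fact alg_quot_mulDl : left_distributive alg_quot_mul +%R.
Proof.
elim/alg_piP=> x; elim/alg_piP=> y; elim/alg_piP=> z.
by rewrite -raddfD !alg_pi_mul -raddfD mulrDl.
Qed.
Fact alg_quot_mulDr : right_distributive alg_quot_mul +%R.
Proof.
elim/alg_piP=> x; elim/alg_piP=> y; elim/alg_piP=> z.
by rewrite -raddfD !alg_pi_mul -raddfD mulrDr.
Qed.
Fact alg_quot_one_neq0 : alg_pi 1 != 0.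
Proof. by rewrite -(raddf0 alg_pi) alg_pi_eq subr0. Qed.

HB.instance Definition _ := GRing.Zmodule_isNzRing.Build Q alg_quot_mulA
  alg_quot_mul1x alg_quot_mulx1 alg_quot_mulDl alg_quot_mulDr alg_quot_one_neq0.

Fact alg_quot_scaleA c d x :
  alg_quot_scale c (alg_quot_scale d x) = alg_quot_scale (c * d) x.
Proof. by elim/alg_piP: x => x; rewrite !alg_pi_scale scalerA. Qed.
Fact alg_quot_scale1 : left_id 1 alg_quot_scale.
Proof. by elim/alg_piP=> x; rewrite alg_pi_scale scale1r. Qed.
Fact alg_quot_scaleDr : right_distributive alg_quot_scale +%R.
Proof.
move=> c; elim/alg_piP=> x; elim/alg_piP=> y.
by rewrite -raddfD !alg_pi_scale -raddfD scalerDr.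
Qed.
Fact alg_quot_scaleDl x : {morph alg_quot_scale^~ x : c d / c + d}.
Proof.
by elim/alg_piP: x => x c d; rewrite /= !alg_pi_scale -raddfD scalerDl.
Qed.

HB.instance Definition _ := GRing.Zmodule_isLmodule.Build F Q
  alg_quot_scaleA alg_quot_scale1 alg_quot_scaleDr alg_quot_scaleDl.

Lemma alg_piM x y : alg_pi (x * y) = alg_pi x * alg_pi y.
Proof. by rewrite -alg_pi_mul. Qed.
Lemma alg_piZ c x : alg_pi (c *: x) = c *: alg_pi x.
Proof. by rewrite -alg_pi_scale. Qed.

Fact alg_quot_scaleAl (c : F) (x y : Q) : c *: (x * y) = (c *: x) * y.
Proof.
elim/alg_piP: x => x; elim/alg_piP: y => y.
by rewrite -alg_piM -!alg_piZ -alg_piM scalerAl.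
Qed.
Fact alg_quot_scaleAr (c : F) (x y : Q) : c *: (x * y) = x * (c *: y).
Proof.
elim/alg_piP: x => x; elim/alg_piP: y => y.
by rewrite -alg_piM -!alg_piZ -alg_piM scalerAr.
Qed.

HB.instance Definition _ :=
  GRing.Lmodule_isLalgebra.Build F Q alg_quot_scaleAl.
HB.instance Definition _ :=
  GRing.Lalgebra_isAlgebra.Build F Q alg_quot_scaleAr.

End AlgebraQuotient.

Section FreeAlgebra.
Variables (F : fieldType) (X : choiceType).

Definition freealg : Type := {malg F[{fmonom X}]}.
HB.instance Definition _ := GRing.Lalgebra.on freealg.

Fact freealg_scaleAr (c : F) (f g : freealg) : c *: (f * g) = f * (c *: g).
Proof.
have malgC_comm (h : {malg F[{fmonom X}]}) : h * c%:MP = c%:MP * h.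
  rewrite [h]monalgE mulr_suml mulr_sumr; apply: eq_bigr => k _.
  by rewrite !malgM_def !fgmulUU mul1m mulm1 mulrC.
rewrite -[LHS]mul_malgC -[_ *: g]mul_malgC [RHS]mulrA (malgC_comm f).
by rewrite -mulrA.
Qed.

HB.instance Definition _ := GRing.Lalgebra_isAlgebra.Build F freealg freealg_scaleAr.

Definition fvar (x : X) : freealg := << (fmu x) >>.
End FreeAlgebra.

Section HeckeAlgebra.
Variables (F : fieldType) (n : nat).
Local Notation T := (@fvar F 'I_n).

Inductive hecke_rel : freealg F 'I_n -> Prop :=
| HeckeSq i : hecke_rel (T i * T i - T i)
| HeckeComm (i j : 'I_n) : (i.+1 < j)%N -> hecke_rel (T i * T j - T j * T i)
| HeckeBraid3 (i j : 'I_n) : (0 < i)%N -> j = i.+1 :> nat ->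
    hecke_rel (T i * T j * T i - T j * T i * T j)
| HeckeBraid4 (i j : 'I_n) : i = 0%N :> nat -> j = 1%N :> nat ->
    hecke_rel (T i * T j * T i * T j - T j * T i * T j * T i).

(* The ideal is proper: sending every generator to 1 defines a character. *)
Lemma hecke_ideal1 : 1 \notin two_sided_ideal hecke_rel.
Proof.
pose h : {fmonom 'I_n} -> F := fun => 1.
have hM : mmorphism h by split=> // x y; rewrite /h mulr1.
pose hm : {mmorphism {fmonom 'I_n} -> F} := HB.pack h (monalg.isMultiplicative.Build _ _ h hM).
pose e : {rmorphism {malg F[{fmonom 'I_n}]} -> F} := mmap idfun hm.
have eT i : e (T i) = 1 by rewrite /e /= mmapU mul1r.
have eB (x y : freealg F 'I_n) : e (x - y) = e x - e y by exact: (rmorphB e).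
have eM (x y : freealg F 'I_n) : e (x * y) = e x * e y by exact: (rmorphM e).
have e1 : e (1 : freealg F 'I_n) = 1 by exact: (rmorph1 e).
have e0 : e (0 : freealg F 'I_n) = 0 by exact: (rmorph0 e).
clearbody e; apply/negP => /asboolP /(_ (fun x => e x = 0)) eP.
have /eqP : e 1 = 0; last by rewrite e1 oner_eq0.
apply: eP => [|y z y0 z0|a y y0|a y y0|y] //.
- by rewrite eB y0 z0 subrr.
- by rewrite eM y0 mulr0.
- by rewrite eM y0 mul0r.
- have eM1 u v : e u = 1 -> e v = 1 -> e (u * v : freealg F 'I_n) = 1.
    by move=> eu ev; rewrite eM eu ev mulr1.
  have eB0 u v : e u = 1 -> e v = 1 -> e (u - v : freealg F 'I_n) = 0.
    by move=> eu ev; rewrite eB eu ev subrr.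
  have e2 i j := eM1 _ _ (eT i) (eT j).
  have e3 i j k := eM1 _ _ (e2 i j) (eT k).
  have e4 i j k l := eM1 _ _ (e3 i j k) (eT l).
  case=> [i|i j _|i j _ _|i j _ _].
  + exact: eB0 (e2 i i) (eT i).
  + exact: eB0 (e2 i j) (e2 j i).
  + exact: eB0 (e3 i j i) (e3 j i j).
  + exact: eB0 (e4 i j i j) (e4 j i j i).
Qed.

Definition hecke : Type := alg_quot hecke_ideal1.
HB.instance Definition _ := GRing.Algebra.on hecke.

Definition hgen (i : 'I_n) : hecke := alg_pi hecke_ideal1 (T i).
Definition hgenbar (i : 'I_n) : hecke := hgen i - 1.

Section Parabolic.
Variable G : {set 'I_n}.

Definition parabolic_pred : {pred hecke} := fun x =>
  `[< forall S : hecke -> Prop, S 1 ->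
        (forall (c : F) y z, S y -> S z -> S (c *: y + z)) ->
        (forall y z, S y -> S z -> S (y * z)) ->
        (forall i, i \in G -> S (hgen i)) -> S x >].

Fact parabolic_closed : subalg_closed parabolic_pred.
Proof.
split=> [|c y z /asboolP Sy /asboolP Sz|y z /asboolP Sy /asboolP Sz];
  apply/asboolP => S S1 Slin SM Sgen //.
- by apply: (Slin); [apply: Sy | apply: Sz].
- by apply: (SM); [apply: Sy | apply: Sz].
Qed.

HB.instance Definition _ :=
  GRing.isSubalgClosed.Build F hecke parabolic_pred parabolic_closed.

Record parabolic : predArgType :=
  Parabolic { parabolic_val : hecke; _ : parabolic_val \in parabolic_pred }.
HB.instance Definition _ := [isSub for parabolic_val].
HB.instance Definition _ := [Choice of parabolic by <:].
HB.instance Definition _ := [SubChoice_isSubAlgebra of parabolic by <:].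

Fact hgenbar_parabolic (i : {i | i \in G}) : hgenbar (val i) \in parabolic_pred.
Proof.
rewrite rpredB ?rpred1 //; apply/asboolP => S S1 Slin SM Sgen.
exact: Sgen (valP i).
Qed.

Definition pgenbar (i : {i | i \in G}) : parabolic :=
  Parabolic (hgenbar_parabolic i).
End Parabolic.

End HeckeAlgebra.

Section SignedPermutations.
Variable n : nat.

(* (k, false) stands for k + 1 and (k, true) for -(k + 1). *)
Definition signed : finType := ('I_n * bool)%type.

Definition sint (x : signed) : int :=
  if x.2 then - (x.1.+1)%:Z else (x.1.+1)%:Z.
Definition sopp (x : signed) : signed := (x.1, ~~ x.2).

Definition signed_perms : {set {perm signed}} :=
  [set w : {perm signed} | [forall x, w (sopp x) == sopp (w x)]].

Definition sgen_fun (i : 'I_n) (x : signed) : signed :=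
  if i == 0%N :> nat then (x.1, x.2 (+) (x.1 == i))
  else (tperm (ord_pred i) i x.1, x.2).

Fact sgen_funK i : involutive (sgen_fun i).
Proof.
move=> [k b]; rewrite /sgen_fun; case: (val i == 0%N) => /=; last by rewrite tpermK.
by rewrite -addbA addbb addbF.
Qed.

Definition sgen i : {perm signed} := perm (inv_inj (@sgen_funK i)).

(* Products in {perm _} compose from left to right; words are read here as
   compositions s_(i_1) \o ... \o s_(i_r). *)
Definition word_perm (u : seq 'I_n) : {perm signed} :=
  (\prod_(i <- rev u) sgen i)%g.

Definition reduced_word (w : {perm signed}) (u : seq 'I_n) : Prop :=
  word_perm u = w /\ forall v, word_perm v = w -> (size u <= size v)%N.

Definition parabolic_subgroup (I : {set 'I_n}) : {group {perm signed}} :=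
  <<[set sgen i | i in I]>>%G.

(* An arbitrary reduced word of w; by Matsumoto's theorem the elements of the
   Hecke algebra attached to w below do not depend on the choice. *)
Definition redword (w : {perm signed}) : seq 'I_n :=
  if pselect (exists u, reduced_word w u) is left ex then sval (cid ex) else [::].

Lemma redwordP w : w \in parabolic_subgroup setT -> reduced_word w (redword w).
Proof.
move=> /gen_prodgP[r [c cS wE]].
pose P k := `[< exists u, word_perm u = w /\ size u = k >].
have exP : exists k, P k.
  have cE k : exists i, c k == sgen i.
    by have /imsetP[i _ ->] := cS k; exists i.
  pose u := rev [seq xchoose (cE k) | k <- index_enum 'I_r].
  exists (size u); apply/asboolP; exists u; split=> //.
  rewrite /word_perm revK big_map wE.
  by apply: eq_bigr => k _; rewrite -(eqP (xchooseP (cE k))).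
rewrite /redword; case: pselect => [ex|[]]; first by case: (cid ex).
case: (ex_minnP exP) => k /asboolP[u [uw uk]] kmin; exists u.
split=> // v vw; rewrite uk; apply: kmin; apply/asboolP.
by exists v.
Qed.

Definition longest (I : {set 'I_n}) : {perm signed} :=
  [arg max_(w > 1%g in parabolic_subgroup I) size (redword w)].

End SignedPermutations.

Section ProjectiveIdeals.
Variables (F : fieldType) (n : nat).

Definition hpi (w : {perm signed n}) : hecke F n :=
  \prod_(i <- redword w) hgen F i.
Definition hpibar (w : {perm signed n}) : hecke F n :=
  \prod_(i <- redword w) hgenbar F i.

Definition calP (I J : {set 'I_n}) : lmodType (hecke F n) :=
  lideal (hpibar (longest I) * hpi (longest (J :\: I))).

End ProjectiveIdeals.

Section Compositions.
Local Open Scope nat_scope.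
Implicit Types (a b : seq nat) (s : seq (seq nat)).

Definition is_comp a := (a != [::]) && all (leq 1) a.
Definition is_pcomp a := (a != [::]) && all (leq 1) (behead a).

Definition descents a : seq nat :=
  [seq sumn (take j a) | j <- iota 1 (size a).-1].

Definition ncat a b :=
  take (size a).-1 a ++ (last 0 a + head 0 b) :: behead b.

(* A pair a, s stands for a (+) s_1 (+) ... (+) s_(k-1). *)
Definition is_gpribbon n a s :=
  [&& is_pcomp a, all is_comp s & n == sumn a + sumn [seq sumn b | b <- s]].

Definition bracket a s : seq (seq nat) :=
  foldl (fun B b => [seq c ++ b | c <- B] ++ [seq ncat c b | c <- B]) [:: a] s.

(* Boxes are (row, column), rows being numbered upwards, and are listed in
   reading order. *)
Fixpoint ribbon (r c : nat) a : seq (nat * nat) :=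
  if a is m :: a' then
    [seq (r, j) | j <- iota c m] ++ ribbon r.+1 (c + m.-1) a'
  else [::].

Fixpoint ribbons (r c : nat) s : seq (nat * nat) :=
  if s is a :: s' then
    ribbon r c a ++ ribbons (r + size a) (c + sumn [seq m.-1 | m <- a]).+1 s'
  else [::].

(* The pseudo-ribbon of a is the ribbon of (a_1 + 1, a_2, ...), its first box
   being the 0-box: this covers both a_1 > 0 and a_1 = 0. *)
Definition gpribbon a s : seq (nat * nat) :=
  ribbons 0 0 (((head 0 a).+1 :: behead a) :: s).

Definition row (D : seq (nat * nat)) k := (nth (0, 0) D k).1.
Definition col (D : seq (nat * nat)) k := (nth (0, 0) D k).2.

Definition increasing N (D : seq (nat * nat)) (v : 'I_N -> int) : bool :=
  [forall p : 'I_N, forall q : 'I_N,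
    ((row D p == row D q) && (col D p < col D q) ==> (v p < v q)%R) &&
    ((col D p == col D q) && (row D p > row D q) ==> (v p < v q)%R)].

End Compositions.

Section LinearExtension.
Variables (F : fieldType) (X : finType) (P : pred X).
Local Notation T := {x : X | P x}.

Definition bvec (x : X) : {ffun T -> F^o} := [ffun t => (val t == x)%:R].

Definition linext (V : lmodType F) (h : T -> V) (v : {ffun T -> F^o}) : V :=
  \sum_t v t *: h t.

End LinearExtension.

Section TypeB.
Variables (F : fieldType) (n : nat) (a : seq nat) (s : seq (seq nat)).

(* Box 0 of the diagram is the 0-box; box k + 1 carries the entry tau k, so
   that tau is its own reading word. *)
Definition entry (tau : {ffun 'I_n -> signed n}) (p : 'I_n.+1) : int :=
  if unlift ord0 p is Some k then sint (tau k) else 0.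

Definition brow (k : 'I_n) : nat := row (gpribbon a s) k.+1.

Definition standardB (tau : {ffun 'I_n -> signed n}) : bool :=
  increasing (gpribbon a s) (entry tau) &&
  [exists w in signed_perms n, [forall k, tau k == w (k, false)]].

Definition act_tabB (i : 'I_n) (tau : {ffun 'I_n -> signed n}) :
  {ffun 'I_n -> signed n} := [ffun k => sgen i (tau k)].

Definition descentB (i : 'I_n) (tau : {ffun 'I_n -> signed n}) : bool :=
  if i == 0%N :> nat then [exists p, sint (tau p) == - 1] else
  [exists p, exists q,
    [|| [&& sint (tau p) == i%:Z, sint (tau q) == i.+1%:Z & (brow p > brow q)%N],
        [&& sint (tau p) == - i%:Z, sint (tau q) == - i.+1%:Z
          & (brow p < brow q)%N]
      | (sint (tau p) == i%:Z) && (sint (tau q) == - i.+1%:Z)]].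

Definition spaceB : lmodType F := {ffun {tau | standardB tau} -> F^o}.

Definition opB (i : 'I_n) : spaceB -> spaceB :=
  linext (fun t : {tau | standardB tau} =>
    if descentB i (val t) then - bvec F standardB (val t)
    else if standardB (act_tabB i (val t)) then
      bvec F standardB (act_tabB i (val t))
    else 0).

(* The H-module structures on spaceB in which each generator acts as opB;
   there is at most one since the generators generate the algebra. *)
Definition PB : Type := hmod_on (hgenbar F (n := n)) opB.

End TypeB.

Section TypeA.
Variables (F : fieldType) (m : nat) (b : seq nat).

(* The entries 1, ..., m are represented by the ordinals 0, ..., m - 1. *)
Definition arow (k : 'I_m) : nat := row (ribbon 0 0 b) k.

Definition standardA (tau : {ffun 'I_m -> 'I_m}) : bool :=
  injectiveb tau && increasing (ribbon 0 0 b) (fun k => (tau k)%:Z).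

Definition spaceA : lmodType F := {ffun {tau | standardA tau} -> F^o}.

Definition act_tabA (i : 'I_m) (tau : {ffun 'I_m -> 'I_m}) : {ffun 'I_m -> 'I_m} :=
  [ffun k => tperm (ord_pred i) i (tau k)].

Definition higherA (i : 'I_m) (tau : {ffun 'I_m -> 'I_m}) : bool :=
  [exists p, exists q,
    [&& (tau p).+1 == i :> nat, tau q == i & (arow p > arow q)%N]].
Definition same_rowA (i : 'I_m) (tau : {ffun 'I_m -> 'I_m}) : bool :=
  [exists p, exists q,
    [&& (tau p).+1 == i :> nat, tau q == i & arow p == arow q]].

(* Only meaningful for i != 0, the generators being pi_1, ..., pi_(m-1). *)
Definition opA (i : 'I_m) : spaceA -> spaceA :=
  linext (fun t : {tau | standardA tau} =>
    if higherA i (val t) then - bvec F standardA (val t)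
    else if same_rowA i (val t) then 0
    else bvec F standardA (act_tabA i (val t))).

End TypeA.

Section ExternalTensor.
Variable F : fieldType.

Record opspace := OpSpace { osp :> lmodType F; oop : nat -> osp -> osp }.

Definition opspace_of (m : nat) (V : lmodType F) (op : 'I_m -> V -> V) : opspace :=
  OpSpace (fun (i : nat) v => if insub i is Some j then op j v else 0).

(* For i < m the i-th operator acts on X, for i > m the (i - m)-th operator of
   Y acts on Y; the value i = m will not be used. *)
Definition opspace_tensor (m : nat) (X Y : opspace) : opspace :=
  @OpSpace (tensor_F X Y) (fun i =>
    if (i < m)%N then tmap_F (@oop X i) id else tmap_F id (@oop Y (i - m)%N)).

Fixpoint opspace_tensors (m : nat) (X : opspace) (s : seq (seq nat)) : opspace :=
  if s is b :: s' then
    opspace_tensors (m + sumn b)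
      (opspace_tensor m X (opspace_of (opA (F := F) (m := sumn b) (b := b)))) s'
  else X.

Definition tensor_space (a : seq nat) (s : seq (seq nat)) : opspace :=
  opspace_tensors (sumn a)
    (opspace_of (opB (F := F) (n := sumn a) (a := a) (s := [::]))) s.

Section TensorModule.
Variables (n : nat) (a : seq nat) (s : seq (seq nat)).

Definition block_gens : {set 'I_n} :=
  [set i : 'I_n | val i \notin descents (sumn a :: [seq sumn b | b <- s])].

(* The module structures over H_(n_1,...,n_k) on the tensor product, where the
   identification with a tensor product of Hecke algebras sends a generator of
   the j-th tensor factor to the corresponding generator of the j-th block. *)
Definition tensor_module : Type :=
  hmod_on (@pgenbar F n block_gens)
    (fun i => oop (o := tensor_space a s) (val (val i))).

End TensorModule.
End ExternalTensor.

Definition block_incl (F : fieldType) (n : nat) (G : {set 'I_n}) :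
  {rmorphism parabolic F G -> hecke F n} := val.

(* Main.v *)
Require Import Defs.
From HB Require Import structures.
From mathcomp Require Import all_boot all_order all_fingroup all_algebra.
From mathcomp Require generic_quotient ring_quotient.
From mathcomp Require Import finmap boolp monalg.
From mathcomp Require Import zify.

(* Reading words identify the standard tableaux of shape alpha with the signed
   permutations that have prescribed descents and non-descents along the steps
   inside the components of alpha, and are unconstrained at the gaps between them.
   Let I be the set of forced descents, K the set of forced non-descents, and write
   rho_w for the product of the pi_i - 1 over a reduced word of w.  Then p |-> rho_p pi_(w_0(K))
   intertwines the operators on tableaux with left multiplication in the Hecke
   algebra; it is injective, since right multiplication by pi_(w_0(K)) preserves
   the coefficients at minimal coset representatives, and its image is the left
   ideal generated by rho_(w_0(I)) pi_(w_0(K)).  The relations thus need only be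
   checked in the algebra itself, where they hold.

   Induced module: a signed permutation with the prescribed descents factors
   uniquely into a minimal coset representative and an element of the parabolic
   subgroup, which is a tensor product of tableaux, and rho factors accordingly.

   Direct sum: filling the gaps of alpha by steps in all possible ways gives the
   elements of [alpha].  Right multiplication by rho_(w_0(I_beta)) pi_(w_0(K)) maps
   the ideal of beta to that of alpha, and the sum of these maps is triangular for
   the length, with signs on the diagonal. *)

Set Implicit Arguments.
Unset Strict Implicit.
Unset Printing Implicit Defensive.

Import GRing.Theory Order.TTheory Num.Theory.
Local Open Scope ring_scope.

(** * Signed permutations, descents and length *)

(** The form rho_p pi_(w_0(K)) is dictated by the case in which an operator gives 0. If i is not a
    descent of a tableau, passing to s_i lengthens its permutation and keeps all right descents, so
    standardness can only fail through a new descent at some j in K. Since pi_(w_0(K)) = pi_j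
    pi_(w_0(K)), and rho_w pi_j = 0 when j is a right descent of w, the product then vanishes as
    well. The algebra is given by generators and relations, so the independence of the rho_w has to
    be produced: it comes from a representation on functions on the group in which pi_i is the
    pullback along an idempotent map, the coefficients of an element being read off from its effect
    on the delta function at 1. Facts on parabolic subgroups are derived from the order of the
    signed letters: the indices outside I cut the letters into intervals, the parabolic subgroup is
    the stabilizer of these intervals, and minimal representatives and longest elements are those
    that increase, respectively decrease, on each of them. *)

Section SignedPerm.
Variable n : nat.
Implicit Types (i j : 'I_n) (x y : signed n) (w u v : {perm signed n}).

Local Notation W := (signed_perms n).

(* The action of s_i on the values of a word. *)
Definition sI (i : nat) (z : int) : int :=
  if i == 0%N then (if `|z|%N == 1%N then - z else z)
  else if z == i%:Z then i.+1%:Z else if z == i.+1%:Z then i%:Z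
  else if z == - i%:Z then - i.+1%:Z else if z == - i.+1%:Z then - i%:Z else z.

(** The letters j + 1 and j exchanged by s_j. For j = 0 the letter -1 replaces 0, which turns the
    comparison of w(0) = 0 with w(1) into one of w(-1) with w(1). *)
Definition shi j : signed n := (j, false).
Definition slo j : signed n := if j == 0%N :> nat then (j, true) else (ord_pred j, false).

Lemma ord_predE j : (0 < j)%N -> ord_pred j = j.-1 :> nat.
Proof. by case: j => [[|k] lt] //= _; rewrite modnDr modn_small // ltnW. Qed.

Lemma sint_inj : injective (@sint n).
Proof.
move=> [[k kn] [|]] [[l ln] [|]]; rewrite /sint /= => kl;
  (have /eqP kl' : k == l by apply/eqP; lia); move: kn ln kl; rewrite ?kl' => kn ln;
  rewrite ?(bool_irrelevance kn ln) //; lia.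
Qed.

Lemma sint_opp x : sint (sopp x) = - sint x.
Proof. by case: x => k [|]; rewrite /sint /= ?opprK. Qed.

Lemma sint_neq0 x : sint x != 0.
Proof. by case: x => k [|]; rewrite /sint /=; lia. Qed.

Lemma sint_bound x : (0 < `|sint x| <= n)%N.
Proof. by case: x => [[k kn] [|]]; rewrite /sint /=; lia. Qed.

Lemma sintP (z : int) : (0 < `|z| <= n)%N -> exists x, sint x = z.
Proof.
move=> zn; have lt : (`|z|.-1 < n)%N by lia.
by exists (Ordinal lt, z < 0); rewrite /sint /=; case: ifP; lia.
Qed.

Lemma soppK : involutive (@sopp n).
Proof. by case=> k b; rewrite /sopp /= negbK. Qed.

Lemma sint_hi j : sint (shi j) = j.+1%:Z. Proof. by []. Qed.

Lemma sint_lo j : sint (slo j) = if j == 0%N :> nat then -1 else j%:Z.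
Proof.
rewrite /slo; case: ifPn => [/eqP j0|j0]; rewrite /sint /=; first by rewrite j0.
by have := @ord_predE j; rewrite /=; lia.
Qed.

Lemma sint_sgen i x : sint (sgen i x) = sI i (sint x).
Proof.
rewrite permE /sgen_fun /sI; case: x => k b; case: ifPn => [/eqP i0|i0] /=.
  rewrite /sint -(inj_eq val_inj) /= i0.
  by case: eqP => [->|]; case: b => //=; case: eqP; lia.
have ip := ord_predE (j := i); rewrite lt0n i0 in ip; move/(_ isT): ip => ip.
case: tpermP => [->|->|/eqP + /eqP]; rewrite /sint /= -?(inj_eq val_inj) /=; move: ip => /=;
  case: b; do ![case: eqP]; lia.
Qed.

Lemma sgen2 i : (sgen i * sgen i)%g = 1%g.
Proof. by apply/permP => x; rewrite permM !permE sgen_funK. Qed.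
Lemma sgenV i : (sgen i)^-1%g = sgen i.
Proof. by apply/eqP; rewrite eq_invg_mul sgen2. Qed.
Lemma sgenK i : involutive (sgen i).
Proof. by move=> x; rewrite -permM sgen2 perm1. Qed.

Lemma sgen_lo i : sgen i (slo i) = shi i.
Proof. by apply: sint_inj; rewrite sint_sgen sint_lo sint_hi /sI; do ![case: eqP]; lia. Qed.
Lemma sgen_hi i : sgen i (shi i) = slo i.
Proof. by rewrite -sgen_lo sgenK. Qed.
Lemma lt_lohi i : sint (slo i) < sint (shi i).
Proof. by rewrite sint_lo sint_hi; case: eqP; lia. Qed.

(** The letters [slo i] and [shi i] are consecutive, and so are their opposites; exchanging them
    reverses no other comparison. For i = 0 the two exceptions coincide. *)
Lemma sgen_mono i x y : sint x < sint y -> ~ (x = slo i /\ y = shi i) ->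
  ~ (x = sopp (shi i) /\ y = sopp (slo i)) -> sint (sgen i x) < sint (sgen i y).
Proof.
move=> xy h1 h2; rewrite !sint_sgen.
have {}h1 : ~ (sint x = sint (slo i) /\ sint y = sint (shi i)).
  by case=> /sint_inj ? /sint_inj ?; apply: h1.
have {}h2 : ~ (sint x = - sint (shi i) /\ sint y = - sint (slo i)).
  by rewrite -!sint_opp; case=> /sint_inj ? /sint_inj ?; apply: h2.
have := sint_neq0 x; have := sint_neq0 y.
move: h1 h2; rewrite sint_lo sint_hi /sI.
by do ![case: eqP]; lia.
Qed.

Lemma WP w : reflect (forall x, w (sopp x) = sopp (w x)) (w \in W).
Proof. by rewrite inE; apply: (iffP forallP) => h x; apply/eqP. Qed.

Lemma W1 : 1%g \in W. Proof. by apply/WP => x; rewrite !perm1. Qed.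
Lemma WM u v : u \in W -> v \in W -> (u * v)%g \in W.
Proof. by move=> /WP hu /WP hv; apply/WP => x; rewrite !permM hu hv. Qed.
Lemma WV u : u \in W -> u^-1%g \in W.
Proof. by move=> /WP hu; apply/WP => x; apply: (@perm_inj _ u); rewrite hu !permKV. Qed.
Lemma Wgen i : sgen i \in W.
Proof. by apply/WP => x; apply: sint_inj; rewrite sint_opp !sint_sgen sint_opp /sI;
  do ![case: eqP]; lia. Qed.
Lemma WMg i w : ((w * sgen i)%g \in W) = (w \in W).
Proof.
apply/idP/idP => h; last by rewrite WM ?Wgen.
by rewrite -[w]mulg1 -(sgen2 i) mulgA WM ?Wgen.
Qed.
Lemma WgM i w : ((sgen i * w)%g \in W) = (w \in W).
Proof.
apply/idP/idP => h; last by rewrite WM ?Wgen.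
by rewrite -[w]mul1g -(sgen2 i) -mulgA WM ?Wgen.
Qed.

(* Products in {perm _} compose from left to right: [sgen j * w] is w s_j and
   [w * sgen i] is s_i w, so that [DR] and [DL] are the right and left descents. *)
Definition DR j w := sint (w (shi j)) < sint (w (slo j)).
Definition DL i w := DR i w^-1%g.

Lemma DR_neg j w : ~~ DR j w -> sint (w (slo j)) < sint (w (shi j)).
Proof.
rewrite /DR -leNgt le_eqVlt => /orP[/eqP/sint_inj/perm_inj|//].
by move/(congr1 (@sint n)); have := lt_lohi j; lia.
Qed.

Lemma DRs j w : DR j (sgen j * w)%g = ~~ DR j w.
Proof.
rewrite /DR !permM sgen_lo sgen_hi.
by apply/idP/idP; [rewrite -leNgt => /ltW | apply: DR_neg].
Qed.
Lemma DLs i w : DL i (w * sgen i)%g = ~~ DL i w.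
Proof. by rewrite /DL invMg sgenV DRs. Qed.

(* One of the two pairs (x, y), (-y, -x); these stand for the positive roots. *)
Definition pairs : {set signed n * signed n} :=
  [set p | (sint p.1 < sint p.2) && (0 <= sint p.1 + sint p.2)].
Definition inv_set w := [set p in pairs | sint (w p.2) < sint (w p.1)].
Definition len w := #|inv_set w|.

(** By [sgen_mono], composing with s_i only affects the pair of arguments that w sends to [slo i]
    and [shi i], together with the opposite pair; [pairs] contains one of the two. *)
Lemma lenS i w : w \in W -> ~~ DL i w -> len (w * sgen i)%g = (len w).+1.
Proof.
move=> wW /DR_neg lt.
set a := w^-1%g (slo i) in lt; set b := w^-1%g (shi i) in lt.
have wa : w a = slo i by rewrite permKV.
have wb : w b = shi i by rewrite permKV.
have wN := WP _ wW.
pose p := if 0 <= sint a + sint b then (a, b) else (sopp b, sopp a).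
have pP : p \in pairs.
  by rewrite inE /p; case: ifP => /= h; rewrite ?sint_opp; lia.
have pN : p \notin inv_set w.
  rewrite inE negb_and pP /= /p; case: ifP => _ /=; rewrite ?wN wa wb ?sint_opp;
  have := lt_lohi i; lia.
have -> : len (w * sgen i)%g = #|p |: inv_set w|; last by rewrite cardsU1 pN.
congr #|pred_of_set _|; apply/setP => q; rewrite in_setU1.
have [->|qp] /= := eqVneq q p.
  rewrite inE pP /= !permM /p; case: ifP => _ /=; rewrite ?wN wa wb.
    by rewrite sgen_lo sgen_hi lt_lohi.
  have /WP gN := Wgen i.
  by rewrite !gN sgen_lo sgen_hi !sint_opp; have := lt_lohi i; lia.
rewrite !inE; case qP : ((sint q.1 < sint q.2) && (0 <= sint q.1 + sint q.2)) => //=.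
have {}qp : ~ (q = (a, b)) /\ ~ (q = (sopp b, sopp a)).
  move: qP pP qp; rewrite /p inE; case: ifP => h /=; rewrite ?sint_opp => qP h' /eqP qp;
  split=> // qE; move: qP; rewrite qE /= ?sint_opp => ?; last by lia.
  (* Both pairs can lie in [pairs] only if a and b are opposite, and then the pairs coincide. *)
  by apply: qp; rewrite qE; congr (_, _); apply: sint_inj; rewrite sint_opp; lia.
rewrite !permM; case: q qp qP => c d [h1 h2] /= qP.
have [cd|cd|/sint_inj/perm_inj ->] := ltgtP (sint (w d)) (sint (w c)).
- apply: sgen_mono => // -[]; rewrite -?wa -?wb -?wN => /perm_inj dE /perm_inj cE;
    by move: qP; rewrite dE cE ?sint_opp /=; lia.
- apply/negbTE; rewrite -leNgt; apply: ltW; apply: sgen_mono => // -[e1 e2].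
  + by apply: h1; congr (_, _); apply: (@perm_inj _ w); rewrite ?wN ?wa ?wb.
  + by apply: h2; congr (_, _); apply: (@perm_inj _ w); rewrite ?wN ?wa ?wb.
- by rewrite ltxx.
Qed.
End SignedPerm.

Section Words.
Variable n : nat.
Implicit Types (i j : 'I_n) (x y : signed n) (w u v : {perm signed n}) (r s : seq 'I_n).
Implicit Types I J : {set 'I_n}.

Local Notation W := (signed_perms n).

Lemma lenD i w : w \in W -> DL i w -> (len (w * sgen i)%g).+1 = len w.
Proof.
move=> wW d; rewrite -(@lenS _ i) ?WMg // ?DLs ?negbK //.
by rewrite -mulgA sgen2 mulg1.
Qed.

Lemma len1 : len (1%g : {perm signed n}) = 0%N.
Proof.
apply: eq_card0 => p; rewrite !inE !perm1.
by apply/negbTE/negP => /andP[/andP[h _]]; lia.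
Qed.

Lemma word_nil : word_perm [::] = 1%g :> {perm signed n}.
Proof. by rewrite /word_perm big_nil. Qed.
Lemma word_cat r s : word_perm (r ++ s) = (word_perm s * word_perm r)%g.
Proof. by rewrite /word_perm rev_cat big_cat. Qed.
Lemma word1 i : word_perm [:: i] = sgen i.
Proof. by rewrite /word_perm big_seq1. Qed.
Lemma word_cons i r : word_perm (i :: r) = (word_perm r * sgen i)%g.
Proof. by rewrite -cat1s word_cat word1. Qed.
Lemma word_rcons i r : word_perm (rcons r i) = (sgen i * word_perm r)%g.
Proof. by rewrite -cats1 word_cat word1. Qed.
Lemma word_rev r : word_perm (rev r) = (word_perm r)^-1%g.
Proof.
elim: r => [|i r IH]; first by rewrite word_nil invg1.
by rewrite rev_cons word_rcons word_cons IH invMg sgenV.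
Qed.
Lemma word_W r : word_perm r \in W.
Proof. by elim: r => [|i r IH]; rewrite ?word_nil ?W1 // word_cons WMg. Qed.

Lemma len_word r : (len (word_perm r) <= size r)%N.
Proof.
elim: r => [|i r IH]; first by rewrite word_nil len1.
rewrite word_cons /=; have [d|d] := boolP (DL i (word_perm r)).
  by have := lenD (word_W r) d; lia.
by rewrite lenS ?word_W.
Qed.

Definition cnt I (k : 'I_n) : nat := #|[set d : 'I_n | (d \notin I) && (d <= k)%N]|.
(* The indices d outside I separate the values up to d from those above d, and
   likewise for the opposite values: [lab I x] numbers the block containing x. *)
Definition lab I x : int := if x.2 then - (cnt I x.1)%:Z else (cnt I x.1)%:Z.

Lemma cnt_mono I (k l : 'I_n) : (k <= l)%N -> (cnt I k <= cnt I l)%N.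
Proof.
move=> kl; apply: subset_leq_card; apply/subsetP => d; rewrite !inE => /andP[-> h] /=.
exact: leq_trans kl.
Qed.

Lemma lab_opp I x : lab I (sopp x) = - lab I x.
Proof. by case: x => k [|]; rewrite /lab /= ?opprK. Qed.

Lemma lab_mono I x y : sint x <= sint y -> lab I x <= lab I y.
Proof.
case: x y => [k [|]] [l [|]]; rewrite /sint /lab /= => h; try lia.
- by have := @cnt_mono I l k; lia.
- by have := @cnt_mono I k l; lia.
Qed.

(** [cnt] jumps at j exactly when j is outside I. For j = 0 the letters are 1 and -1, whose labels
    are opposite and agree only if they vanish. *)
Lemma lab_lohi I j : (lab I (slo j) == lab I (shi j)) = (j \in I).
Proof.
rewrite /slo /shi /lab; have [j0|j0] /= := eqVneq (nat_of_ord j) 0%N.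
  have -> : cnt I j = (j \notin I).
    rewrite /cnt; case: (boolP (j \in I)) => jI /=.
      apply: eq_card0 => d; rewrite !inE; apply/negbTE/negP => /andP[dI dj].
      by have dE : d = j; [apply: val_inj => /=; lia | rewrite dE jI in dI].
    rewrite -[RHS](cards1 j); congr #|pred_of_set _|; apply/setP => d; rewrite !inE -(inj_eq val_inj) /=.
    apply/idP/idP => [/andP[_]|/eqP dj]; first lia.
    by have -> : d = j; [exact: val_inj | rewrite jI /=].
  by case: (j \in I).
have jp := @ord_predE _ j; rewrite lt0n j0 in jp; move/(_ isT): jp => jp.
have -> : cnt I j = (cnt I (ord_pred j) + (j \notin I))%N.
  rewrite /cnt (cardsD1 j) inE leqnn andbT addnC; congr (_ + _)%N.
  congr #|pred_of_set _|; apply/setP => d; rewrite !inE -(inj_eq val_inj) jp /=.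
  by case: (d \in I) => /=; rewrite ?andbF //; lia.
by case: (j \in I); lia.
Qed.

Lemma lt_lab_lohi I j : j \notin I -> lab I (slo j) < lab I (shi j).
Proof.
move=> jI; rewrite lt_neqAle lab_lohi jI; apply: lab_mono.
by apply: ltW; apply: lt_lohi.
Qed.

(** Every letter but the largest is some [slo j] or the opposite of some [shi j], with successor
    [shi j] or the opposite of [slo j]; the generators thus suffice to climb through all letters. *)
Lemma next_signed x y : sint x < sint y ->
  exists j, (x = slo j /\ sint (shi j) <= sint y) \/
    (x = sopp (shi j) /\ sint (sopp (slo j)) <= sint y).
Proof.
move=> xy; have xn := sint_bound x; have yn := sint_bound y; have y0 := sint_neq0 y.
have x0 := sint_neq0 x.
have [xp|xp] := boolP (0 < sint x).
  have lt : (`|sint x| < n)%N by lia.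
  exists (Ordinal lt); left; split; last by rewrite sint_hi /=; lia.
  by apply: sint_inj; rewrite sint_lo /=; case: eqP; lia.
have [x1|x1] := eqVneq (sint x) (-1).
  have lt : (0 < n)%N by lia.
  exists (Ordinal lt); left; split; last by rewrite sint_hi /=; lia.
  by apply: sint_inj; rewrite sint_lo /=.
have lt : (`|sint x|.-1 < n)%N by lia.
exists (Ordinal lt); right; rewrite sint_opp sint_lo /=; split.
  by apply: sint_inj; rewrite sint_opp sint_hi /=; lia.
by case: eqP; lia.
Qed.

(** Labels are monotone, so the letters between two letters of a block stay in it and each step
    between neighbours comes from an index in I. This turns conditions at single indices into
    monotonicity on whole blocks. *)
Lemma chain I (R : signed n -> signed n -> Prop) :
  (forall y x z, R x y -> R y z -> R x z) ->
  (forall j, j \in I -> R (slo j) (shi j)) ->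
  (forall j, j \in I -> R (sopp (shi j)) (sopp (slo j))) ->
  forall x y, sint x < sint y -> lab I x = lab I y -> R x y.
Proof.
move=> Rt R1 R2 x y; have [m] := ubnP `|sint y - sint x|%N.
elim: m x => // m IH x lt xy lxy.
suff [z [Rxz xz zy]] : exists z, [/\ R x z, sint x < sint z & sint z <= sint y].
  have [/sint_inj <- //|zy'] := eqVneq (sint z) (sint y).
  apply: (Rt z) => //; apply: IH; try lia.
  by have := lab_mono I (ltW xz); have := lab_mono I zy; lia.
have [j [[xE le]|[xE le]]] := next_signed xy.
  have xz := lt_lohi j; rewrite -xE in xz.
  exists (shi j); split => //; rewrite xE; apply: R1; rewrite -lab_lohi -xE.
  by have := lab_mono I (ltW xz); have := lab_mono I le; lia.
have xz : sint x < sint (sopp (slo j)) by rewrite xE !sint_opp; have := lt_lohi j; lia.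
exists (sopp (slo j)); split => //; rewrite xE; apply: R2; rewrite -lab_lohi.
have := lab_mono I (ltW xz); have := lab_mono I le.
by move: lxy; rewrite xE !lab_opp; lia.
Qed.

Lemma chain_incr I w : w \in W -> (forall j, j \in I -> ~~ DR j w) ->
  forall x y, sint x < sint y -> lab I x = lab I y -> sint (w x) < sint (w y).
Proof.
move=> /WP wW h; apply: chain => [y x z /lt_trans h1 /h1 //|j /h /DR_neg //|j /h /DR_neg].
by rewrite !wW !sint_opp; lia.
Qed.

Lemma chain_decr I w : w \in W -> (forall j, j \in I -> DR j w) ->
  forall x y, sint x < sint y -> lab I x = lab I y -> sint (w y) < sint (w x).
Proof.
move=> /WP wW h; apply: chain => [y x z h1 /lt_trans /(_ h1) //|j /h //|j /h].
by rewrite /DR !wW !sint_opp; lia.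
Qed.

Lemma labT x : lab setT x = 0.
Proof.
have c0 k : cnt setT k = 0%N by apply: eq_card0 => d; rewrite !inE.
by rewrite /lab c0; case: ifP.
Qed.

Lemma DR0_eq1 w : w \in W -> (forall j, ~~ DR j w) -> w = 1%g.
Proof.
move=> wW h; have {h} mono x y : sint x < sint y -> sint (w x) < sint (w y).
  by move=> xy; apply: (@chain_incr setT); rewrite ?labT.
(* The number of smaller letters is invariant under an order-preserving permutation and determines
   the letter. *)
pose rk (x : signed n) := #|[set y : signed n | sint y < sint x]|.
have rkw x : rk (w x) = rk x.
  rewrite /rk -[RHS](card_imset _ (@perm_inj _ w)); congr #|pred_of_set _|; apply/setP => y.
  rewrite inE; apply/idP/imsetP => [h|[z + ->]]; last by rewrite inE; apply: mono.
  exists (w^-1%g y); rewrite ?permKV // inE.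
  have [lt|//|/sint_inj e] := ltgtP (sint x) (sint (w^-1%g y)).
    by have := mono _ _ lt; rewrite permKV; lia.
  by move: h; rewrite e permKV ltxx.
have rk_lt x y : sint x < sint y -> (rk x < rk y)%N.
  move=> xy; apply: proper_card; apply/properP; split.
    by apply/subsetP => z; rewrite !inE => /lt_trans; apply.
  by exists x; rewrite inE ?ltxx.
apply/permP => x; rewrite perm1.
have := rkw x; have [/rk_lt|/rk_lt|/sint_inj //] := ltgtP (sint x) (sint (w x)); lia.
Qed.

Lemma exDR w : w \in W -> w != 1%g -> exists j, DR j w.
Proof.
move=> wW w1; apply/existsP; apply: contraNT w1 => /existsPn h.
by apply/eqP; apply: DR0_eq1.
Qed.

Lemma word_ex w : w \in W -> exists2 r, word_perm r = w & size r = len w.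
Proof.
have [m] := ubnP (len w); elim: m w => // m IH w lt wW.
have [->|w1] := eqVneq w 1%g; first by exists [::]; rewrite ?word_nil ?len1.
have /(exDR (WV wW)) [j d] : w^-1%g != 1%g by rewrite invg_eq1.
have l := lenD wW d; have [||r rw rs] := IH (w * sgen j)%g; rewrite ?WMg //; first lia.
exists (j :: r); first by rewrite word_cons rw -mulgA sgen2 mulg1.
by rewrite /= rs.
Qed.

Lemma lenV w : w \in W -> len w^-1%g = len w.
Proof.
have le v : v \in W -> (len v^-1%g <= len v)%N.
  by move=> /word_ex[r <- <-]; rewrite -word_rev -(size_rev r) len_word.
by move=> wW; apply/eqP; rewrite eqn_leq le //= -{1}[w]invgK le // WV.
Qed.

Lemma lenSr j w : w \in W -> ~~ DR j w -> len (sgen j * w)%g = (len w).+1.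
Proof.
move=> wW d; rewrite -lenV ?WgM // invMg sgenV lenS ?WV ?lenV //.
by rewrite /DL invgK.
Qed.
Lemma lenDr j w : w \in W -> DR j w -> (len (sgen j * w)%g).+1 = len w.
Proof.
move=> wW d; rewrite -(@lenSr j) ?WgM // ?DRs ?negbK //.
by rewrite mulgA sgen2 mul1g.
Qed.

Definition red r := size r == len (word_perm r).

Lemma red_cons i r : red (i :: r) -> red r /\ DL i (word_perm (i :: r)).
Proof.
rewrite /red /= word_cons => /eqP e; have := len_word r.
have [d|d] := boolP (DL i (word_perm r)).
  by have := lenD (word_W r) d; lia.
by move: e; rewrite lenS ?word_W // DLs => -[->].
Qed.

(** Reconciles the two lengths: [redword] is minimal among all words, and [word_ex] provides a word
    with as many letters as there are inversions. *)
Lemma redwordPW w : w \in W -> word_perm (redword w) = w /\ size (redword w) = len w.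
Proof.
move=> wW; have [r rw rs] := word_ex wW.
have gw : w \in parabolic_subgroup [set: 'I_n].
  rewrite -rw; elim: {rw rs} r => [|i r IH]; first by rewrite word_nil group1.
  rewrite word_cons groupM //; apply: mem_gen; exact: imset_f.
have [h1 h2] := redwordP gw; split => //.
have := h2 _ rw; have := len_word (redword w); rewrite h1; lia.
Qed.

Lemma red_redword w : w \in W -> red (redword w).
Proof. by move=> /redwordPW[h1 h2]; rewrite /red h1 h2. Qed.

(** Exchanging two letters that stand in increasing order can create a descent but not remove one.
    This is what preserves the forced descents when an operator moves a tableau. *)
Lemma DR_up i j w : w \in W -> ~~ DL i w -> DR j w -> DR j (w * sgen i)%g.
Proof.
move=> wW /DR_neg d1 d2; rewrite /DR !permM; apply: sgen_mono => // -[e1 e2].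
  by move: d1; rewrite -e1 -e2 !permK; have := lt_lohi j; lia.
have {}wW := WP _ (WV wW).
have f1 : sopp (w (shi j)) = shi i by rewrite e1 soppK.
have f2 : sopp (w (slo j)) = slo i by rewrite e2 soppK.
by move: d1; rewrite -f1 -f2 !wW !permK !sint_opp; have := lt_lohi j; lia.
Qed.

End Words.

(** * Matsumoto's theorem for reduced words *)

Section Braids.
Variable n : nat.
Implicit Types (i j : 'I_n) (x y : signed n) (w u v : {perm signed n}) (r s t : seq 'I_n).

Local Notation W := (signed_perms n).

Lemma ord_neq (a c : 'I_n) : a != c :> nat -> a != c.
Proof. by apply: contraNN => /eqP ->. Qed.

Lemma sgen_comm i j : (i.+1 < j)%N -> (sgen i * sgen j = sgen j * sgen i)%g.
Proof.
move=> ij; have j0 : (j == 0%N :> nat) = false by lia.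
apply/permP => -[k b]; rewrite !permM !permE /sgen_fun j0 /=.
have jp : ord_pred j = j.-1 :> nat by rewrite ord_predE //; lia.
have [i0|i0] /= := eqVneq (nat_of_ord i) 0%N.
  by case: tpermP => [->|->|//]; congr (_, _ (+) _); rewrite -!(inj_eq val_inj); move: jp => /=; lia.
have ip : ord_pred i = i.-1 :> nat by rewrite ord_predE //; lia.
congr (_, _).
have tD z (a c : 'I_n) : a != z -> c != z -> tperm a c z = z by exact: tpermD.
have h1 : ord_pred i != ord_pred j by apply: ord_neq; lia.
have h2 : ord_pred i != j by apply: ord_neq; lia.
have h3 : i != ord_pred j by apply: ord_neq; lia.
have h4 : i != j by apply: ord_neq; lia.
case: (tpermP (ord_pred j) j k) => [->|->|/eqP k1 /eqP k2].
- by rewrite (tD j _ _ h2 h4) (tD (ord_pred j) _ _ h1 h3) tpermL.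
- by rewrite (tD j _ _ h2 h4) (tD (ord_pred j) _ _ h1 h3) tpermR.
- by case: (tpermP (ord_pred i) i k) => [_|_|_ _]; rewrite tD // eq_sym.
Qed.

Lemma sgen_braid3 i j : (0 < i)%N -> j = i.+1 :> nat ->
  (sgen i * sgen j * sgen i = sgen j * sgen i * sgen j)%g.
Proof.
move=> i0 ji; apply/permP => -[k b]; rewrite !permM !permE /sgen_fun.
have -> : (i == 0%N :> nat) = false by lia.
have -> : (j == 0%N :> nat) = false by lia.
congr (_, _) => /=.
have -> : ord_pred j = i by apply: ord_inj; rewrite ord_predE ji.
have ip : ord_pred i = i.-1 :> nat by rewrite ord_predE //; lia.
have h1 : ord_pred i != i by apply: ord_neq; lia.
have h2 : ord_pred i != j by apply: ord_neq; lia.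
have h3 : i != j by apply: ord_neq; lia.
have e1 : tperm (ord_pred i) i j = j by rewrite tpermD.
have e2 : tperm i j (ord_pred i) = ord_pred i by rewrite tpermD // eq_sym.
have [->|k1] := eqVneq k (ord_pred i); first by rewrite !(tpermL, tpermR, e1, e2).
have [->|k2] := eqVneq k i; first by rewrite !(tpermL, tpermR, e1, e2).
have [->|k3] := eqVneq k j; first by rewrite !(tpermL, tpermR, e1, e2).
by rewrite !(@tpermD _ _ _ k) // eq_sym.
Qed.

Lemma sgen_braid4 i j : i = 0%N :> nat -> j = 1%N :> nat ->
  (sgen i * sgen j * sgen i * sgen j = sgen j * sgen i * sgen j * sgen i)%g.
Proof.
move=> i0 j1; apply/permP => -[k b]; rewrite !permM !permE /sgen_fun i0 j1 /=.
have -> : ord_pred j = i by apply: ord_inj; rewrite ord_predE j1 // i0.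
have h : i != j by apply: ord_neq; rewrite i0 j1.
have h' : (j == i) = false by rewrite eq_sym (negbTE h).
have [->|k1] := eqVneq k i; first by rewrite !(eqxx, tpermL, tpermR, h', h); case: b.
have [->|k2] := eqVneq k j; first by rewrite !(eqxx, tpermL, tpermR, h', h); case: b.
have e : tperm i j k = k by rewrite tpermD // eq_sym.
by rewrite !e (negbTE k1) !addbF.
Qed.

Lemma DLM j w v : DL j (w * v)%g =
  (sint (w^-1%g (v^-1%g (shi j))) < sint (w^-1%g (v^-1%g (slo j)))).
Proof. by rewrite /DL /DR invMg !permM. Qed.
Lemma DLE j w : DL j w = (sint (w^-1%g (shi j)) < sint (w^-1%g (slo j))).
Proof. by []. Qed.

Lemma sgen_far i j : (i.+1 < j)%N ->
  [/\ sgen i (slo j) = slo j, sgen i (shi j) = shi j,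
      sgen j (slo i) = slo i & sgen j (shi i) = shi i].
Proof.
by move=> ij; split; apply: sint_inj; rewrite sint_sgen ?sint_lo ?sint_hi /sI; do ![case: eqP]; lia.
Qed.

Lemma sgen_near i j : (0 < i)%N -> j = i.+1 :> nat ->
  [/\ slo j = shi i, sgen i (shi j) = shi j & sgen j (slo i) = slo i].
Proof.
by move=> i0 ij; split; apply: sint_inj; rewrite ?sint_sgen ?sint_lo ?sint_hi /sI; do ![case: eqP]; lia.
Qed.

Lemma sgen_four i j : i = 0%N :> nat -> j = 1%N :> nat ->
  [/\ slo i = sopp (shi i), slo j = shi i & sgen i (shi j) = shi j].
Proof.
by move=> i0 ij; split; apply: sint_inj; rewrite ?sint_sgen ?sint_opp ?sint_lo ?sint_hi /sI; do ![case: eqP]; lia.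
Qed.

(** Stated for an arbitrary ring because the results on reduced words are applied both to the pi_i
    and to the pi_i - 1. *)
Definition braided (R : pzRingType) (b : 'I_n -> R) : Prop :=
  [/\ forall i j, (i.+1 < j)%N -> b i * b j = b j * b i,
      forall i j, (0 < i)%N -> j = i.+1 :> nat -> b i * b j * b i = b j * b i * b j
    & forall i j, i = 0%N :> nat -> j = 1%N :> nat ->
        b i * b j * b i * b j = b j * b i * b j * b i].

Definition bw (R : pzRingType) (b : 'I_n -> R) r : R := \prod_(i <- r) b i.

Lemma bw_cat (R : pzRingType) (b : 'I_n -> R) r s : bw b (r ++ s) = bw b r * bw b s.
Proof. by rewrite /bw big_cat. Qed.
Lemma bw_cons (R : pzRingType) (b : 'I_n -> R) i s : bw b (i :: s) = b i * bw b s.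
Proof. by rewrite /bw big_cons. Qed.
Lemma bw_nil (R : pzRingType) (b : 'I_n -> R) : bw b [::] = 1.
Proof. by rewrite /bw big_nil. Qed.

Lemma mulsgK i w : (w * sgen i * sgen i)%g = w.
Proof. by rewrite -mulgA sgen2 mulg1. Qed.

(** In its instances [i :: A] and [j :: B] are the two sides of the braid relation, that is, the two
    reduced words of the longest element of the dihedral subgroup of s_i and s_j. *)
Definition ordersw i j A B :=
  [/\ word_perm (i :: A) = word_perm (j :: B), size A = size B &
    forall (R : pzRingType) (b : 'I_n -> R), braided b -> bw b (i :: A) = bw b (j :: B)].

Lemma red_drop i w : w \in W -> DL i w ->
  [/\ (w * sgen i)%g \in W & (len (w * sgen i)%g).+1 = len w].
Proof. by move=> wW d; rewrite WMg lenD. Qed.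

(** The letters i and j are stripped alternately from w; comparing the positions of the values they
    move shows that each is still a left descent when its turn comes. The cases are the orders 2, 4
    and 3 of s_i s_j. *)
Lemma dihedral_lt i j w : (i < j)%N -> w \in W -> DL i w -> DL j w ->
  exists A B t, [/\ ordersw i j A B, word_perm ((i :: A) ++ t) = w
    & ((size A).+1 + size t)%N = len w].
Proof.
move=> ij wW di dj.
have [far|near] := ltnP i.+1 j.
  have [f1 f2 f3 f4] := sgen_far far.
  have [w1 l1] := red_drop wW di.
  have [|w2 l2] := red_drop w1 (_ : DL j _); first by rewrite DLM !sgenV f1 f2.
  have [t tw ts] := word_ex w2.
  exists [:: j], [:: i], t; split.
  - split=> // [|R b [h _ _]]; first by rewrite !word_cons word_nil !mul1g (sgen_comm far).
    by rewrite !bw_cons !bw_nil !mulr1 h.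
  - by rewrite word_cat tw !word_cons word_nil !mul1g !mulgA !mulsgK.
  - by rewrite ts /=; lia.
have ji : j = i.+1 :> nat by lia.
have [i0|i0] := posnP i.
  have ji' : j = 1%N :> nat by lia.
  have [f1 f2 f3] := sgen_four i0 ji'.
  have f4 := sgen_hi j; have f5 := sgen_lo j; rewrite f2 in f4 f5.
  have f6 := sgen_hi i; rewrite f1 in f6.
  have f7 x : sgen i (sopp x) = sopp (sgen i x) by apply: (WP _ (Wgen i)).
  have f8 x : sgen j (sopp x) = sopp (sgen j x) by apply: (WP _ (Wgen j)).
  have f9 x : sint (w^-1%g (sopp x)) = - sint (w^-1%g x) by rewrite (WP _ (WV wW)) sint_opp.
  have ff := (f1, f2, f3, f4, f5, f6, f7, f8, f9, soppK).
  move: (di) (dj); rewrite !DLE !ff => ci cj.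
  have [w1 l1] := red_drop wW di.
  have [|w2 l2] := red_drop w1 (_ : DL j _); first by rewrite DLM !sgenV !ff; lia.
  have [|w3 l3] := red_drop w2 (_ : DL i _); first by rewrite -!mulgA DLM !invMg !permM !sgenV !ff; lia.
  have [|w4 l4] := red_drop w3 (_ : DL j _); first by rewrite -!mulgA DLM !invMg !permM !sgenV !ff; lia.
  have [t tw ts] := word_ex w4.
  exists [:: j; i; j], [:: i; j; i], t; split.
  - split=> // [|R b [_ _ h]].
      by rewrite !word_cons word_nil !mul1g (sgen_braid4 i0 ji').
    by rewrite !bw_cons !bw_nil !mulr1 !mulrA h.
  - by rewrite word_cat tw !word_cons word_nil !mul1g !mulgA !mulsgK.
  - by rewrite ts /=; lia.
have [f1 f2 f3] := sgen_near i0 ji.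
have f4 := sgen_hi j; have f5 := sgen_lo j; rewrite f1 in f4 f5.
have ff := (f1, f2, f3, f4, f5, sgen_hi i, sgen_lo i).
move: (di) (dj); rewrite !DLE !ff => ci cj.
have [w1 l1] := red_drop wW di.
have [|w2 l2] := red_drop w1 (_ : DL j _); first by rewrite DLM !sgenV !ff; lia.
have [|w3 l3] := red_drop w2 (_ : DL i _); first by rewrite -!mulgA DLM !invMg !permM !sgenV !ff; lia.
have [t tw ts] := word_ex w3.
exists [:: j; i], [:: i; j], t; split.
- split=> // [|R b [_ h _]]; first by rewrite !word_cons word_nil !mul1g (sgen_braid3 i0 ji).
  by rewrite !bw_cons !bw_nil !mulr1 !mulrA h.
- by rewrite word_cat tw !word_cons word_nil !mul1g !mulgA !mulsgK.
- by rewrite ts /=; lia.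
Qed.

Lemma dihedral i j w : i != j -> w \in W -> DL i w -> DL j w ->
  exists A B t, [/\ ordersw i j A B, word_perm ((i :: A) ++ t) = w
    & ((size A).+1 + size t)%N = len w].
Proof.
move=> ij wW di dj; have [lt|gt|/val_inj e] := ltngtP i j.
- exact: dihedral_lt.
- have [A [B [t [[h1 h2 h3] h4 h5]]]] := dihedral_lt gt wW dj di.
  exists B, A, t; split; last by rewrite -h2.
  - by split=> // R b hb; rewrite h3.
  - by rewrite -h4 !word_cat h1.
- by rewrite e eqxx in ij.
Qed.

(** Equal first letters are cancelled. Distinct first letters i and j are both left descents, and
    [dihedral] supplies two intermediate reduced words that begin with i and j, share the tail t and
    differ by one braid relation. *)
Lemma matsumoto (R : pzRingType) (b : 'I_n -> R) : braided b ->
  forall r s, red r -> red s -> word_perm r = word_perm s -> bw b r = bw b s.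
Proof.
move=> hb r; have [m] := ubnP (size r); elim: m r => // m IH [|i r] lt s.
  by rewrite /red => _ /eqP + e; rewrite -e word_nil len1 => /size0nil ->.
case: s => [|j s] rr rs e.
  by move: rr; rewrite /red e word_nil len1.
have [rr' di] := red_cons rr; have [rs' dj] := red_cons rs.
rewrite !bw_cons; have [eij|ij] := eqVneq i j.
  rewrite -{j}eij in rs e dj *; congr (_ * _); apply: IH => //.
  by apply: (@mulIg _ (sgen i)); rewrite -!word_cons.
set w := word_perm (i :: r) in e di dj; rewrite -e in dj.
have wW : w \in W by apply: word_W.
have [A [B [t [[h1 h2 h3] h4 h5]]]] := dihedral ij wW di dj.
have szr : (size r).+1 = len w by apply/eqP.
have szs : (size s).+1 = len w by rewrite e; apply/eqP.
have h4' : word_perm ((j :: B) ++ t) = w by rewrite -h4 !word_cat h1.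
have aux k p q : word_perm (k :: p) = w -> word_perm (k :: q) = w -> red p -> (size p).+1 = len w ->
    size p = size q -> word_perm p = word_perm q /\ red q.
  rewrite /red !word_cons => <- e2 /eqP rp sp spq; have e3 := mulIg _ _ _ e2.
  by rewrite e3 -spq rp.
have [e1 q1] : word_perm r = word_perm (A ++ t) /\ red (A ++ t).
  by apply: (aux i) => //; rewrite size_cat; lia.
have [e2 q2] : word_perm s = word_perm (B ++ t) /\ red (B ++ t).
  by apply: (aux j) => //; rewrite size_cat; lia.
rewrite (IH r _ (A ++ t)) // (IH s _ (B ++ t)) //; last by move: lt => /=; lia.
by rewrite !bw_cat !mulrA -!bw_cons h3.
Qed.

(* pi_i acts on the functions on W by pullback along [demaz i]. *)
Definition demaz i w := if DL i w then (w * sgen i)%g else w.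

Lemma demazW i w : w \in W -> demaz i w \in W.
Proof. by rewrite /demaz; case: ifP; rewrite ?WMg. Qed.

Lemma demaz_id i w : demaz i (demaz i w) = demaz i w.
Proof. by rewrite /demaz; case: (boolP (DL i w)) => d; rewrite ?DLs ?d // (negbTE d). Qed.

Lemma demaz_comm i j w : (i.+1 < j)%N -> demaz i (demaz j w) = demaz j (demaz i w).
Proof.
move=> ij; have [f1 f2 f3 f4] := sgen_far ij.
have e1 : DL i (w * sgen j)%g = DL i w by rewrite DLM !sgenV f3 f4.
have e2 : DL j (w * sgen i)%g = DL j w by rewrite DLM !sgenV f1 f2.
rewrite /demaz; case: (boolP (DL j w)) => dj; case: (boolP (DL i w)) => di;
  rewrite ?e1 ?e2 ?(negbTE di) ?(negbTE dj) ?di ?dj //.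
by rewrite -!mulgA (sgen_comm ij).
Qed.

(** Whether each map acts depends only on the relative order of the positions of three consecutive
    values. With these comparisons replaced by booleans, the transitivity constraints [h1] and [h2]
    discard the impossible cases. *)
Lemma demaz_braid3 i j w : (0 < i)%N -> j = i.+1 :> nat ->
  demaz i (demaz j (demaz i w)) = demaz j (demaz i (demaz j w)).
Proof.
move=> i0 ji; have [f1 f2 f3] := sgen_near i0 ji.
have f4 := sgen_hi j; have f5 := sgen_lo j; rewrite f1 in f4 f5.
have ff := (f1, f2, f3, f4, f5, sgen_hi i, sgen_lo i).
pose x z := sint (w^-1%g z).
have d1 : DL i w = (x (shi i) < x (slo i)) by [].
have d2 : DL j w = (x (shi j) < x (shi i)) by rewrite DLE f1.
have d3 : DL j (w * sgen i)%g = (x (shi j) < x (slo i)) by rewrite DLM !sgenV !ff.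
have d4 : DL i (w * sgen j)%g = (x (shi j) < x (slo i)) by rewrite DLM !sgenV !ff.
have d5 : DL i (w * sgen i * sgen j)%g = (x (shi j) < x (shi i)).
  by rewrite -!mulgA DLM !invMg !permM !sgenV !ff.
have d6 : DL j (w * sgen j * sgen i)%g = (x (shi i) < x (slo i)).
  by rewrite -!mulgA DLM !invMg !permM !sgenV !ff.
have br : (w * sgen i * sgen j * sgen i = w * sgen j * sgen i * sgen j)%g.
  by rewrite -!mulgA; congr (_ * _)%g; rewrite !mulgA (sgen_braid3 i0 ji).
have h1 : x (shi i) < x (slo i) -> x (shi j) < x (shi i) -> x (shi j) < x (slo i) by lia.
have h2 : ~~ (x (shi i) < x (slo i)) -> ~~ (x (shi j) < x (shi i)) -> ~~ (x (shi j) < x (slo i)) by lia.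
clear ff f1 f2 f3 f4 f5.
move: (x (shi i) < x (slo i)) (x (shi j) < x (shi i)) (x (shi j) < x (slo i)) d1 d2 d3 d4 d5 d6 h1 h2 => {x} p q t.
case: p; case: q; case: t => d1 d2 d3 d4 d5 d6 h1 h2;
  by [move: (h1 isT isT) | move: (h2 isT isT)
     | rewrite /demaz; do 7?rewrite ?d1 ?d2 ?d3 ?d4 ?d5 ?d6 ?DLs /=; rewrite ?br].
Qed.

Lemma demaz_braid4 i j w : w \in W -> i = 0%N :> nat -> j = 1%N :> nat ->
  demaz i (demaz j (demaz i (demaz j w))) = demaz j (demaz i (demaz j (demaz i w))).
Proof.
move=> wW i0 j1; have [f1 f2 f3] := sgen_four i0 j1.
have f4 := sgen_hi j; have f5 := sgen_lo j; rewrite f2 in f4 f5.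
have f6 := sgen_hi i; rewrite f1 in f6.
have f7 x : sgen i (sopp x) = sopp (sgen i x) by apply: (WP _ (Wgen i)).
have f8 x : sgen j (sopp x) = sopp (sgen j x) by apply: (WP _ (Wgen j)).
have f9 x : sint (w^-1%g (sopp x)) = - sint (w^-1%g x) by rewrite (WP _ (WV wW)) sint_opp.
have ff := (f1, f2, f3, f4, f5, f6, f7, f8, f9, soppK).
pose a := sint (w^-1%g (shi i)); pose b := sint (w^-1%g (shi j)).
have d1 : DL i w = (a < - a) by rewrite DLE !ff.
have d2 : DL j w = (b < a) by rewrite DLE !ff.
have d3 : DL j (w * sgen i)%g = (b < - a) by rewrite DLM !sgenV !ff.
have d4 : DL i (w * sgen j)%g = (b < - b) by rewrite DLM !sgenV !ff.
have d5 : DL i (w * sgen i * sgen j)%g = (b < - b).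
  by rewrite -!mulgA DLM !invMg !permM !sgenV !ff.
have d6 : DL j (w * sgen j * sgen i)%g = (a < - b).
  by rewrite -!mulgA DLM !invMg !permM !sgenV !ff.
have d7 : DL j (w * sgen i * sgen j * sgen i)%g = (- a < - b).
  by rewrite -!mulgA DLM !invMg !permM !sgenV !ff.
have d8 : DL i (w * sgen j * sgen i * sgen j)%g = (a < - a).
  by rewrite -!mulgA DLM !invMg !permM !sgenV !ff.
have br : (w * sgen i * sgen j * sgen i * sgen j = w * sgen j * sgen i * sgen j * sgen i)%g.
  by rewrite -!mulgA; congr (_ * _)%g; rewrite !mulgA (sgen_braid4 i0 j1).
have {}d7 : DL j (w * sgen i * sgen j * sgen i)%g = (b < a) by rewrite d7 ltrN2.
have {}d6 : DL j (w * sgen j * sgen i)%g = (b < - a) by rewrite d6 ltrNr.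
(* These constraints on the signs and the order of the nonzero integers a and b leave eight of the
   sixteen cases. *)
have [h1 h2 h3 h4] : [/\ a < - a -> b < - b -> b < - a, ~~ (a < - a) -> ~~ (b < - b) -> ~~ (b < - a),
    a < - a -> ~~ (b < - b) -> ~~ (b < a) & ~~ (a < - a) -> b < - b -> b < a].
  have b0 : b != 0 by apply: sint_neq0.
  have a0 : a != 0 by apply: sint_neq0.
  by move: (a) (b) a0 b0; clear => a b; split; lia.
clear ff f1 f2 f3 f4 f5 f6 f7 f8 f9.
move: (a < - a) (b < - b) (b < a) (b < - a) d1 d2 d3 d4 d5 d6 d7 d8 h1 h2 h3 h4 => {a b} p q t s.
case: p; case: q; case: t; case: s => d1 d2 d3 d4 d5 d6 d7 d8 h1 h2 h3 h4;
  by [move: (h1 isT isT) | move: (h2 isT isT) | move: (h3 isT isT) | move: (h4 isT isT)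
     | rewrite /demaz; do 9?rewrite ?d1 ?d2 ?d3 ?d4 ?d5 ?d6 ?d7 ?d8 ?DLs /=; rewrite ?br].
Qed.

End Braids.

(** * The basis of the Hecke algebra *)

Section ReducedProducts.
Variables (n : nat) (R : pzRingType) (b : 'I_n -> R).
Hypothesis hb : braided b.
Implicit Types (i j : 'I_n) (w u v : {perm signed n}) (r s t : seq 'I_n).
Local Notation W := (signed_perms n).

Definition pw w := bw b (redword w).

Lemma pw_word r : red r -> bw b r = pw (word_perm r).
Proof.
move=> rr; apply: matsumoto => //; first by rewrite red_redword ?word_W.
by have [-> _] := redwordPW (word_W r).
Qed.

Lemma pw1 : pw 1 = 1.
Proof. by rewrite -[RHS](@bw_nil n R b) pw_word ?word_nil // /red word_nil len1. Qed.

Lemma pwL i w : w \in W -> ~~ DL i w -> b i * pw w = pw (w * sgen i)%g.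
Proof.
move=> wW d; have [h1 h2] := redwordPW wW.
rewrite /pw -bw_cons pw_word ?word_cons ?h1 //.
by rewrite /red word_cons h1 /= h2 lenS.
Qed.

Lemma pwR j w : w \in W -> ~~ DR j w -> pw w * b j = pw (sgen j * w)%g.
Proof.
move=> wW d; have [h1 h2] := redwordPW wW.
rewrite -[b j]mulr1 -(@bw_nil n R b) -bw_cons /pw -bw_cat cats1 pw_word ?word_rcons ?h1 //.
by rewrite /red word_rcons h1 size_rcons h2 lenSr.
Qed.

End ReducedProducts.

(** * Modules over the free algebra *)

Section FreeAction.
Variables (F : fieldType) (X : choiceType) (V : lmodType F) (op : X -> V -> V).
Hypothesis opL : forall i c u v, op i (c *: u + v) = c *: op i u + op i v.

Definition wact (k : {fmonom X}) (v : V) : V := foldr op v (k : seq X).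
Definition freeact (f : freealg F X) (v : V) : V := \sum_(k <- msupp f) f@_k *: wact k v.

Lemma freeactEw (d : {fset {fmonom X}}) f v : (msupp f `<=` d)%fset ->
  freeact f v = \sum_(k <- d) f@_k *: wact k v.
Proof.
move=> le; rewrite [LHS](big_fset_incl _ le) => //= x xd /mcoeff_outdom ->.
by rewrite scale0r.
Qed.

Lemma freeact_lin c f g v : freeact (c *: f + g) v = c *: freeact f v + freeact g v.
Proof.
pose d := (msupp f `|` msupp g)%fset.
rewrite !(@freeactEw d) ?fsubsetUl ?fsubsetUr //.
  by rewrite scaler_sumr -big_split; apply: eq_bigr => k _; rewrite /= mcoeffD mcoeffZ scalerDl scalerA.
apply: fsubset_trans (msuppD_le _ _) _; apply: fsetSU; exact: msuppZ_le.
Qed.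

Lemma freeactU k v : freeact << k >> v = wact k v.
Proof. by rewrite (freeactEw _ (msuppU_le)) big_seq_fset1 mcoeffUU scale1r. Qed.

Lemma freeact0 v : freeact 0 v = 0.
Proof. by rewrite /freeact msupp0 big_nil. Qed.

Lemma malg_ind (S : freealg F X -> Prop) : S 0 ->
  (forall c f g, S f -> S g -> S (c *: f + g)) -> (forall k, S << k >>) -> forall f, S f.
Proof.
move=> S0 SD SU f; rewrite [f]monalgE; elim: (msupp f : seq _) => [|k s IH].
  by rewrite big_nil.
rewrite big_cons; have -> : << f@_k *g k >> = f@_k *: << k >> :> {malg F[{fmonom X}]}.
  by apply/malgP => j; rewrite mcoeffZ !mcoeffU mulrnAr mulr1.
exact: SD.
Qed.

Lemma op0 i : op i 0 = 0.
Proof.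
by have := opL i 1 0 0; rewrite !scale1r addr0 => /(congr1 (fun x => x - op i 0)); rewrite addrK subrr.
Qed.

Lemma wact_lin k c u v : wact k (c *: u + v) = c *: wact k u + wact k v.
Proof. by case: k => s; rewrite /wact /=; elim: s => //= i s ->; rewrite opL. Qed.

Lemma freeact_linr f c u v : freeact f (c *: u + v) = c *: freeact f u + freeact f v.
Proof.
rewrite /freeact scaler_sumr -big_split; apply: eq_bigr => k _ /=.
by rewrite wact_lin scalerDr !scalerA mulrC.
Qed.

Lemma freeact0r f : freeact f 0 = 0.
Proof.
by have := freeact_linr f 1 0 0; rewrite !scale1r addr0 => /(congr1 (fun x => x - freeact f 0)); rewrite addrK subrr.
Qed.

Lemma freeactM f g v : freeact (f * g) v = freeact f (freeact g v).
Proof.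
elim/malg_ind: f => [|c f f' IH IH'|k]; first by rewrite mul0r !freeact0.
  set p := f * g in IH *; set p' := f' * g in IH' *.
  have -> : (c *: f + f') * g = c *: p + p'.
    by rewrite [LHS](mulrDl (c *: f)); congr (_ + _); rewrite [RHS](scalerAl c f g).
  rewrite [LHS]freeact_lin [RHS]freeact_lin.
  by congr (_ *: _ + _); [exact: IH | exact: IH'].
pose u : freealg F X := << k >>; rewrite -/u.
elim/malg_ind: g => [|c g g' IH IH'|l]; first by rewrite mulr0 !freeact0 freeact0r.
  set p := u * g in IH *; set p' := u * g' in IH' *.
  have -> : u * (c *: g + g') = c *: p + p'.
    by rewrite [LHS](mulrDr u); congr (_ + _); rewrite [RHS](scalerAr c u g).
  rewrite [LHS]freeact_lin; transitivity (c *: freeact u (freeact g v) + freeact u (freeact g' v)).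
    by congr (_ *: _ + _); [exact: IH | exact: IH'].
  by rewrite -[LHS]freeact_linr -freeact_lin.
rewrite {}/u.
have -> : << k >> * << l >> = << mul k l >> :> freealg F X.
  by rewrite [LHS]malgM_def fgmulUU mulr1.
rewrite !freeactU /wact; case: k l => k [l] /=.
by rewrite /mul /= /fmmul fmE /= foldr_cat.
Qed.

Lemma freeactV i v : freeact (fvar F i) v = op i v.
Proof. by rewrite freeactU /wact /fmu fmE. Qed.

Lemma freeact1 v : freeact 1 v = v.
Proof. by rewrite freeactU /wact /one /= /fmone fmE. Qed.

Lemma freealg_ind (S : freealg F X -> Prop) : S 1 ->
  (forall c f g, S f -> S g -> S (c *: f + g)) -> (forall i f, S f -> S (fvar F i * f)) ->
  forall f, S f.
Proof.
move=> S1 SD SM f; have S0 : S 0 by have := SD (-1) 1 1 S1 S1; rewrite scaleN1r addNr.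
elim/malg_ind: f => // -[]; elim=> [|i s IH].
  have -> : FMonom [::] = one :> {fmonom X} by rewrite /one /= /fmone fmE.
  exact: S1.
have -> : << FMonom (i :: s) >> = fvar F i * << FMonom s >> :> freealg F X; last exact: SM.
rewrite [RHS]malgM_def fgmulUU mulr1; congr << _ >>.
by rewrite /mul /= /fmmul /fmu !fmE.
Qed.

End FreeAction.

(** Idempotency gives (b_i - 1)(b_j - 1) = b_i b_j - s with s = b_i + b_j - 1 symmetric in i and j,
    and moreover s b_i = b_j b_i and b_i s = b_i b_j. After expansion the two sides of each relation
    have the same lower terms. *)
Lemma braided_sub1 n (R : pzRingType) (b : 'I_n -> R) :
  (forall i, b i * b i = b i) -> braided b -> braided (fun i => b i - 1).
Proof.
move=> idem [h2 h3 h4].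
have Z (x a c d : R) : x - a - (c - d) = x - c - (a - d).
  by rewrite !opprB addrACA [RHS]addrACA [- a + _]addrC.
pose s i j := b i + b j - 1.
have sC i j : s i j = s j i by rewrite /s (addrC (b i)).
have e2 i j : (b i - 1) * (b j - 1) = b i * b j - s i j.
  by rewrite mulrBl mul1r mulrBr mulr1 /s !opprD !opprK -!addrA; congr (_ + (_ + _)).
have sl i j : s i j * b i = b j * b i.
  by rewrite /s mulrBl mulrDl idem mul1r addrAC subrr add0r.
have sr i j : s i j * b j = b i * b j by rewrite sC sl.
have sl' i j : b i * s i j = b i * b j.
  by rewrite /s mulrBr mulrDr idem mulr1 addrAC subrr add0r.
clearbody s; split=> [i j ij|i j i0 ij|i j i0 j1].
- by rewrite !e2 sC h2.
- rewrite !e2 !mulrBl !mulrBr !mulr1 !sl h3 // (sC j); exact: Z.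
- rewrite !e2 -mulrA e2 -[RHS]mulrA e2 !mulrBl !mulrBr.
  have e4 : b i * b j * (b i * b j) = b j * b i * (b j * b i) by rewrite !mulrA h4.
  have e5 i' j' : b i' * b j' * s i' j' = b i' * b j' * b i'.
    by rewrite -!mulrA sC sl'.
  have e6 i' j' : s i' j' * (b i' * b j') = b j' * b i' * b j' by rewrite mulrA sl.
  rewrite e4 !e5 !e6 (sC j i); exact: Z.
Qed.

Lemma sub1_sq (R : pzRingType) (x : R) : x * x = x -> (x - 1) * (x - 1) = - (x - 1).
Proof. by move=> e; rewrite mulrBr mulr1 mulrBl e mul1r subrr sub0r. Qed.

(** * Coordinates in the Hecke algebra *)

Section Hecke.
Variables (F : fieldType) (n : nat).
Implicit Types (i j : 'I_n) (w : {perm signed n}) (r s t : seq 'I_n).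
Local Notation W := (signed_perms n).
Local Notation H := (hecke F n).
Local Notation V := {ffun {perm signed n} -> F^o}.

Lemma hecke_ind (S : H -> Prop) : S 1 ->
  (forall c x y, S x -> S y -> S (c *: x + y)) ->
  (forall i x, S x -> S (hgen F i * x)) -> forall x, S x.
Proof.
move=> S1 SD SM; elim/alg_piP; elim/freealg_ind => //= [c f g Sf Sg|i f Sf].
  by rewrite raddfD /= alg_piZ; apply: SD.
by rewrite alg_piM; apply: SM.
Qed.

Lemma hecke_relE (x y : freealg F 'I_n) : hecke_rel (x - y) ->
  alg_pi (@hecke_ideal1 F n) x = alg_pi (@hecke_ideal1 F n) y.
Proof. by move=> r; apply/eqP; rewrite alg_pi_eq; apply: two_sided_ideal_gen. Qed.

Lemma hgen_sq i : hgen F i * hgen F i = hgen F i.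
Proof. by rewrite /hgen -[LHS]alg_piM; apply: hecke_relE; exact: HeckeSq. Qed.

Lemma hgen_braided : braided (@hgen F n).
Proof.
split=> [i j ij|i j i0 ij|i j i0 j1]; rewrite /hgen -!alg_piM; apply: hecke_relE.
- exact: HeckeComm.
- exact: HeckeBraid3.
- exact: HeckeBraid4.
Qed.

Lemma hgenbar_braided : braided (@hgenbar F n).
Proof. exact: (braided_sub1 hgen_sq hgen_braided). Qed.

Lemma hgenbar_sq i : hgenbar F i * hgenbar F i = - hgenbar F i.
Proof. exact: sub1_sq (hgen_sq i). Qed.

(** The functions are defined on all permutations of the letters; outside W, where [demaz_braid4]
    does not apply, the operators are the identity, so that the relations hold everywhere. *)
Definition opr i (v : V) : V := [ffun w => if w \in W then v (demaz i w) else v w].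

Lemma opr_lin i c (u v : V) : opr i (c *: u + v) = c *: opr i u + opr i v.
Proof. by apply/ffunP => w; rewrite !ffunE; case: ifP; rewrite ?ffunE. Qed.

Lemma opr_rel (f : freealg F 'I_n) : hecke_rel f -> forall v, freeact opr f v = 0.
Proof.
pose T := @fvar F 'I_n.
have sub (g h : freealg F 'I_n) v : freeact opr (g - h) v = freeact opr g v - freeact opr h v.
  have -> : g - h = (-1) *: h + g by rewrite scaleN1r addrC.
  by rewrite [LHS]freeact_lin scaleN1r addrC.
have TE (g : freealg F 'I_n) i v : freeact opr (g * T i) v = freeact opr g (opr i v).
  rewrite [LHS](freeactM opr_lin); congr (freeact _ _ _); exact: freeactV.
have T1 i v : freeact opr (T i) v = opr i v by exact: freeactV.
have T2 i j v : freeact opr (T i * T j) v = opr i (opr j v).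
  by apply: etrans (TE _ _ _) _; apply: T1.
have T3 i j k v : freeact opr (T i * T j * T k) v = opr i (opr j (opr k v)).
  by apply: etrans (TE _ _ _) _; apply: T2.
have T4 i j k l v : freeact opr (T i * T j * T k * T l) v = opr i (opr j (opr k (opr l v))).
  by apply: etrans (TE _ _ _) _; apply: T3.
case=> [i|i j ij|i j i0 ij|i j i0 j1] v; rewrite [LHS]sub; apply/eqP; rewrite subr_eq0; apply/eqP.
- apply: etrans (T2 _ _ _) _; apply: etrans _ (esym (T1 _ _)).
  apply/ffunP => w; rewrite !ffunE; case: (boolP (w \in W)) => wW //.
  have d1 k := demazW k wW; have d2 k l := demazW l (d1 k); have d3 k l m := demazW m (d2 k l).
  by rewrite ?d1 ?d2 ?d3 demaz_id.
- apply: etrans (T2 _ _ _) _; apply: etrans _ (esym (T2 _ _ _)).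
  apply/ffunP => w; rewrite !ffunE; case: (boolP (w \in W)) => wW //.
  have d1 k := demazW k wW; have d2 k l := demazW l (d1 k); have d3 k l m := demazW m (d2 k l).
  by rewrite ?d1 ?d2 ?d3 (demaz_comm _ ij).
- apply: etrans (T3 _ _ _ _) _; apply: etrans _ (esym (T3 _ _ _ _)).
  apply/ffunP => w; rewrite !ffunE; case: (boolP (w \in W)) => wW //.
  have d1 k := demazW k wW; have d2 k l := demazW l (d1 k); have d3 k l m := demazW m (d2 k l).
  by rewrite ?d1 ?d2 ?d3 (demaz_braid3 _ i0 ij).
- apply: etrans (T4 _ _ _ _ _) _; apply: etrans _ (esym (T4 _ _ _ _ _)).
  apply/ffunP => w; rewrite !ffunE; case: (boolP (w \in W)) => wW //.
  have d1 k := demazW k wW; have d2 k l := demazW l (d1 k); have d3 k l m := demazW m (d2 k l).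
  by rewrite ?d1 ?d2 ?d3 (demaz_braid4 wW i0 j1).
Qed.

Lemma opr_ideal (f : freealg F 'I_n) : f \in two_sided_ideal (@hecke_rel F n) ->
  forall v, freeact opr f v = 0.
Proof.
move=> /asboolP /(_ (fun g => forall v, freeact opr g v = 0)) Hf; apply: Hf => [v|f1 f2 h1 h2 v|f1 f2 h v|f1 f2 h v|f1 /opr_rel //].
- exact: freeact0.
- have -> : f1 - f2 = (-1) *: f2 + f1 by rewrite scaleN1r addrC.
  by rewrite [LHS]freeact_lin h1 h2 scaler0 addr0.
- by rewrite [LHS](freeactM opr_lin) h (freeact0r opr_lin).
- by rewrite [LHS](freeactM opr_lin) h.
Qed.

Definition hrep (h : H) (v : V) : V :=
  freeact opr (generic_quotient.repr (h : ring_quotient.Quotient.quot (two_sided_ideal (@hecke_rel F n)))) v.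

Lemma hrep_pi f v : hrep (alg_pi (@hecke_ideal1 F n) f) v = freeact opr f v.
Proof.
have := opr_ideal (alg_piK (@hecke_ideal1 F n) f) v.
rewrite /hrep; set g := generic_quotient.repr _; move=> e.
have -> : g = 1 *: (g - f) + f by rewrite scale1r subrK.
by rewrite [LHS]freeact_lin e scaler0 add0r.
Qed.

Lemma hrep_lin c g h v : hrep (c *: g + h) v = c *: hrep g v + hrep h v.
Proof.
elim/alg_piP: g => g; elim/alg_piP: h => h.
by rewrite -alg_piZ -raddfD !hrep_pi [LHS]freeact_lin.
Qed.

Lemma hrepM g h v : hrep (g * h) v = hrep g (hrep h v).
Proof.
elim/alg_piP: g => g; elim/alg_piP: h => h.
by rewrite -alg_piM !hrep_pi [LHS](freeactM opr_lin).
Qed.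

Lemma hrep1 v : hrep 1 v = v.
Proof. by rewrite [LHS](hrep_pi 1) [LHS]freeact1. Qed.

Lemma hrep_gen i v : hrep (hgen F i) v = opr i v.
Proof. by rewrite hrep_pi [LHS]freeactV. Qed.

Definition vdelta w : V := [ffun x => (x == w)%:R].
(** [hpibar F w] sends the delta function at 1 to the one at w, so this is the coefficient of h at
    [hpibar F w]; the independence of these products follows. *)
Definition hcoord (h : H) w : F := hrep h (vdelta 1) w.

Lemma hcoord_lin c g h w : hcoord (c *: g + h) w = c * hcoord g w + hcoord h w.
Proof. by rewrite /hcoord hrep_lin !ffunE. Qed.
Lemma hcoordD g h w : hcoord (g + h) w = hcoord g w + hcoord h w.
Proof. by have := hcoord_lin 1 g h w; rewrite scale1r mul1r. Qed.
Lemma hcoord0 w : hcoord 0 w = 0.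
Proof. by have /(congr1 (fun x => x - hcoord 0 w)) := hcoordD 0 0 w; rewrite addr0 addrK subrr. Qed.
Lemma hcoordZ c g w : hcoord (c *: g) w = c * hcoord g w.
Proof. by have := hcoord_lin c g 0 w; rewrite !addr0 hcoord0 addr0. Qed.
Lemma hcoordN g w : hcoord (- g) w = - hcoord g w.
Proof. by rewrite -scaleN1r hcoordZ mulN1r. Qed.
Lemma hcoord_sum (T : Type) (l : seq T) (P : pred T) (f : T -> H) w :
  hcoord (\sum_(x <- l | P x) f x) w = \sum_(x <- l | P x) hcoord (f x) w.
Proof.
by elim/big_rec2: _ => [|x a b _ <-]; rewrite ?hcoord0 ?hcoordD.
Qed.

Lemma opr_delta i w : w \in W -> ~~ DL i w ->
  opr i (vdelta w) = vdelta w + vdelta (w * sgen i)%g.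
Proof.
move=> wW d; apply/ffunP => x; rewrite !ffunE; case: ifPn => [xW|xW]; last first.
  case: (eqVneq x w) => [e|_]; first by rewrite e wW in xW.
  case: eqP => [e|_]; first by rewrite e WMg wW in xW.
  by rewrite addr0.
rewrite /demaz; case: ifPn => dx.
  have -> : (x == w) = false by apply/eqP => e; rewrite -e dx in d.
  rewrite add0r; congr (_%:R); congr nat_of_bool.
  by apply/eqP/eqP => [<-|->]; rewrite mulsgK.
have -> : (x == (w * sgen i)%g) = false by apply/eqP => e; rewrite e DLs d in dx.
by rewrite addr0.
Qed.

Lemma hrep_gen_bar i w : w \in W -> ~~ DL i w ->
  hrep (hgenbar F i) (vdelta w) = vdelta (w * sgen i)%g.
Proof.
move=> wW d; have -> : hgenbar F i = (-1) *: 1 + hgen F i by rewrite scaleN1r addrC.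
by rewrite hrep_lin hrep1 hrep_gen opr_delta // scaleN1r addKr.
Qed.

Lemma hcoord_bar w x : w \in W -> hcoord (hpibar F w) x = (x == w)%:R.
Proof.
move=> wW; rewrite /hcoord; suff -> : hrep (hpibar F w) (vdelta 1) = vdelta w by rewrite ffunE.
have [rw _] := redwordPW wW; rewrite -[in RHS]rw; move: (red_redword wW); rewrite /hpibar.
elim: (redword w) => [|i r IH] rr; first by rewrite big_nil hrep1 word_nil.
have [rr' d] := red_cons rr.
rewrite big_cons hrepM IH // word_cons hrep_gen_bar ?word_W //.
by move: d; rewrite word_cons DLs.
Qed.

Lemma hpibarE w : hpibar F w = pw (@hgenbar F n) w. Proof. by []. Qed.
Lemma hpiE w : hpi F w = pw (@hgen F n) w. Proof. by []. Qed.

Lemma hpibarL i w : w \in W ->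
  hgenbar F i * hpibar F w = if DL i w then - hpibar F w else hpibar F (w * sgen i)%g.
Proof.
move=> wW; case: ifPn => d; last exact: (pwL hgenbar_braided).
have -> : hpibar F w = hgenbar F i * hpibar F (w * sgen i)%g.
  by rewrite !hpibarE (pwL hgenbar_braided) ?WMg ?DLs ?d // mulsgK.
by rewrite mulrA hgenbar_sq mulNr.
Qed.

Lemma hpibarR j w : w \in W ->
  hpibar F w * hgenbar F j = if DR j w then - hpibar F w else hpibar F (sgen j * w)%g.
Proof.
move=> wW; case: ifPn => d; last exact: (pwR hgenbar_braided).
have -> : hpibar F w = hpibar F (sgen j * w)%g * hgenbar F j.
  by rewrite !hpibarE (pwR hgenbar_braided) ?WgM ?DRs ?d // mulgA sgen2 mul1g.
by rewrite -mulrA hgenbar_sq mulrN.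
Qed.

Lemma hpiL i w : w \in W -> DL i w -> hgen F i * hpi F w = hpi F w.
Proof.
move=> wW d; have -> : hpi F w = hgen F i * hpi F (w * sgen i)%g.
  by rewrite !hpiE (pwL hgen_braided) ?WMg ?DLs ?d // mulsgK.
by rewrite mulrA hgen_sq.
Qed.

Lemma hpibar1 : hpibar F (1%g : {perm signed n}) = 1.
Proof. by rewrite hpibarE (pw1 hgenbar_braided). Qed.

Lemma hgenE i : hgen F i = hgenbar F i + 1.
Proof. by rewrite /hgenbar subrK. Qed.

(** Being equal to one's own expansion is an F-linear property that holds for every [hpibar F w],
    and left multiplication by a generator sends each [hpibar F w] to a combination of such
    elements. *)
Lemma hcoordP h : h = \sum_(w in W) hcoord h w *: hpibar F w.
Proof.
have Sbar w : w \in W -> hpibar F w = \sum_(x in W) hcoord (hpibar F w) x *: hpibar F x.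
  move=> wW; rewrite (bigD1 w) //= hcoord_bar // eqxx scale1r big1 ?addr0 // => x /andP[_ xw].
  by rewrite hcoord_bar // (negbTE xw) scale0r.
have SD c x y : x = \sum_(w in W) hcoord x w *: hpibar F w ->
    y = \sum_(w in W) hcoord y w *: hpibar F w ->
    c *: x + y = \sum_(w in W) hcoord (c *: x + y) w *: hpibar F w.
  move=> {1}-> {1}->; rewrite scaler_sumr -big_split; apply: eq_bigr => w _ /=.
  by rewrite hcoord_lin scalerDl scalerA.
elim/hecke_ind: h => [|c x y|i x Sx]; first by rewrite -{1}hpibar1 -{1}hpibar1 -Sbar ?W1.
  exact: SD.
rewrite {1}Sx mulr_sumr.
have S0 : 0 = \sum_(w in W) hcoord 0 w *: hpibar F w.
  by rewrite big1 // => w _; rewrite hcoord0 scale0r.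
suff S (l : seq _) : \sum_(w <- l | w \in W) hgen F i * (hcoord x w *: hpibar F w) =
   \sum_(z in W) hcoord (\sum_(w <- l | w \in W) hgen F i * (hcoord x w *: hpibar F w)) z *: hpibar F z.
  have {1}-> := S (index_enum _); apply: eq_bigr => z _.
  by congr (_ *: _); rewrite {2}Sx mulr_sumr.
elim: l => [|w l IH]; first by rewrite big_nil.
rewrite !big_cons; case: ifP => // wW.
rewrite -scalerAr; apply: (SD _ _ _ _ IH); rewrite hgenE mulrDl mul1r -[_ * _]scale1r.
apply: (SD); last exact: Sbar.
rewrite hpibarL //; case: ifP => _; last by rewrite -Sbar ?WMg.
by rewrite -scaleN1r -[_ *: _]addr0; apply: (SD _ _ _ _ S0); apply: Sbar.
Qed.

End Hecke.

(** * Parabolic subgroups *)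

Section ParabolicSubgroups.
Variable n : nat.
Implicit Types (i j : 'I_n) (x y : signed n) (w u v z : {perm signed n}) (r s : seq 'I_n).
Implicit Types I J K : {set 'I_n}.
Local Notation W := (signed_perms n).

Lemma lab_sgen I i x : i \in I -> lab I (sgen i x) = lab I x.
Proof.
rewrite -lab_lohi /slo /shi /lab permE /sgen_fun; case: x => k b /=.
have [i0|i0] := eqVneq (nat_of_ord i) 0%N => /= /eqP e.
  by case: eqP => [->|_]; rewrite ?addbF //; case: b => /=; lia.
by case: tpermP => [->|->|//]; case: b => /=; lia.
Qed.

(** The parabolic subgroup of I as the stabilizer of the blocks of letters; [parabolicE] identifies
    it with the subgroup generated by the s_i with i in I. *)
Definition WI I : {set {perm signed n}} :=
  [set w in W | [forall x, lab I (w x) == lab I x]].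

Lemma WIP I w : reflect (w \in W /\ forall x, lab I (w x) = lab I x) (w \in WI I).
Proof.
rewrite [w \in WI I]in_set; apply: (iffP andP) => -[wW h]; split=> //; first by move=> x; apply/eqP/(forallP h).
by apply/forallP => x; rewrite h.
Qed.

Lemma WI_W I w : w \in WI I -> w \in W. Proof. by case/WIP. Qed.
Lemma WI1 I : 1%g \in WI I.
Proof. by apply/WIP; split=> [|x]; rewrite ?W1 ?perm1. Qed.
Lemma WI_M I u v : u \in WI I -> v \in WI I -> (u * v)%g \in WI I.
Proof.
by move=> /WIP[uW hu] /WIP[vW hv]; apply/WIP; split=> [|x]; rewrite ?WM // permM hv hu.
Qed.
Lemma WI_V I u : u \in WI I -> u^-1%g \in WI I.
Proof.
by move=> /WIP[uW hu]; apply/WIP; split=> [|x]; rewrite ?WV // -[LHS]hu permKV.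
Qed.
Lemma WI_gen I i : i \in I -> sgen i \in WI I.
Proof. by move=> iI; apply/WIP; split=> [|x]; rewrite ?Wgen ?lab_sgen. Qed.

(** For j outside I the letters [slo j] and [shi j] lie in different blocks, and w keeps each letter
    in its block. *)
Lemma WI_DR I j w : w \in WI I -> DR j w -> j \in I.
Proof.
move=> /WIP[_ h]; apply: contraTT => /lt_lab_lohi; rewrite -(h (slo j)) -(h (shi j)).
move=> lt; rewrite /DR -leNgt; case: (leP (sint (w (slo j))) (sint (w (shi j)))) => // /ltW.
by move/(lab_mono I); lia.
Qed.

Lemma WI_DR0 I z : z \in WI I -> (forall j, j \in I -> ~~ DR j z) -> z = 1%g.
Proof.
move=> zI h; apply: DR0_eq1 => [|j]; first exact: WI_W zI.
by apply/negP => d; have := h _ (WI_DR zI d); rewrite d.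
Qed.

Lemma WI_word I w : w \in WI I -> exists r, [/\ all (mem I) r, word_perm r = w & red r].
Proof.
have [m] := ubnP (len w); elim: m w => // m IH w lt wI.
have [->|w1] := eqVneq w 1%g.
  by exists [::]; split=> //; rewrite /red ?word_nil ?len1.
have wW := WI_W wI; have [j d] := exDR wW w1.
have jI := WI_DR wI d; have l := lenDr wW d.
have [||r [rI rw rr]] := IH (sgen j * w)%g; first by lia.
  by rewrite WI_M ?WI_gen.
exists (rcons r j); rewrite /red word_rcons rw mulgA sgen2 mul1g all_rcons rI /= jI.
by split=> //; rewrite size_rcons -l -rw eqSS.
Qed.

Lemma parabolicE I : parabolic_subgroup I =i WI I.
Proof.
move=> w; apply/idP/idP => [/gen_prodgP[m [c cI ->]]|/WI_word[r [rI <- _]]].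
  apply: (big_ind (fun w => w \in WI I)); [exact: WI1|exact: WI_M|].
  by move=> k _; have /imsetP[i iI ->] := cI k; rewrite WI_gen.
elim: r rI => [|i r IH] /=; first by rewrite word_nil group1.
by case/andP => iI /IH h; rewrite word_cons groupM // mem_gen ?imset_f.
Qed.

(** [v * u] is u after v. The letters [v (slo j)] and [v (shi j)] lie in one block, on which u is
    increasing, so u does not affect their comparison. *)
Lemma DR_par I u v j : u \in W -> (forall j, j \in I -> ~~ DR j u) -> v \in WI I ->
  j \in I -> DR j (v * u)%g = DR j v.
Proof.
move=> uW hu /WIP[vW hv] jI; rewrite /DR !permM.
have e : lab I (v (slo j)) = lab I (v (shi j)) by rewrite !hv; apply/eqP; rewrite lab_lohi.
have [lt|lt|/sint_inj/perm_inj e'] := ltgtP (sint (v (slo j))) (sint (v (shi j))).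
- by apply/negbTE; rewrite -leNgt ltW // (chain_incr uW hu).
- by apply: (chain_incr uW hu).
- by rewrite e' ltxx.
Qed.

Definition minI I u := [forall j in I, ~~ DR j u].
Lemma minIP I u : reflect (forall j, j \in I -> ~~ DR j u) (minI I u).
Proof. exact: forall_inP. Qed.

Lemma fact_uniq I u v u' v' : u \in W -> u' \in W -> minI I u -> minI I u' ->
  v \in WI I -> v' \in WI I -> (v * u = v' * u')%g -> u = u' /\ v = v'.
Proof.
move=> uW uW' /minIP hu /minIP hu' vI vI' e.
have zI : (v^-1 * v')%g \in WI I by rewrite WI_M ?WI_V.
have uE : u = (v^-1 * v' * u')%g by rewrite -mulgA -e mulKg.
have z1 : (v^-1 * v' = 1)%g.
  apply: (WI_DR0 zI) => j jI; rewrite -(DR_par uW' hu') // -uE; exact: hu.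
split; first by rewrite uE z1 mul1g.
by apply: (mulgI v^-1%g); rewrite mulVg z1.
Qed.

(** Right descents in I are removed from w one at a time and collected in v. Each removal takes the
    last letter off a reduced word, so the products over reduced words factor as well. *)
Lemma factI I w : w \in W -> exists u v, [/\ u \in W, minI I u, v \in WI I, w = (v * u)%g &
  forall (R : pzRingType) (b : 'I_n -> R), braided b -> pw b w = pw b u * pw b v].
Proof.
have [m] := ubnP (len w); elim: m w => // m IH w lt wW.
have [mw|] := boolP (minI I w).
  exists w, 1%g; split=> //; rewrite ?WI1 ?mul1g // => R b hb.
  by rewrite pw1 // mulr1.
rewrite negb_forall_in => /exists_inP[j jI]; rewrite negbK => d.
have l := lenDr wW d; have [||u [v [uW mu vI wE h]]] := IH (sgen j * w)%g; first by lia.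
  by rewrite WgM.
exists u, (sgen j * v)%g; split=> //.
- by rewrite WI_M ?WI_gen.
- by rewrite -mulgA -wE mulgA sgen2 mul1g.
move=> R b hb; rewrite -(pwR hb) ?(WI_W vI) // ?mulrA -?h ?(pwR hb) ?WgM ?DRs ?d //.
  by rewrite mulgA sgen2 mul1g.
by rewrite -(DR_par uW (elimT (minIP _ _) mu)) // -wE DRs d.
Qed.

Lemma longest_WI I : longest I \in WI I.
Proof.
rewrite /longest; case: arg_maxnP => [|w wI _]; first exact: group1.
by rewrite -parabolicE.
Qed.

Lemma longest_max I w : w \in WI I -> (len w <= len (longest I))%N.
Proof.
rewrite /longest; case: arg_maxnP => [|u]; first exact: group1.
move=> /= uI max wI; have := max w; rewrite /= -parabolicE in wI => /(_ wI).
have [_ ->] := redwordPW (WI_W (etrans (esym (parabolicE I u)) uI)).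
by have [_ ->] := redwordPW (WI_W (etrans (esym (parabolicE I w)) wI)).
Qed.

Lemma longest_DR I j : j \in I -> DR j (longest I).
Proof.
move=> jI; have wI := longest_WI I; apply: contraT => d.
have := lenSr (WI_W wI) d.
by have := @longest_max I (sgen j * longest I)%g; rewrite WI_M ?WI_gen // => /(_ isT); lia.
Qed.

Lemma longest_DL I j : j \in I -> DL j (longest I).
Proof.
move=> jI; have wI := longest_WI I; apply: contraT => d.
have := lenS (WI_W wI) d.
by have := @longest_max I (longest I * sgen j)%g; rewrite WI_M ?WI_gen // => /(_ isT); lia.
Qed.

(** Both v and the longest element reverse the order on every block, so [v^-1 * l] preserves it;
    having no descent in I, it is trivial. *)
Lemma longest_uniq I v : v \in WI I -> (forall j, j \in I -> DR j v) -> v = longest I.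
Proof.
move=> vI hv; have lI := longest_WI I; set l := longest I in lI *.
have zI : (v^-1 * l)%g \in WI I by rewrite WI_M ?WI_V.
have {}z1 : (v^-1 * l = 1)%g.
  apply: (WI_DR0 zI) => j jI; rewrite /DR !permM.
  have [VW hV] := WIP _ _ (WI_V vI).
  have e : lab I (v^-1%g (slo j)) = lab I (v^-1%g (shi j)) by rewrite !hV; apply/eqP; rewrite lab_lohi.
  have [lt|lt|/sint_inj/perm_inj e'] := ltgtP (sint (v^-1%g (slo j))) (sint (v^-1%g (shi j))).
  - have := chain_decr (WI_W vI) hv lt e; rewrite !permKV; have := lt_lohi j; lia.
  - have := chain_decr (WI_W lI) (@longest_DR I) lt (esym e); rewrite -/l; lia.
  - by rewrite e' ltxx.
by apply: (mulgI v^-1%g); rewrite mulVg z1.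
Qed.

End ParabolicSubgroups.

(** * Right multiplication, longest elements and leading terms *)

Section HeckeParabolic.
Variables (F : fieldType) (n : nat).
Implicit Types (i j : 'I_n) (w u v z x : {perm signed n}) (r s : seq 'I_n).
Implicit Types I J K : {set 'I_n}.
Local Notation W := (signed_perms n).
Local Notation H := (hecke F n).
Implicit Types h g : H.

(** If j is a descent of z, then [hpibar F z] arises from itself with sign -1 and from the shorter
    element z s_j; otherwise it does not arise at all. *)
Lemma hcoord_barR h j z : z \in W ->
  hcoord (h * hgenbar F j) z = if DR j z then hcoord h (sgen j * z)%g - hcoord h z else 0.
Proof.
move=> zW; rewrite {1}(hcoordP h) mulr_suml hcoord_sum.
under eq_bigr => w wW do rewrite -scalerAl hcoordZ hpibarR //.
transitivity (\sum_(w in W) hcoord h w *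
    (if DR j w then - (w == z)%:R else ((sgen j * w)%g == z)%:R)).
  apply: eq_bigr => w wW; congr (_ * _).
  by case: ifP => _; rewrite ?hcoordN hcoord_bar ?WgM // eq_sym.
case: ifPn => d.
  rewrite (bigD1 z) //= d eqxx mulrN1 addrC; congr (_ - _).
  have zz : (sgen j * z)%g != z.
    by apply/eqP => e; have := DRs j z; rewrite e d.
  rewrite (bigD1 (sgen j * z)%g) ?WgM ?zW //= DRs d /= mulgA sgen2 mul1g eqxx mulr1 big1 ?addr0 // => w /andP[/andP[wW wz] wz'].
  case: ifP => _; first by rewrite (negbTE wz) oppr0 mulr0.
  case: eqP => [e|_]; last by rewrite mulr0.
  by move: wz'; rewrite -e mulgA sgen2 mul1g eqxx.
rewrite big1 // => w wW; case: ifPn => dw.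
  case: eqP => [e|_]; last by rewrite oppr0 mulr0.
  by rewrite -e dw in d.
case: eqP => [e|_]; last by rewrite mulr0.
by rewrite -e DRs dw in d.
Qed.

Lemma hcoord_genR h j z : z \in W ->
  hcoord (h * hgen F j) z = if DR j z then hcoord h (sgen j * z)%g else hcoord h z.
Proof.
move=> zW; rewrite hgenE mulrDr mulr1 hcoordD hcoord_barR //.
by case: ifP => _; rewrite ?subrK ?add0r.
Qed.

Lemma hpi_longest_word K : exists2 r, all (mem K) r & hpi F (longest K) = bw (@hgen F n) r.
Proof.
have [r [rK rw rr]] := WI_word (longest_WI K); exists r => //.
by rewrite hpiE -rw (pw_word (@hgen_braided F n)).
Qed.
Lemma hpibar_word I w : w \in WI I ->
  exists2 r, all (mem I) r & hpibar F w = bw (@hgenbar F n) r /\ size r = len w.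
Proof.
move=> wI; have [r [rI rw rr]] := WI_word wI; exists r => //.
by rewrite hpibarE -rw (pw_word (@hgenbar_braided F n)) //; split=> //; apply/eqP.
Qed.

Lemma hcoord_hpi_longest K h z : z \in W -> minI K z ->
  hcoord (h * hpi F (longest K)) z = hcoord h z.
Proof.
move=> zW /minIP hz; have [r + ->] := hpi_longest_word K.
elim: r h => [|j r IH] h /=; first by rewrite bw_nil mulr1.
case/andP => jK rK; rewrite bw_cons mulrA IH // hcoord_genR //.
by rewrite (negbTE (hz j jK)).
Qed.

(** A factor pi_j can be split off [hpi F (longest K)] on the left, and [hpibar F w] times pi_j is 0
    at a right descent j of w. *)
Lemma hpi_longest_kill K w j : w \in W -> j \in K -> DR j w ->
  hpibar F w * hpi F (longest K) = 0.
Proof.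
move=> wW jK d; rewrite -(@hpiL _ _ j) ?(WI_W (longest_WI K)) ?longest_DL // mulrA.
by rewrite hgenE mulrDr mulr1 hpibarR // d addNr mul0r.
Qed.

Lemma longest_bar_genR I j : j \in I -> hpibar F (longest I) * hgen F j = 0.
Proof.
move=> jI; rewrite hgenE mulrDr mulr1 hpibarR ?(WI_W (longest_WI I)) //.
by rewrite longest_DR // addNr.
Qed.

(** Right multiplication by pi_j annihilates [hpibar F (longest I)] but leaves the coefficients at
    elements without descent j unchanged. *)
Lemma hcoord_longest0 I h j z : z \in W -> j \in I -> ~~ DR j z ->
  hcoord (h * hpibar F (longest I)) z = 0.
Proof.
move=> zW jI d; have := hcoord_genR (h * hpibar F (longest I)) j zW.
by rewrite (negbTE d) => <-; rewrite -mulrA longest_bar_genR // mulr0 hcoord0.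
Qed.

(** The parabolic factor of w inherits all descents in I, hence is the longest element. *)
Lemma hpibar_longest_fact I w : w \in W -> (forall j, j \in I -> DR j w) ->
  exists2 u, u \in W & hpibar F w = hpibar F u * hpibar F (longest I).
Proof.
move=> wW hw; have [u [v [uW /minIP mu vI wE h]]] := factI I wW.
have <- : v = longest I.
  apply: longest_uniq => // j jI; rewrite -(DR_par uW mu) // -wE; exact: hw.
exists u => //; exact: (h _ _ (@hgenbar_braided F n)).
Qed.

(* [h] agrees with [c] times the basis element of [u] up to longer elements. *)
Definition leads h (c : F) u :=
  forall z, z \in W -> (len z <= len u)%N -> hcoord h z = c * (z == u)%:R.

Lemma leads_bar u : u \in W -> leads (hpibar F u) 1 u.
Proof. by move=> uW z zW _; rewrite hcoord_bar // mul1r eq_sym. Qed.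

(** At z with descent j the new coefficient is the old one at the shorter element z s_j, so it is 0
    as long as z is not longer than u. *)
Lemma leads_gen h c u j : leads h c u -> ~~ DR j u -> leads (h * hgen F j) c u.
Proof.
move=> lh d z zW lz; rewrite hcoord_genR //; case: ifPn => dz; last exact: lh.
have l := lenDr zW dz; rewrite lh ?WgM //; last by lia.
have -> : (z == u) = false by apply/eqP => e; rewrite -e dz in d.
case: eqP => // e; rewrite e in l; exfalso; lia.
Qed.

(** At a descent j of u, [hpibar F u] is an eigenvector with eigenvalue -1: the origin of the sign
    in [leads_hpibar_longest]. *)
Lemma leads_bargen h c u j : leads h c u -> DR j u -> leads (h * hgenbar F j) (- c) u.
Proof.
move=> lh d z zW lz; rewrite hcoord_barR //; case: ifPn => dz.
  have l := lenDr zW dz; rewrite !lh ?WgM //; last by lia.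
  have -> : ((sgen j * z)%g == u) = false by apply/eqP => e; rewrite e in l; lia.
  by rewrite mulr0 sub0r mulNr.
have -> : (z == u) = false by apply/eqP => e; rewrite e d in dz.
by rewrite mulr0.
Qed.

Lemma leads_hpi_longest h c u K : leads h c u -> minI K u ->
  leads (h * hpi F (longest K)) c u.
Proof.
move=> lh /minIP hu; have [r + ->] := hpi_longest_word K.
elim: r h lh => [|j r IH] h lh /=; first by rewrite bw_nil mulr1.
case/andP => jK rK; rewrite bw_cons mulrA; apply: IH => //.
by apply: leads_gen lh _; apply: hu.
Qed.

Lemma leads_hpibar_longest h c u I : leads h c u -> (forall j, j \in I -> DR j u) ->
  leads (h * hpibar F (longest I)) ((-1) ^+ len (longest I) * c) u.
Proof.
move=> lh hu; have [r + [-> <-]] := hpibar_word (longest_WI I).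
elim: r h c lh => [|j r IH] h c lh /=; first by rewrite bw_nil mulr1 expr0 mul1r.
case/andP => jK rK; rewrite bw_cons mulrA exprSr -[X in leads _ X]mulrA mulN1r; apply: IH => //.
by apply: leads_bargen lh _; apply: hu.
Qed.

End HeckeParabolic.

(** * Diagrams as sequences of steps *)

Section Steps.
Local Open Scope nat_scope.

(* From a box to the next one in reading order: [Some false] is a step to the
   right, [Some true] a step up, [None] a step to the next component. *)
Definition step := option bool.
Implicit Types (st : seq step) (a b : seq nat) (s : seq (seq nat)).

Definition rsteps a : seq step :=
  nseq (head 0 a).-1 (Some false) ++
  flatten [seq Some true :: nseq k.-1 (Some false) | k <- behead a].

(* The first row is one box longer because it starts with the 0-box. *)
Definition gsteps a s : seq step :=
  rsteps ((head 0 a).+1 :: behead a) ++ flatten [seq None :: rsteps b | b <- s].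

(** A gap raises both coordinates, so that the next component starts strictly northeast and shares
    no row or column with the previous ones. *)
Definition move (p : nat * nat) (c : step) : nat * nat :=
  (p.1 + (c != Some false), p.2 + (c != Some true)).

Definition boxes p st := p :: scanl move p st.

Lemma boxes_cat p st1 c st2 :
  boxes p (st1 ++ c :: st2) = boxes p st1 ++ boxes (move (foldl move p st1) c) st2.
Proof.
by rewrite /boxes scanl_cat.
Qed.

Lemma move_right r c : move (r, c) (Some false) = (r, c.+1).
Proof. by rewrite /move addn0 addn1. Qed.

Lemma foldl_right r c m : foldl move (r, c) (nseq m (Some false)) = (r, c + m).
Proof. by elim: m c => [|m IH] c /=; rewrite ?addn0 // move_right IH addSnnS. Qed.

Lemma boxes_right r c m : boxes (r, c) (nseq m (Some false)) = [seq (r, j) | j <- iota c m.+1].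
Proof.
elim: m c => [|m IH] c //.
have -> : boxes (r, c) (nseq m.+1 (Some false)) = (r, c) :: boxes (r, c.+1) (nseq m (Some false)).
  by rewrite /boxes /= move_right.
by rewrite IH.
Qed.

(** The second conjunct locates the last box, from which [ribbonsE] places the next component. *)
Lemma ribbonE r c m a : 0 < m -> all (leq 1) a ->
  ribbon r c (m :: a) = boxes (r, c) (rsteps (m :: a)) /\
  foldl move (r, c) (rsteps (m :: a)) = (r + size a, c + sumn [seq k.-1 | k <- m :: a]).
Proof.
move=> m0; elim: a r c m m0 => [|k a IH] r c m m0 /=.
  by rewrite /rsteps [flatten _]/= !cats0 foldl_right boxes_right prednK // !addn0.
case/andP => k0 a0; have [h1 h2] := IH r.+1 (c + m.-1) k k0 a0.
have e : rsteps [:: m, k & a] = nseq m.-1 (Some false) ++ Some true :: rsteps (k :: a) by [].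
have mv : move (r, c + m.-1) (Some true) = (r.+1, c + m.-1) by rewrite /move addn0 addn1.
rewrite e boxes_cat foldl_cat foldl_right boxes_right prednK // mv; split; first by rewrite -h1.
rewrite -[foldl _ _ (_ :: _)]/(foldl move (move (r, c + m.-1) (Some true)) (rsteps (k :: a))).
by rewrite mv h2 /=; congr (_, _); lia.
Qed.

Lemma ribbonsE r c m a s : 0 < m -> all (leq 1) a -> all is_comp s ->
  ribbons r c ((m :: a) :: s) =
    boxes (r, c) (rsteps (m :: a) ++ flatten [seq None :: rsteps b | b <- s]).
Proof.
elim: s r c m a => [|[|k b] s IH] r c m a m0 a0 //.
  move=> _; have [h _] := ribbonE r c m0 a0.
  by rewrite -[ribbons _ _ _]/(ribbon r c (m :: a) ++ [::]) !cats0.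
rewrite [all _ _]/= => /andP[/andP[_ /andP[k0 b0]] sc].
have [h1 h2] := ribbonE r c m0 a0.
rewrite -[ribbons _ _ _]/(ribbon r c (m :: a) ++ ribbons (r + size (m :: a))
  (c + sumn [seq k.-1 | k <- m :: a]).+1 ((k :: b) :: s)) h1 IH //.
rewrite -[flatten [seq None :: rsteps b0 | b0 <- (k :: b) :: s]]/(None :: rsteps (k :: b) ++ flatten [seq None :: rsteps b | b <- s]).
by rewrite boxes_cat h2 /move /= !addn1 addnS.
Qed.

Lemma gpribbonE a s : is_pcomp a -> all is_comp s -> gpribbon a s = boxes (0, 0) (gsteps a s).
Proof. by move=> /andP[_ a0] sc; rewrite /gpribbon ribbonsE. Qed.

Lemma ribbon0E b : is_comp b -> ribbon 0 0 b = boxes (0, 0) (rsteps b).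
Proof. by case: b => // k b /andP[_ /andP[k0 b0]]; have [-> _] := ribbonE 0 0 k0 b0. Qed.

Lemma size_rsteps m a : 0 < m -> all (leq 1) a -> (size (rsteps (m :: a))).+1 = sumn (m :: a).
Proof.
move=> m0 a0; rewrite /rsteps size_cat size_nseq /=.
rewrite -addSn prednK //; congr (_ + _); elim: a a0 => //= k a IH /andP[k0 a0].
by rewrite size_cat size_nseq IH // -addSn prednK //.
Qed.

Lemma size_gsteps a s : is_pcomp a -> all is_comp s ->
  size (gsteps a s) = sumn a + sumn [seq sumn b | b <- s].
Proof.
move=> /andP[an a0] sc; rewrite /gsteps size_cat; congr (_ + _).
  apply: succn_inj; rewrite size_rsteps //; by case: a an a0.
elim: s sc => // -[|k b] s IH //= /andP[/andP[_ /andP[k0 b0]] sc].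
by rewrite size_cat IH // -addSn size_rsteps.
Qed.

Local Notation row := Defs.row.
Local Notation col := Defs.col.

Lemma row_boxes p st k : k < size st ->
  row (boxes p st) k.+1 = row (boxes p st) k + (nth None st k != Some false).
Proof.
rewrite /row /boxes; elim: st p k => // c st IH p [|k] //= lt; exact: (IH (move p c) k).
Qed.
Lemma col_boxes p st k : k < size st ->
  col (boxes p st) k.+1 = col (boxes p st) k + (nth None st k != Some true).
Proof.
rewrite /col /boxes; elim: st p k => // c st IH p [|k] //= lt; exact: (IH (move p c) k).
Qed.

Definition okstep (c : step) (x y : int) : bool :=
  match c with Some true => (y < x)%R | Some false => (x < y)%R | None => true end.

Section Increasing.
Variables (st : seq step) (p0 : nat * nat).
Local Notation D := (boxes p0 st).

Lemma row_mono k l : k <= l <= size st -> row D k <= row D l.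
Proof.
elim: l => [|l IH] /andP[]; first by rewrite leqn0 => /eqP ->.
rewrite leq_eqVlt => /predU1P[-> //|kl] lt.
by rewrite row_boxes //; apply: leq_trans (leq_addr _ _); apply: IH; rewrite -ltnS kl ltnW.
Qed.
Lemma col_mono k l : k <= l <= size st -> col D k <= col D l.
Proof.
elim: l => [|l IH] /andP[]; first by rewrite leqn0 => /eqP ->.
rewrite leq_eqVlt => /predU1P[-> //|kl] lt.
by rewrite col_boxes //; apply: leq_trans (leq_addr _ _); apply: IH; rewrite -ltnS kl ltnW.
Qed.

Lemma same_row_lt (vv : nat -> int) k l :
  (forall i, i < size st -> okstep (nth None st i) (vv i) (vv i.+1)) ->
  k < l <= size st -> row D k = row D l -> (vv k < vv l)%R.
Proof.
move=> h; elim: l => // l IH /andP[kl lt] e.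
have r1 : row D k <= row D l by apply: row_mono; rewrite -ltnS kl ltnW.
have := h l lt; move: e; rewrite row_boxes //.
case: (nth None st l) => [[|]|] /= e; try lia.
move: kl; rewrite ltnS leq_eqVlt => /predU1P[-> //|kl] o.
have kl' : k < l <= size st by rewrite kl ltnW.
have e2 : row D k = row D l by apply/eqP; rewrite eqn_leq r1 e addn0 leqnn.
exact: lt_trans (IH kl' e2) o.
Qed.

(** Both coordinates weakly increase in reading order, so the boxes of one row or one column are
    consecutive and joined by steps of one kind; comparing neighbours is enough. *)
Lemma increasingP N (v : 'I_N -> int) (vv : nat -> int) : N = (size st).+1 ->
  (forall p, v p = vv p) ->
  reflect (forall k, k < size st -> okstep (nth None st k) (vv k) (vv k.+1)) (increasing D v).
Proof.
move=> NE vE; apply: (iffP idP) => [inc k lt|h].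
  have ltk : k < N by rewrite NE ltnS ltnW.
  have ltk1 : k.+1 < N by rewrite NE ltnS.
  have /andP[h1 _] := forallP (forallP inc (Ordinal ltk)) (Ordinal ltk1).
  have /andP[_ h2] := forallP (forallP inc (Ordinal ltk1)) (Ordinal ltk).
  move: h1 h2; rewrite !vE /= row_boxes // col_boxes //.
  by case: (nth None st k) => [[|]|] //=; rewrite ?addn0 ?addn1 ?eqxx ?ltnn ?ltnSn.
have sameC k l : k < l <= size st -> col D k = col D l -> (vv l < vv k)%R.
  elim: l => // l IH /andP[kl lt] e.
  have r1 : col D k <= col D l by apply: col_mono; rewrite -ltnS kl ltnW.
  have := h l lt; move: e; rewrite col_boxes //.
  case: (nth None st l) => [[|]|] /= e; try lia.
  move: kl; rewrite ltnS leq_eqVlt => /predU1P[-> //|kl] o.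
  have kl' : k < l <= size st by rewrite kl ltnW.
  have e2 : col D k = col D l by apply/eqP; rewrite eqn_leq r1 e addn0 leqnn.
  exact: lt_trans o (IH kl' e2).
have le (q : 'I_N) : q <= size st by rewrite -ltnS -NE ltn_ord.
apply/forallP => p; apply/forallP => q; rewrite !vE; apply/andP; split; apply/implyP => /andP[/eqP e lt].
  have [pq|qp] := ltnP p q; first by rewrite (same_row_lt h) // pq le.
  have : col D q <= col D p by apply: col_mono; rewrite qp le.
  lia.
have [qp|pq] := ltnP q p; first by rewrite sameC // qp le.
have : row D p <= row D q by apply: row_mono; rewrite pq le.
lia.
Qed.

End Increasing.

(** The argument x is the entry before the word: the 0 of the 0-box in type B, and in type A an
    arbitrary value shielded by a leading step [None]. *)
Fixpoint compat (x : int) st (w : seq int) : bool :=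
  match st, w with
  | [::], [::] => true
  | c :: st', y :: w' => okstep c x y && compat y st' w'
  | _, _ => false
  end.

Lemma compatP x st w : reflect (size w = size st /\
   forall k, k < size st -> okstep (nth None st k) (nth 0%R (x :: w) k) (nth 0%R (x :: w) k.+1))
  (compat x st w).
Proof.
elim: st x w => [|c st IH] x [|y w] /=; try by constructor; case.
  by constructor; split.
apply: (iffP andP) => [[oc /IH[ws h]]|[[ws] h]].
  by split=> [|[|k] lt]; rewrite ?ws //; apply: h.
split; first exact: (h 0).
by apply/IH; split=> // k lt; apply: (h k.+1).
Qed.

Lemma compat_cat x st1 st2 w1 w2 : size w1 = size st1 ->
  compat x (st1 ++ st2) (w1 ++ w2) = compat x st1 w1 && compat (last x w1) st2 w2.
Proof. by elim: st1 x w1 => [|c st IH] x [|y w] //= [/IH ->]; rewrite andbA. Qed.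

Lemma compat_mono (f : int -> int) x st w :
  (forall y z, (f y < f z)%R = (y < z)%R) -> compat (f x) st (map f w) = compat x st w.
Proof.
move=> fm; elim: st x w => [|c st IH] x [|y w] //=; rewrite IH; congr (_ && _).
by case: c => [[|]|] //=; rewrite fm.
Qed.

End Steps.

(** * Descent sets, gluing and brackets in terms of steps *)

Section StepsDescents.
Local Open Scope nat_scope.
Implicit Types (st : seq step) (a b c x : seq nat) (s : seq (seq nat)).

Definition dlist m a := [seq m + sumn (take j a) | j <- iota 0 (size a)].

Lemma dlist_cons m k a : dlist m (k :: a) = m :: dlist (m + k) a.
Proof.
rewrite /dlist /= addn0; congr (_ :: _); rewrite -[1]/(1 + 0) iotaDl -map_comp.
by apply: eq_map => j /=; rewrite addnA.
Qed.

Lemma descentsE m a : descents (m :: a) = dlist m a.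
Proof. by rewrite /descents /dlist /= -[1]/(1 + 0) iotaDl -map_comp; apply: eq_map => j. Qed.

Lemma dlist_add d m a : dlist (d + m) a = map (addn d) (dlist m a).
Proof. by rewrite /dlist -map_comp; apply: eq_map => j /=; rewrite addnA. Qed.

Lemma dlist_ge m a i : i \in dlist m a -> m <= i.
Proof. by move=> /mapP[j _ ->]; apply: leq_addr. Qed.

Lemma rsteps_cons m k a : rsteps (m :: k :: a) =
  nseq m.-1 (Some false) ++ Some true :: rsteps (k :: a).
Proof. by []. Qed.

(** The first row has m + 1 boxes, the 0-box included. Step i therefore leaves the box of the i-th
    letter, and descents need no shift of index. *)
Lemma rsteps_dlist m a i : all (leq 1) a ->
  (nth None (rsteps (m.+1 :: a)) i == Some true) = (i \in dlist m a).
Proof.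
elim: a m i => [|[|k] a IH] m i //=.
  by rewrite /rsteps cats0 nth_nseq; case: ifP.
move=> a0; rewrite rsteps_cons dlist_cons in_cons nth_cat size_nseq nth_nseq /=.
case: (ltngtP i m) => [im|im|->]; last by rewrite subnn eqxx.
- by apply/esym/negbTE/negP => /dlist_ge; lia.
- rewrite -(subnSK im) /= IH // addnS -addSn dlist_add.
  by rewrite -{2}(subnKC im) mem_map //; apply: addnI.
Qed.

Lemma rsteps_Some a : None \notin rsteps a.
Proof.
rewrite /rsteps mem_cat negb_or mem_nseq andbF /=.
by apply/negP => /flattenP[t /mapP[k _ ->]]; rewrite in_cons mem_nseq /= andbF.
Qed.

Lemma rsteps_cat x b : x != [::] -> b != [::] ->
  rsteps (x ++ b) = rsteps x ++ Some true :: rsteps b.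
Proof. by case: x => // m x; case: b => // k b _ _; rewrite /rsteps /= map_cat flatten_cat catA. Qed.

Lemma nseq_split (T : Type) (m k : nat) (y : T) : 0 < m ->
  nseq (m + k).-1 y = nseq m.-1 y ++ nseq k y.
Proof. by case: m => // m _; rewrite addSn nseqD. Qed.

Lemma rsteps_ncat x b : x != [::] -> all (leq 1) x -> is_comp b ->
  rsteps (ncat x b) = rsteps x ++ Some false :: rsteps b.
Proof.
case: b => // k b; elim/last_ind: x => // y z _ _ + /andP[_ /andP[k0 b0]].
rewrite all_rcons => /andP[z0 y0].
have h : rsteps (z + k :: b) = rsteps [:: z] ++ Some false :: rsteps (k :: b).
  rewrite /rsteps /= cats0 nseq_split //; case: k k0 => // k _ /=.
  by rewrite -catA.
rewrite /ncat size_rcons -cats1 last_cat take_size_cat //=.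
case: y y0 => [|m y] y0 //.
by rewrite !rsteps_cat // h -catA.
Qed.

Definition pos a := (head 0 a).+1 :: behead a.

Lemma pos_cat a b : a != [::] -> pos (a ++ b) = pos a ++ b.
Proof. by case: a. Qed.
Lemma pos_ncat a b : a != [::] -> pos (ncat a b) = ncat (pos a) b.
Proof. by case: a => // m [|k a] //= _; rewrite /pos /ncat /=. Qed.

Lemma pos_ge1 a : is_pcomp a -> all (leq 1) (pos a).
Proof. by move=> /andP[_]; rewrite /pos. Qed.

Lemma gsteps0 a : gsteps a [::] = rsteps (pos a).
Proof. by rewrite /gsteps cats0. Qed.

Lemma is_pcomp_cat a b : is_pcomp a -> is_comp b -> is_pcomp (a ++ b).
Proof.
by case: a => // m a /andP[_ a0] /andP[_ b0]; rewrite /is_pcomp /= all_cat b0 andbT.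
Qed.
Lemma is_pcomp_ncat a b : is_pcomp a -> is_comp b -> is_pcomp (ncat a b).
Proof.
case: b => // k b; case/lastP: a => // a z /andP[_ a0] /andP[_ /andP[k0 b0]].
rewrite /ncat size_rcons -cats1 last_cat take_size_cat //=.
case: a a0 => [|m a] a0; rewrite /is_pcomp //=.
move: a0; rewrite /= all_rcons all_cat /= => /andP[z0 ->] /=.
by rewrite addn_gt0 k0 orbT; exact: b0.
Qed.

Lemma gsteps_cat a b : is_pcomp a -> is_comp b ->
  gsteps (a ++ b) [::] = gsteps a [::] ++ Some true :: rsteps b.
Proof. by move=> /andP[a0 _] /andP[b0 _]; rewrite !gsteps0 pos_cat // rsteps_cat. Qed.
Lemma gsteps_ncat a b : is_pcomp a -> is_comp b ->
  gsteps (ncat a b) [::] = gsteps a [::] ++ Some false :: rsteps b.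
Proof.
move=> ap bc; have /andP[a0 _] := ap.
by rewrite !gsteps0 pos_ncat // rsteps_ncat // pos_ge1.
Qed.

Lemma foldl_ncat a s : is_pcomp a -> all is_comp s -> is_pcomp (foldl ncat a s) /\
  gsteps (foldl ncat a s) [::] = gsteps a [::] ++ flatten [seq Some false :: rsteps b | b <- s].
Proof.
elim: s a => [|b s IH] a ap /=; first by rewrite cats0.
case/andP => bc sc; have [h1 h2] := IH _ (is_pcomp_ncat ap bc) sc.
by rewrite h2 gsteps_ncat // -catA.
Qed.

Definition fill (f : step -> step) := map (fun c : step => if c is None then f None else c).

Lemma fill_rsteps f a : fill f (rsteps a) = rsteps a.
Proof.
rewrite -[RHS]map_id; apply/eq_in_map => -[//|]; by rewrite (negbTE (rsteps_Some a)).
Qed.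

Lemma descents_gsteps a i : is_pcomp a ->
  (nth None (gsteps a [::]) i == Some true) = (i \in descents a).
Proof. by case: a => // m a /andP[_ a0]; rewrite gsteps0 rsteps_dlist // descentsE. Qed.

Lemma gsteps_eq a s : gsteps a s = gsteps a [::] ++ flatten [seq None :: rsteps b | b <- s].
Proof. by rewrite {2}/gsteps cats0. Qed.

Lemma gsteps_rcons a s b : gsteps a (rcons s b) = gsteps a s ++ None :: rsteps b.
Proof. by rewrite /gsteps map_rcons flatten_rcons catA. Qed.

(** Gluing the components in one row at each gap turns the gaps into steps to the right, which
    contribute no descent. *)
Lemma descents_ncat a s i : is_pcomp a -> all is_comp s ->
  (i \in descents (foldl ncat a s)) = (nth None (gsteps a s) i == Some true).
Proof.
move=> ap sc; have [h1 h2] := foldl_ncat ap sc.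
rewrite -descents_gsteps // h2 (gsteps_eq a s).
have -> : flatten [seq Some false :: rsteps b | b <- s] =
    fill (fun=> Some false) (flatten [seq None :: rsteps b | b <- s]).
  elim: s {sc h1 h2} => //= b s ->; rewrite /fill map_cat; congr (_ :: _ ++ _).
  exact: (esym (fill_rsteps (fun=> Some false) b)).
have e : gsteps a [::] = fill (fun=> Some false) (gsteps a [::]) by rewrite gsteps0 fill_rsteps.
rewrite {1}e /fill -map_cat.
set t := _ ++ _; case: (ltnP i (size t)) => it; last by rewrite !nth_default ?size_map.
by rewrite (nth_map None) //; case: (nth _ _ _).
Qed.

Lemma rsteps_ones m : 0 < m -> rsteps (nseq m 1) = nseq m.-1 (Some true).
Proof. by case: m => // m _; rewrite /rsteps /=; elim: m => //= m ->. Qed.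

Lemma omap_rsteps b : is_comp b -> rsteps (nseq (sumn b) 1) = map (omap (fun=> true)) (rsteps b).
Proof.
case: b => // m b /andP[_ /andP[m0 b0]]; rewrite -size_rsteps // rsteps_ones //=.
have : None \notin rsteps (m :: b) by apply: rsteps_Some.
by elim: (rsteps _) => //= -[c|] t IH; rewrite in_cons //= => /IH ->.
Qed.

Lemma comp_sumn b : is_comp b -> 0 < sumn b.
Proof. by case: b => // m b /andP[_ /andP[m0 _]] /=; rewrite ltn_addr. Qed.

(** The components are replaced by columns of the same sizes, so all steps inside them go up while
    the gaps stay: J is the set of steps that are not gaps. *)
Lemma descents_ones a s i : is_pcomp a -> all is_comp s -> i < sumn a + sumn [seq sumn b | b <- s] ->
  (i \in descents (foldl ncat (0 :: nseq (sumn a) 1) [seq nseq (sumn b) 1 | b <- s])) =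
  (nth None (gsteps a s) i != None).
Proof.
move=> ap sc lt; rewrite descents_ncat; first last.
- elim: s sc {lt} => //= b s IH /andP[bc /IH ->]; rewrite andbT.
  by have := comp_sumn bc; case: (sumn b) => // k _; rewrite /is_comp /= all_nseq orbT.
- by rewrite /is_pcomp /= all_nseq orbT.
have -> : gsteps (0 :: nseq (sumn a) 1) [seq nseq (sumn b) 1 | b <- s] =
    map (omap (fun=> true)) (gsteps a s).
  rewrite !(gsteps_eq _ (map _ _)) (gsteps_eq a) map_cat; congr (_ ++ _).
    case: a ap {lt} => // m a ap; rewrite !gsteps0 -omap_rsteps.
      by rewrite /pos /=.
    by have := pos_ge1 ap; rewrite /is_comp /pos.
  elim: s sc {lt} => //= b s IH /andP[bc /IH ->].
  by rewrite map_cat omap_rsteps.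
rewrite (nth_map None) ?size_gsteps //; by case: (nth _ _ _).
Qed.

(** The sums n_1, n_1 + n_2, ... at which the gaps occur, that is, the indices of the generators
    left out of the parabolic subalgebra. *)
Definition seps a s := dlist (sumn a) [seq sumn b | b <- s].

Lemma flatten_None m s i : all is_comp s -> i < sumn [seq sumn b | b <- s] ->
  (m + i \in dlist m [seq sumn b | b <- s]) =
  (nth None (flatten [seq None :: rsteps b | b <- s]) i == None).
Proof.
elim: s m i => [|b s IH] m i //= /andP[bc sc] lt.
have bs : (size (rsteps b)).+1 = sumn b.
  by case: b bc {lt} => // k b /andP[_ /andP[k0 b0]]; rewrite size_rsteps.
rewrite dlist_cons in_cons; case: i lt => [|i] lt; first by rewrite addn0 !eqxx.
rewrite -[X in _ == X]addn0 eqn_add2l /= nth_cat.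
case: ltnP => ib.
  have -> : (m + i.+1 \in dlist (m + sumn b) [seq sumn b0 | b0 <- s]) = false.
    by apply/negbTE/negP => /dlist_ge; rewrite leq_add2l -bs ltnS leqNgt ib.
  apply/esym/negbTE; apply: contra (rsteps_Some b) => /eqP <-; exact: mem_nth.
have le : sumn b <= i.+1 by rewrite -bs.
have -> : i - size (rsteps b) = i.+1 - sumn b by rewrite -bs subSS.
rewrite -(IH (m + sumn b)) //; last by lia.
by have -> : m + i.+1 = m + sumn b + (i.+1 - sumn b) by rewrite -addnA subnKC.
Qed.

Lemma seps_None a s i : is_pcomp a -> all is_comp s -> i < sumn a + sumn [seq sumn b | b <- s] ->
  (i \in seps a s) = (nth None (gsteps a s) i == None).
Proof.
move=> ap sc lt; have := size_gsteps ap (isT : all is_comp [::]); rewrite /= addn0 => sa.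
rewrite gsteps_eq nth_cat sa; case: ltnP => ia.
  apply/idP/idP => [/dlist_ge|/eqP h]; first by lia.
  by have := rsteps_Some (pos a); rewrite -gsteps0 -{1}h mem_nth ?sa.
rewrite -(@flatten_None (sumn a)) ?subnKC //; lia.
Qed.

(** t fills each gap of st by a step to the right or up. By [bracketP] and [bracket_ex] these
    fillings are the step sequences of the elements of the bracket. *)
Definition completes st t := all2 (fun c d : step => (d != None) && ((c == None) || (c == d))) st t.

Lemma completes_refl st : None \notin st -> completes st st.
Proof. by elim: st => //= c st IH; rewrite in_cons negb_or eq_sym => /andP[-> /IH]; rewrite eqxx orbT. Qed.

Lemma completes_cat st1 st2 t1 t2 : size st1 = size t1 ->
  completes (st1 ++ st2) (t1 ++ t2) = completes st1 t1 && completes st2 t2.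
Proof. by rewrite /completes; elim: st1 t1 => [|c st1 IH] [|d t1] //= [/IH ->]; rewrite andbA. Qed.

Lemma completes_eq st t : None \notin st -> completes st t -> t = st.
Proof.
elim: st t => [|c st IH] [|d t] //=; rewrite in_cons negb_or eq_sym => /andP[/negbTE -> h].
by case/andP => /andP[_ /eqP ->] /(IH _ h) ->.
Qed.

Lemma bracket_rcons a s b : bracket a (rcons s b) =
  [seq c ++ b | c <- bracket a s] ++ [seq ncat c b | c <- bracket a s].
Proof. by rewrite /bracket foldl_rcons. Qed.

Lemma bracketP a s c : is_pcomp a -> all is_comp s -> c \in bracket a s ->
  [/\ is_pcomp c, sumn c = sumn a + sumn [seq sumn b | b <- s] & completes (gsteps a s) (gsteps c [::])].
Proof.
move=> ap; elim/last_ind: s c => [|s b IH] c.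
  rewrite inE addn0 => _ /eqP ->; split=> //.
  by apply: completes_refl; rewrite gsteps0 rsteps_Some.
rewrite all_rcons => /andP[bc sc]; rewrite bracket_rcons gsteps_rcons map_rcons sumn_rcons.
have H d (e : bool) c' : d \in bracket a s -> is_pcomp c' ->
  gsteps c' [::] = gsteps d [::] ++ Some e :: rsteps b ->
  [/\ is_pcomp c', sumn c' = sumn a + (sumn [seq sumn b0 | b0 <- s] + sumn b)
   & completes (gsteps a s ++ None :: rsteps b) (gsteps c' [::])].
  move=> db c'p c'e; have [dp ds dc] := IH d sc db; split=> //.
    have := size_gsteps c'p (isT : all is_comp [::]); have := size_gsteps dp (isT : all is_comp [::]).
    rewrite /= !addn0 c'e size_cat => -> <- /=; rewrite ds -addnA; congr (_ + _); congr (_ + _).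
    by case: b bc {c'e} => // k b /andP[_ /andP[k0 b0]]; rewrite size_rsteps.
  rewrite c'e completes_cat ?dc /=; first by apply: completes_refl; apply: rsteps_Some.
  by rewrite !size_gsteps // ds addn0.
rewrite mem_cat => /orP[] /mapP[d ds ->]; have [dp _ _] := IH d sc ds.
- by apply: (H d true) => //; [apply: is_pcomp_cat | apply: gsteps_cat].
- by apply: (H d false) => //; [apply: is_pcomp_ncat | apply: gsteps_ncat].
Qed.

Lemma bracket_ex a s t : is_pcomp a -> all is_comp s -> completes (gsteps a s) t ->
  exists2 c, c \in bracket a s & gsteps c [::] = t.
Proof.
move=> ap; elim/last_ind: s t => [|s b IH] t.
  move=> _ /completes_eq -> //; first by exists a; rewrite ?inE.
  by rewrite gsteps0 rsteps_Some.
rewrite all_rcons => /andP[bc sc]; rewrite gsteps_rcons => h.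
have st : size t = size (gsteps a s ++ None :: rsteps b).
  by move: h; rewrite /completes all2E => /andP[/eqP ->].
rewrite -(cat_take_drop (size (gsteps a s)) t) in h *.
have sz : size (gsteps a s) = size (take (size (gsteps a s)) t).
  by rewrite size_takel // st size_cat leq_addr.
move: h; rewrite completes_cat // => /andP[/(IH _ sc)[c cb <-]].
case: (drop _ _) => [|[e|] d] //= /(completes_eq (rsteps_Some b)) ->.
have [cp _ _] := bracketP ap sc cb.
rewrite bracket_rcons; case: e.
  by exists (c ++ b); rewrite ?gsteps_cat // mem_cat (map_f (cat^~ b)).
by exists (ncat c b); rewrite ?gsteps_ncat // mem_cat orbC (map_f (ncat^~ b)).
Qed.

(** The first step up has index m - 1, which recovers the first row. *)
Lemma rsteps_inj m a m' a' : 0 < m -> 0 < m' -> all (leq 1) a -> all (leq 1) a' ->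
  rsteps (m :: a) = rsteps (m' :: a') -> m :: a = m' :: a'.
Proof.
have idx k (t : seq step) : index (Some true) (nseq k (Some false) ++ Some true :: t) = k.
  by elim: k => //= k ->.
have noU k : Some true \notin rsteps [:: k].
  by rewrite /rsteps cats0 mem_nseq andbF.
elim: a m m' a' => [|k a IH] m m' [|k' a'] m0 m0' //.
- by move=> _ _ /(congr1 size); rewrite /rsteps !cats0 !size_nseq /= => e; congr [:: _]; lia.
- by move=> _ _ e; have := noU m; rewrite e rsteps_cons mem_cat in_cons eqxx orbT.
- by move=> _ _ e; have := noU m'; rewrite -e rsteps_cons mem_cat in_cons eqxx orbT.
move=> /andP[k0 a0] /andP[k0' a0']; rewrite !rsteps_cons => e.
have em : m = m' by have := congr1 (index (Some true)) e; rewrite !idx; lia.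
move: e; rewrite em => /(congr1 (drop (size (nseq m'.-1 (Some false : step))))).
by rewrite !drop_size_cat // => -[e]; congr (_ :: _); apply: IH.
Qed.

Lemma gsteps_inj a a' : is_pcomp a -> is_pcomp a' -> gsteps a [::] = gsteps a' [::] -> a = a'.
Proof.
case: a => // m a; case: a' => // m' a' /andP[_ h] /andP[_ h']; rewrite !gsteps0 /pos /=.
by move/rsteps_inj => /(_ isT isT h h') [-> ->].
Qed.

End StepsDescents.

(** * Tableaux as signed words *)

(** Plain words of integers are common labels for tableaux of both types and for their
    concatenations, whose sizes differ. *)
Definition sgword (n : nat) (u : seq int) :=
  [&& size u == n, uniq [seq `|z|%N | z <- u] & all (fun z : int => (0 < `|z| <= n)%N) u].

(* The position of [z] in a signed word, negative when it is [- z] that occurs: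
   this is the inverse signed permutation. *)
Definition wpos (u : seq int) (z : int) : int :=
  if z \in u then (index z u).+1%:Z else - (index (- z) u).+1%:Z.

Definition wdesc (i : nat) (u : seq int) : bool :=
  if i == 0%N then -1 \in u else wpos u i.+1%:Z < wpos u i%:Z.

Section Words.
Variable n : nat.
Implicit Types (i j k : 'I_n) (x y : signed n) (p q : {perm signed n}).
Implicit Types (tau : {ffun 'I_n -> signed n}) (u : seq int).
Local Notation W := (signed_perms n).

Definition tword tau : seq int := [seq sint (tau k) | k <- enum 'I_n].
Definition tabof p : {ffun 'I_n -> signed n} := [ffun k => p (k, false)].
Definition rw p : seq int := tword (tabof p).

Lemma size_tword tau : size (tword tau) = n.
Proof. by rewrite size_map size_enum_ord. Qed.

Lemma nth_tword tau k : nth 0 (tword tau) k = sint (tau k).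
Proof. by rewrite (nth_map k) ?size_enum_ord // nth_ord_enum. Qed.

Lemma tword_inj : injective tword.
Proof. by move=> s t e; apply/ffunP => k; apply: sint_inj; rewrite -!nth_tword e. Qed.

Lemma nth_rw p k : nth 0 (rw p) k = sint (p (k, false)).
Proof. by rewrite nth_tword ffunE. Qed.

Lemma tabof_inj p q : p \in W -> q \in W -> tabof p = tabof q -> p = q.
Proof.
move=> /WP pW /WP qW e; have e' k : p (k, false) = q (k, false).
  by have := congr1 (fun f : {ffun 'I_n -> signed n} => f k) e; rewrite !ffunE.
apply/permP => -[k [|]] //; by rewrite -[(k, true)]/(sopp (k, false)) pW qW e'.
Qed.

Lemma rw_inj p q : p \in W -> q \in W -> rw p = rw q -> p = q.
Proof. by move=> pW qW /tword_inj; apply: tabof_inj. Qed.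

Lemma signedE x : x = if x.2 then sopp (x.1, false) else (x.1, false).
Proof. by case: x => k [|]. Qed.

Lemma rw_sgen p i : rw (p * sgen i)%g = [seq sI i z | z <- rw p].
Proof.
rewrite /rw /tword -map_comp; apply: eq_map => k.
by rewrite /= !ffunE permM sint_sgen.
Qed.

Lemma abs_sint x : `|sint x|%N = x.1.+1.
Proof. by case: x => k [|]; rewrite /sint /=; lia. Qed.

Lemma rw_sgword p : p \in W -> sgword n (rw p).
Proof.
move=> /WP pW; rewrite /sgword size_tword eqxx /= -map_comp map_inj_uniq ?enum_uniq /=; last first.
  move=> k l /=; rewrite !ffunE !abs_sint => -[/ord_inj e].
  have [e'|e'] : p (k, false) = p (l, false) \/ p (k, false) = p (l, true).
    case e2 : (p (k, false)) => [a b]; case e3 : (p (l, false)) => [c d].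
    have e4 : p (l, true) = (c, ~~ d) by rewrite -[(l, true)]/(sopp (l, false)) pW e3.
    rewrite e4; move: e; rewrite e2 e3 /= => ->; case: b d {e2 e3 e4} => [] []; by [left | right].
  - by have [] := perm_inj e'.
  - by have [] := perm_inj e'.
by apply/allP => z /mapP[k _ ->]; rewrite sint_bound.
Qed.

Lemma sgwordP u : reflect (exists2 p, p \in W & rw p = u) (sgword n u).
Proof.
apply: (iffP idP) => [|[p pW <-]]; last exact: rw_sgword.
case/and3P => /eqP us uu ub.
have ex k : exists x, sint x == nth 0 u k.
  have [x h] : exists x, sint x = nth 0 u k by apply: sintP; apply: (allP ub); rewrite mem_nth ?us.
  by exists x; rewrite h.
pose t k := xchoose (ex k); have tE k : sint (t k) = nth 0 u k by apply/eqP/(xchooseP (ex k)).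
pose f x := if x.2 then sopp (t x.1) else t x.1.
have absf x : `|sint (f x)|%N = `|nth 0%R u x.1|%N.
  by rewrite -tE /f; case: ifP => _; rewrite ?sint_opp ?abszN.
have f_inj : injective f.
  move=> x y e; have e1 : x.1 = y.1.
    have := absf x; rewrite e absf => e1; apply: ord_inj.
    apply/eqP; rewrite -(@nth_uniq _ 0%N _ _ _ _ _ uu) ?size_map ?us //.
    by rewrite !(nth_map 0) ?us // e1.
  move: e; rewrite /f e1; case: x y e1 => [a b] [c d] /= ->.
  case: b d => [] [] //= /(congr1 (@sint n)); rewrite sint_opp; have := sint_neq0 (t c); lia.
exists (perm f_inj).
  by apply/WP => x; rewrite !permE /f; case: x => k [|] //=; rewrite soppK.
apply: (@eq_from_nth _ 0); first by rewrite size_tword us.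
move=> k; rewrite size_tword => lt; rewrite -[k]/(val (Ordinal lt)) nth_rw permE.
by rewrite -tE.
Qed.

Lemma mem_rw p x : p \in W -> (sint x \in rw p) = ~~ (p^-1%g x).2.
Proof.
move=> /WP pW; apply/mapP/idP => [[k _]|h].
  by rewrite ffunE => /sint_inj ->; rewrite permK.
exists (p^-1%g x).1; first by rewrite mem_enum.
by rewrite ffunE -[x in LHS](permKV p) [p^-1%g x in LHS]signedE (negbTE h).
Qed.

Lemma index_rw p x : p \in W -> ~~ (p^-1%g x).2 -> index (sint x) (rw p) = (p^-1%g x).1.
Proof.
move=> pW h; have /and3P[_ /map_uniq uu _] := rw_sgword pW.
have <- : nth 0 (rw p) (p^-1%g x).1 = sint x.
  by rewrite nth_rw -[in RHS](permKV p x) [p^-1%g x in RHS]signedE (negbTE h).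
by rewrite index_uniq // size_tword.
Qed.

Lemma wpos_rw p x : p \in W -> wpos (rw p) (sint x) = sint (p^-1%g x).
Proof.
move=> pW; rewrite /wpos mem_rw //; case: ifPn => h.
  by rewrite index_rw // /sint (negbTE h).
rewrite -sint_opp negbK in h *.
have h' : ~~ (p^-1%g (sopp x)).2 by rewrite (WP _ (WV pW)) /= h.
by rewrite index_rw // (WP _ (WV pW)) /sint h.
Qed.

Lemma wdesc_rw p i : p \in W -> wdesc i (rw p) = DL i p.
Proof.
move=> pW; rewrite /wdesc /DL /DR.
have lo := sint_lo i; have hi := sint_hi i; case: ifPn lo => [/eqP i0|i0] lo.
  have e : slo i = sopp (shi i) by apply: sint_inj; rewrite lo sint_opp hi i0.
  rewrite -lo mem_rw // e (WP _ (WV pW)) sint_opp /= negbK /sint.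
  by case: ifP => _; lia.
by rewrite -hi -lo !wpos_rw.
Qed.

(* The word of [p] is increasing along the steps to the right and decreasing
   along the steps up. *)
Definition good (st : seq step) p :=
  [forall j : 'I_n, if nth None st j is Some b then DR j p == b else true].

Lemma goodP st p : reflect (forall j b, nth None st j = Some b -> DR j p = b) (good st p).
Proof.
apply: (iffP forallP) => h j; first by move=> b e; have := h j; rewrite e => /eqP.
by have := h j; case: (nth None st j) => // b /(_ b erefl) ->.
Qed.

Lemma nth0_rw p j : p \in W -> (DR j p = (nth 0 (0 :: rw p) j.+1 < nth 0 (0 :: rw p) j)) *
  (~~ DR j p = (nth 0 (0 :: rw p) j < nth 0 (0 :: rw p) j.+1)).
Proof.
move=> pW; rewrite /DR /= nth_rw -/(shi j).
have e : nth 0 (0 :: rw p) j = if j == 0%N :> nat then 0 else sint (p (slo j)).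
  rewrite /slo; case: j => [[|k] lt] //=.
  have lt' : (k < n)%N by apply: ltnW.
  rewrite -[k]/(val (Ordinal lt')) nth_rw; congr (sint (p (_, _))).
  by apply: ord_inj; rewrite ord_predE.
rewrite e; have := sint_neq0 (p (shi j)).
have [j0|j0] := eqVneq (j : nat) 0%N.
  have -> : slo j = sopp (shi j) by apply: sint_inj; rewrite sint_opp sint_lo sint_hi j0.
  by rewrite (WP _ pW) sint_opp; split; lia.
have : sint (p (slo j)) != sint (p (shi j)).
  by apply/eqP => /sint_inj/perm_inj/(congr1 (@sint n)); have := lt_lohi j; lia.
by split; lia.
Qed.

Lemma compat_good st p : p \in W -> size st = n -> compat 0 st (rw p) = good st p.
Proof.
move=> pW ss; apply/compatP/goodP => [[_ h] j b e|h].
  have := h j; rewrite ss => /(_ (ltn_ord j)); rewrite e.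
  by case: b {e}; rewrite /okstep -?(nth0_rw j pW).1 -?(nth0_rw j pW).2 => // /negbTE.
split; first by rewrite ss size_tword.
move=> k lt; rewrite ss in lt; have := h (Ordinal lt).
case: (nth None st k) => // b /(_ b erefl) /= <-.
have [h1 h2] := nth0_rw (Ordinal lt) pW; rewrite /okstep -h1 -h2.
by case: (DR _ _) => //.
Qed.

Section Standard.
Variables (a : seq nat) (s : seq (seq nat)).
Hypothesis gp : is_gpribbon n a s.

Let ap : is_pcomp a. Proof. by case/and3P: gp. Qed.
Let sc : all is_comp s. Proof. by case/and3P: gp. Qed.

Lemma size_gsteps_n : size (gsteps a s) = n.
Proof. by case/and3P: gp => _ _ /eqP ->; rewrite size_gsteps. Qed.

Lemma standardB_word tau : standardB a s tau =
  sgword n (tword tau) && compat 0 (gsteps a s) (tword tau).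
Proof.
rewrite /standardB andbC; congr (_ && _).
  apply/existsP/sgwordP => [[w /andP[wW /forallP h]]|[w wW e]]; exists w => //.
    by congr tword; apply/ffunP => k; rewrite ffunE (eqP (h k)).
  rewrite wW; apply/forallP => k; rewrite -(tword_inj e) ffunE; exact: eqxx.
have en (k : 'I_n.+1) : entry tau k = nth 0 (0 :: tword tau) k.
  rewrite /entry; case: unliftP => [j ->|->] //.
  by rewrite lift0 /= nth_tword.
rewrite gpribbonE //; have ss := size_gsteps_n.
apply/increasingP/compatP; rewrite ?ss //; last by move=> [_ h] k lt; exact: h.
  by move=> h; split; rewrite ?size_tword // ss.
Qed.

Lemma standardB_perm tau : standardB a s tau -> exists2 p, p \in W & tau = tabof p.
Proof.
by rewrite standardB_word => /andP[/sgwordP[p pW e] _]; exists p => //; apply/esym/tword_inj.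
Qed.

End Standard.
End Words.

(** * Spaces with a basis labelled by words *)

Section WordBasis.
Variable F : fieldType.

(** An interface shared by tableau spaces and tensor products, so that one comparison with the Hecke
    algebra covers both. *)
Record wbasis (X : lmodType F) (L : seq (seq int)) := WBasis {
  wvec : seq int -> X;
  wcoef : X -> seq int -> F;
  wuniq : uniq L;
  wcoef_lin : forall c x y u, wcoef (c *: x + y) u = c * wcoef x u + wcoef y u;
  wcoefE : forall u v, u \in L -> v \in L -> wcoef (wvec u) v = (u == v)%:R;
  wspan : forall x, x = \sum_(u <- L) wcoef x u *: wvec u
}.

(** The rule for pi_i - 1 on words. The predicate [ok] restricts the indices, since on a tensor
    product only those inside a block are meaningful. *)
Definition wop (X : lmodType F) L (B : wbasis X L) (ok : pred nat) (op : nat -> X -> X) : Prop :=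
  forall i, ok i -> (forall c x y, op i (c *: x + y) = c *: op i x + op i y) /\
    forall u, u \in L -> op i (wvec B u) =
      if wdesc i u then - wvec B u
      else if [seq sI i z | z <- u] \in L then wvec B [seq sI i z | z <- u] else 0.

Section Tableaux.
Variables (T : finType) (P : pred T) (wd : T -> seq int).
Hypothesis wd_inj : {in P &, injective wd}.
Local Notation S := {t | P t}.
Local Notation V := {ffun S -> F^o}.

Definition tabwords : seq (seq int) := [seq wd (val t) | t <- enum {: S}].
Definition tabvec (u : seq int) : V := [ffun t => (wd (val t) == u)%:R].
Definition tabcoef (x : V) (u : seq int) : F := \sum_(t | wd (val t) == u) x t.

Lemma wd_val_inj : injective (fun t : S => wd (val t)).
Proof. by move=> s t /= e; apply: val_inj; apply: wd_inj => //; apply: valP. Qed.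

Lemma tabcoef_wd x (t : S) : tabcoef x (wd (val t)) = x t.
Proof.
by rewrite /tabcoef (big_pred1 t) // => r; apply/eqP/eqP => [/wd_val_inj|->].
Qed.

Fact tabwords_uniq : uniq tabwords.
Proof. by rewrite map_inj_uniq ?enum_uniq //; apply: wd_val_inj. Qed.
Fact tabcoef_lin c x y u : tabcoef (c *: x + y) u = c * tabcoef x u + tabcoef y u.
Proof. by rewrite /tabcoef big_distrr -big_split; apply: eq_bigr => t _; rewrite !ffunE. Qed.
Fact tabcoefE u v : u \in tabwords -> v \in tabwords -> tabcoef (tabvec u) v = (u == v)%:R.
Proof. by move=> /mapP[r _ ->] /mapP[t _ ->]; rewrite tabcoef_wd ffunE eq_sym. Qed.
Fact tabspan x : x = \sum_(u <- tabwords) tabcoef x u *: tabvec u.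
Proof.
rewrite big_map; apply/ffunP => t; rewrite sum_ffunE big_enum /= (bigD1 t) //= tabcoef_wd.
rewrite !ffunE eqxx [X in X + _]mulr1 big1 ?addr0 // => r rt; rewrite !ffunE.
by rewrite (inj_eq wd_val_inj) eq_sym (negbTE rt) [LHS]mulr0.
Qed.

Definition tab_basis : wbasis V tabwords :=
  WBasis tabwords_uniq tabcoef_lin tabcoefE tabspan.

Lemma mem_tabwords u : reflect (exists2 t, P t & wd t = u) (u \in tabwords).
Proof.
apply: (iffP mapP) => [[t _ ->]|[t Pt <-]]; first by exists (val t); rewrite ?(valP t).
by exists (exist P t Pt); rewrite ?mem_enum.
Qed.

Lemma linext_lin (h : S -> V) c x y : linext h (c *: x + y) = c *: linext h x + linext h y.
Proof.
rewrite /linext scaler_sumr -big_split; apply: eq_bigr => t _.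
by rewrite /= !ffunE scalerA -scalerDl.
Qed.

Lemma linext_tabvec (h : S -> V) (t : S) : linext h (tabvec (wd (val t))) = h t.
Proof.
rewrite /linext (bigD1 t) //= ffunE eqxx scale1r big1 ?addr0 // => r rt.
by rewrite ffunE (inj_eq wd_val_inj) (negbTE rt) scale0r.
Qed.

Lemma bvecE t : P t -> bvec F P t = tabvec (wd t).
Proof.
move=> Pt; apply/ffunP => r; rewrite !ffunE; congr (_%:R); congr nat_of_bool.
by apply/eqP/eqP => [-> //|/wd_inj]; apply=> //; apply: valP.
Qed.

End Tableaux.
End WordBasis.

(** * Tableaux of type B *)

Section TypeBWords.
Variables (F : fieldType) (n : nat) (a : seq nat) (s : seq (seq nat)).
Hypothesis gp : is_gpribbon n a s.
Local Notation W := (signed_perms n).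
Local Notation st := (gsteps a s).
Implicit Types (i : 'I_n) (p : {perm signed n}).

Let ap : is_pcomp a. Proof. by case/and3P: gp. Qed.
Let sc : all is_comp s. Proof. by case/and3P: gp. Qed.

Lemma brow_mono (k l : 'I_n) : (k <= l)%N -> (brow a s k <= brow a s l)%N.
Proof.
by move=> kl; rewrite /brow gpribbonE // row_mono // ltnS kl (size_gsteps_n gp) ltn_ord.
Qed.

Lemma brow_eq_lt p (k l : 'I_n) : p \in W -> standardB a s (tabof p) -> (k < l)%N ->
  brow a s k = brow a s l -> sint (p (k, false)) < sint (p (l, false)).
Proof.
move=> pW; rewrite standardB_word // => /andP[_ /compatP[_ h]] kl; rewrite /brow gpribbonE // => e.
have := same_row_lt h (_ : (k.+1 < l.+1 <= size st)%N) e.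
by rewrite /= !nth_rw; apply; rewrite ltnS kl (size_gsteps_n gp) ltn_ord.
Qed.

(** Rows weakly increase in reading order, and within one row standardness puts the smaller entry
    first. The comparisons of rows in the definition are therefore comparisons of positions. *)
Lemma descentB_DL p i : p \in W -> standardB a s (tabof p) -> descentB a s i (tabof p) = DL i p.
Proof.
move=> pW std; rewrite -wdesc_rw // /wdesc /descentB.
have mem_val (z : int) : [exists k, sint (tabof p k) == z] = (z \in rw p).
  apply/existsP/mapP => [[k /eqP <-]|[k _ ->]]; exists k => //; by rewrite mem_enum.
case: ifPn => [_|i0]; first exact: mem_val.
have lo := sint_lo i; rewrite (negbTE i0) in lo; have hi := sint_hi i.
rewrite -lo -hi !wpos_rw // -!sint_opp.
have eqv (x : signed n) k : (sint (tabof p k) == sint x) = (p^-1%g x == (k, false)).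
  rewrite ffunE; apply/eqP/eqP => [/sint_inj <-|e]; first by rewrite permK.
  by rewrite -e permKV.
have pVN := WP _ (WV pW).
(* k and l are the positions of the values i and i + 1 up to sign; b and b' tell whether they occur
   negated. *)
case ex : (p^-1%g (slo i)) => [k b]; case ey : (p^-1%g (shi i)) => [l b'].
have {}ex : slo i = p (k, b) by rewrite -ex permKV.
have {}ey : shi i = p (l, b') by rewrite -ey permKV.
have lt := lt_lohi i; have pN := WP _ pW.
have eqv1 k0 : (p^-1%g (slo i) == (k0, false)) = ~~ b && (k == k0).
  by rewrite ex permK xpair_eqE andbC eqbF_neg.
have eqv2 k0 : (p^-1%g (shi i) == (k0, false)) = ~~ b' && (l == k0).
  by rewrite ey permK xpair_eqE andbC eqbF_neg.
have eqv3 k0 : (p^-1%g (sopp (slo i)) == (k0, false)) = b && (k == k0).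
  by rewrite pVN ex permK xpair_eqE andbC /= eqbF_neg negbK.
have eqv4 k0 : (p^-1%g (sopp (shi i)) == (k0, false)) = b' && (l == k0).
  by rewrite pVN ey permK xpair_eqE andbC /= eqbF_neg negbK.
transitivity [|| [&& ~~ b, ~~ b' & (brow a s l < brow a s k)%N],
    [&& b, b' & (brow a s k < brow a s l)%N] | ~~ b && b'].
  apply/existsP/idP => [[k0 /existsP[l0]]|].
    rewrite !eqv eqv1 eqv2 eqv3 eqv4.
    by case: b {ex eqv1 eqv3} => /=; case: b' {ey eqv2 eqv4} => //=; rewrite ?andbF ?orbF //;
      case/and3P => /eqP -> /eqP ->.
  move=> h; exists k; apply/existsP; exists l; rewrite !eqv eqv1 eqv2 eqv3 eqv4 !eqxx !andbT.
  by move: h; case: (b) => /=; case: (b') => /=; rewrite ?andbF ?orbF.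
have kl : k != l.
  apply/eqP => e; move: ex ey; rewrite e; case: (b); case: (b') => ex ey.
  - by move: lt; rewrite ex ey ltxx.
  - have e2 : slo i = sopp (shi i) by rewrite ex ey -pN.
    by have := congr1 (@sint n) e2; rewrite sint_opp lo hi; lia.
  - have e2 : shi i = sopp (slo i) by rewrite ex ey -pN.
    by have := congr1 (@sint n) e2; rewrite sint_opp lo hi; lia.
  - by move: lt; rewrite ex ey ltxx.
have brow_lt k0 l0 : k0 != l0 -> (sint (p (l0, false)) < sint (p (k0, false))) ->
    (brow a s k0 < brow a s l0)%N = (k0 < l0)%N.
  move=> kl0 lt0; case: (ltngtP k0 l0) => [c|c|/ord_inj e]; last by rewrite e eqxx in kl0.
    have le := brow_mono (ltnW c); rewrite ltn_neqAle le andbT; apply/eqP => e.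
    have := brow_eq_lt pW std c e; by rewrite ltNge ltW.
  apply/negbTE; rewrite -leqNgt; exact: brow_mono (ltnW c).
rewrite /sint /=; case: b ex {eqv1 eqv3} => ex; case: b' ey {eqv2 eqv4} => ey /=; rewrite ?orbF.
- rewrite brow_lt //.
  have -> : (l, false) = sopp (l, true) by [].
  have -> : (k, false) = sopp (k, true) by [].
  by rewrite !pN -ex -ey !sint_opp; lia.
- by lia.
- by lia.
- rewrite brow_lt; [by lia | by rewrite eq_sym | by rewrite -ex -ey].
Qed.

Definition spaceB_basis : wbasis (spaceB F n a s) (tabwords (standardB a s) (@tword n)) :=
  tab_basis F (in2W (@tword_inj n)).

Lemma mem_wordsB u : (u \in tabwords (standardB (n := n) a s) (@tword n)) =
  sgword n u && compat 0 st u.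
Proof.
apply/mem_tabwords/andP => [[t + <-]|[/sgwordP[p pW <-] c]].
  by rewrite standardB_word // => /andP.
by exists (tabof p) => //; rewrite standardB_word // rw_sgword.
Qed.

Lemma opB_basis : wop spaceB_basis (ltn^~ n)
  (oop (o := opspace_of (@opB F n a s))).
Proof.
move=> i lt; split=> [c x y|u ul]; rewrite /= insubT; first exact: linext_lin.
have /mem_tabwords[t tP te] := ul; rewrite -te /opB.
rewrite [LHS](linext_tabvec (in2W (@tword_inj n)) _ (exist _ t tP)) /=.
have [p pW tE] := standardB_perm gp tP; rewrite tE in tP te *.
rewrite descentB_DL // -(wdesc_rw (Ordinal lt) pW) /=.
have aE : act_tabB (Ordinal lt) (tabof p) = tabof (p * sgen (Ordinal lt))%g.
  by apply/ffunP => k; rewrite !ffunE permM.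
have rE := rw_sgen p (Ordinal lt); rewrite /= in rE.
have memE : ([seq sI i z | z <- rw p] \in tabwords (standardB (n := n) a s) (@tword n)) =
   standardB a s (tabof (p * sgen (Ordinal lt))%g).
  by rewrite -rE mem_wordsB standardB_word.
case: ifP => _; first by rewrite (bvecE F (in2W (@tword_inj n)) tP).
rewrite -/(rw p) memE aE; case: ifP => // h; rewrite (bvecE F (in2W (@tword_inj n)) h).
by rewrite -rE.
Qed.

End TypeBWords.

(** * Tableaux of type A *)

Section TypeAWords.
Variables (F : fieldType) (b : seq nat).
Hypothesis bc : is_comp b.
Local Notation m := (sumn b).
Local Notation st := (rsteps b).
Implicit Types (i k : 'I_m) (tau : {ffun 'I_m -> 'I_m}) (u : seq int).

Definition aword tau : seq int := [seq (tau k).+1%:Z | k <- enum 'I_m].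

Let size_st : (size st).+1 = m.
Proof. by case: b bc => // k c /andP[_ /andP[k0 c0]]; rewrite size_rsteps. Qed.

Lemma size_aword tau : size (aword tau) = m.
Proof. by rewrite size_map size_enum_ord. Qed.

Lemma nth_aword tau k : nth 0 (aword tau) k = (tau k).+1%:Z.
Proof. by rewrite (nth_map k) ?size_enum_ord // nth_ord_enum. Qed.

Lemma aword_inj : injective aword.
Proof.
move=> t t' e; apply/ffunP => k; apply: ord_inj; have := nth_aword t k.
by rewrite e nth_aword => -[].
Qed.

Lemma standardA_compat tau : injectiveb tau ->
  standardA b tau = compat 0 (None :: st) (aword tau).
Proof.
move=> ti; rewrite /standardA ti ribbon0E //=.
have -> : (increasing (boxes (0, 0)%N st) (fun k => (tau k)%:Z)) =
    increasing (boxes (0, 0)%N st) (fun k => (tau k).+1%:Z).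
  apply: eq_forallb => p; apply: eq_forallb => q.
  by congr ((_ ==> _) && (_ ==> _)); lia.
have R := @increasingP st (0, 0)%N m (fun k => (tau k).+1%:Z) (nth 0 (aword tau))
  (esym size_st) (fun k => esym (nth_aword tau k)).
have sz : size (aword tau) = (size st).+1 by rewrite size_aword size_st.
case: (aword tau) sz R => [|y u] //= [us] R; apply/R/idP => [h|/compatP[_ h] k lt]; last exact: h.
by apply/compatP; split.
Qed.

Lemma mem_wordsA u : (u \in tabwords (standardA (m := m) b) aword) =
  [&& sgword m u, all (fun z => 0 < z) u & compat 0 (None :: st) u].
Proof.
apply/mem_tabwords/and3P => [[t + <-]|[us up uc]].
  move=> /[dup] /andP[/[dup] ti /injectiveP tinj _]; rewrite standardA_compat // => -> .
  split=> //; last by apply/allP => z /mapP[k _ ->].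
  rewrite /sgword size_aword eqxx -map_comp map_inj_uniq ?enum_uniq /=.
    by apply/allP => z /mapP[k _ ->] /=.
  by move=> x y /= [] /ord_inj /tinj.
have [/eqP sz un ub] := and3P us.
have val_u (k : 'I_m) : (0 < nth 0%R u k) /\ (`|nth 0%R u k|.-1 < m)%N.
  have mu : nth 0%R u k \in u by rewrite mem_nth ?sz.
  by split; [exact: (allP up) | have := allP ub _ mu; lia].
pose t : {ffun 'I_m -> 'I_m} := [ffun k => Ordinal (val_u k).2].
have tu : aword t = u.
  apply: (@eq_from_nth _ 0); rewrite size_aword ?sz // => k lt.
  rewrite -[k]/(val (Ordinal lt)) nth_aword ffunE /=.
  by have [/= h _] := val_u (Ordinal lt); move: h; clear; lia.
have ti : injectiveb t.
  apply/injectiveP => k l e; apply: ord_inj; apply/eqP.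
  rewrite -(@nth_uniq _ 0%N _ _ _ _ _ un) ?size_map ?sz //.
  by rewrite !(nth_map 0) ?sz // -tu !nth_aword e.
by exists t => //; rewrite standardA_compat // tu.
Qed.

Definition spaceA_basis : wbasis (spaceA F m b) (tabwords (standardA (m := m) b) aword) :=
  tab_basis F (in2W aword_inj).

Lemma index_aword tau k : injective tau -> index (tau k).+1%:Z (aword tau) = k.
Proof.
move=> ti; rewrite -nth_aword index_uniq ?size_aword //.
by rewrite map_inj_uniq ?enum_uniq // => x y [] /ord_inj /ti.
Qed.

Lemma mem_aword tau k : (tau k).+1%:Z \in aword tau.
Proof. by apply: (map_f (fun k => (tau k).+1%:Z)); rewrite mem_enum. Qed.

(** The type A operator does not test whether s_i(tau) is standard. When i precedes i + 1 in reading
    order, the exchange breaks a common row; if the rows differ, it is shown to preserve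
    standardness. *)
Lemma opA_basis : wop spaceA_basis (fun j : nat => 0 < j < m)%N
  (oop (o := opspace_of (@opA F m b))).
Proof.
move=> i' /andP[i0' lt']; split=> [c x y|u ul]; rewrite /= insubT; first exact: linext_lin.
set i := Sub i' lt' : 'I_m; have i0 : (0 < i)%N by [].
have /mem_tabwords[t tP te] := ul; rewrite -te /opA.
rewrite [LHS](linext_tabvec (in2W aword_inj) _ (exist _ t tP)) /=.
have /andP[tib _] := tP; have ti := injectiveP _ tib.
(* p and q are the boxes of the entries i and i + 1, represented by the ordinals i - 1 and i. *)
have /codomP[p /esym pE] := injF_onto ti (ord_pred i).
have /codomP[q /esym qE] := injF_onto ti i.
have pE' : (t p).+1 = i :> nat by rewrite pE ord_predE; lia.
have memP k : ((t k).+1 == i :> nat) = (k == p).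
  by rewrite -pE' eqSS; apply/eqP/eqP => [/ord_inj/ti|->].
have memQ k : (t k == i) = (k == q) by rewrite -qE (inj_eq ti).
have pq : p != q by rewrite -(inj_eq ti) pE qE; apply/eqP => e; move: pE'; rewrite pE e; lia.
have exE (R : 'I_m -> 'I_m -> bool) :
    [exists x, exists y, [&& (t x).+1 == i :> nat, t y == i & R x y]] = R p q.
  apply/existsP/idP => [[x /existsP[y]]|h].
    by rewrite memP memQ => /and3P[/eqP -> /eqP ->].
  by exists p; apply/existsP; exists q; rewrite memP memQ !eqxx.
rewrite /higherA /same_rowA (exE (fun x y => (arow b x > arow b y)%N)) (exE (fun x y => arow b x == arow b y)).
have arowE k : arow b k = Defs.row (boxes (0, 0)%N st) k by rewrite /arow ribbon0E.
have arow_mono (k l : 'I_m) : (k <= l)%N -> (arow b k <= arow b l)%N.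
  by move=> kl; rewrite !arowE row_mono // kl -ltnS size_st ltn_ord.
have okt : compat 0 (None :: st) (aword t) by rewrite -standardA_compat.
have row_lt (r : {ffun 'I_m -> 'I_m}) (k l : 'I_m) : compat 0 (None :: st) (aword r) ->
   (k < l)%N -> arow b k = arow b l -> (r k < r l)%N.
  move=> /compatP[_ h] kl e; rewrite !arowE in e.
  have h' j : (j < size st)%N -> okstep (nth None st j) (nth 0 (aword r) j) (nth 0 (aword r) j.+1).
    by move=> lt; apply: (h j.+1); rewrite /= ltnS.
  have := same_row_lt h' (_ : (k < l <= size st)%N) e.
  by rewrite kl -ltnS size_st ltn_ord !nth_aword => /(_ isT).
have wE : wdesc i' (aword t) = (q < p)%N.
  have e1 : i'.+1%:Z = (t q).+1%:Z by rewrite qE.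
  have e2 : i'%:Z = (t p).+1%:Z by rewrite pE'.
  by rewrite /wdesc gtn_eqF // e1 e2 /wpos !mem_aword !index_aword.
have aE : aword (act_tabA i t) = [seq sI i' z | z <- aword t].
  rewrite /aword -map_comp; apply: eq_map => k /=; rewrite ffunE /sI gtn_eqF //.
  have [kp|kp] := eqVneq k p; first by rewrite kp pE' eqxx pE tpermL.
  have [kq|kq] := eqVneq k q.
    rewrite kq qE tpermR; have -> : (i.+1%:Z == i') = false by rewrite /=; lia.
    by rewrite eqxx ord_predE //=; lia.
  rewrite tpermD; last 2 first.
  - by rewrite -pE (inj_eq ti) eq_sym.
  - by rewrite -qE (inj_eq ti) eq_sym.
  have h1 : (t k).+1 != i' by rewrite -[i']/(nat_of_ord i) memP.
  have h2 : (t k).+1 != i'.+1 by apply: contra kq => /eqP [e]; rewrite -memQ; apply/eqP/ord_inj.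
  have {}h1 : ((t k).+1%:Z == i'%:Z) = false by apply/negbTE.
  have {}h2 : ((t k).+1%:Z == i'.+1%:Z) = false by apply/negbTE.
  have h3 : ((t k).+1%:Z == - i'%:Z) = false by clear; lia.
  have h4 : ((t k).+1%:Z == - i'.+1%:Z) = false by clear; lia.
  by rewrite h1 h2 h3 h4.
have act_inj : injectiveb (act_tabA i t).
  by apply/injectiveP => x y; rewrite !ffunE => /perm_inj/ti.
have actP : act_tabA i t p = i /\ act_tabA i t q = ord_pred i.
  by rewrite !ffunE pE qE tpermL tpermR.
have lt_pred : (ord_pred i < i)%N by rewrite ord_predE //; lia.
rewrite wE; have [qp|qp] := boolP (q < p)%N.
  have := arow_mono q p (ltnW qp); rewrite leq_eqVlt => /predU1P[e|->].
    by have := row_lt _ _ _ okt qp e; rewrite pE qE; move: lt_pred; clear; lia.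
  by rewrite (bvecE F (in2W aword_inj) tP).
have {}qp : (p < q)%N by rewrite ltn_neqAle pq leqNgt.
have le := arow_mono _ _ (ltnW qp); rewrite ltnNge le /=.
have memE : (aword (act_tabA i t) \in tabwords (standardA (m := m) b) aword) =
    standardA b (act_tabA i t).
  by apply/mem_tabwords/idP => [[t' t'P /aword_inj <-]|h] //; exists (act_tabA i t).
rewrite -aE memE; case: eqP => [e|ne].
  case: ifP => //; rewrite standardA_compat // => /row_lt /(_ qp e).
  by rewrite actP.1 actP.2; move: lt_pred; clear; lia.
suff h : standardA b (act_tabA i t) by rewrite h; exact: (bvecE F (in2W aword_inj) h).
have tne k : k != p -> k != q -> act_tabA i t k = t k /\ t k != i /\ t k != ord_pred i.
  move=> kp kq; rewrite ffunE -pE -qE !(inj_eq ti) kp kq tpermD //.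
  - by rewrite (inj_eq ti) eq_sym.
  - by rewrite (inj_eq ti) eq_sym.
(* Exchanging two consecutive values changes no comparison other than that of p with q. *)
have swap (k l : 'I_m) : k != l -> (k, l) != (p, q) -> (k, l) != (q, p) ->
    (act_tabA i t k < act_tabA i t l)%N = (t k < t l)%N.
  have ip : ord_pred i = i.-1 :> nat by rewrite ord_predE.
  have F1 (x : 'I_m) : [/\ x = p -> t x = i.-1 :> nat, x <> p -> t x <> i.-1 :> nat,
      x = q -> t x = i :> nat & x <> q -> t x <> i :> nat].
    by rewrite -ip; split=> [->|h /ord_inj|->|h /ord_inj]; rewrite -?pE -?qE // => /ti.
  have F2 (x : 'I_m) : [/\ x = p -> act_tabA i t x = i :> nat, x = q -> act_tabA i t x = i.-1 :> nat
      & x <> p -> x <> q -> act_tabA i t x = t x :> nat].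
    rewrite -ip; split=> [->|->|/eqP h1 /eqP h2]; rewrite ?actP.1 ?actP.2 //.
    by have [-> _] := tne _ h1 h2.
  move=> /eqP kl /eqP h1 /eqP h2; have [a1 a2 a3 a4] := F1 k; have [b1 b2 b3 b4] := F1 l.
  have [c1 c2 c3] := F2 k; have [d1 d2 d3] := F2 l.
  have [e|ne1] := pselect (k = p).
    have lp : l <> p by move=> e'; apply: kl; rewrite e e'.
    have lq : l <> q by move=> e'; apply: h1; rewrite e e'.
    by rewrite (c1 e) (d3 lp lq) (a1 e); have := b2 lp; have := b4 lq; move: i0; clear; lia.
  have [e|ne2] := pselect (k = q).
    have lq : l <> q by move=> e'; apply: kl; rewrite e e'.
    have lp : l <> p by move=> e'; apply: h2; rewrite e e'.
    by rewrite (c2 e) (d3 lp lq) (a3 e); have := b2 lp; have := b4 lq; move: i0; clear; lia.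
  rewrite (c3 ne1 ne2); have := a2 ne1; have := a4 ne2.
  have [e|lp] := pselect (l = p); first by rewrite (d1 e) (b1 e); move: i0; clear; lia.
  have [e|lq] := pselect (l = q); first by rewrite (d2 e) (b3 e); move: i0; clear; lia.
  by rewrite (d3 lp lq).
rewrite standardA_compat //; apply/compatP; split; first by rewrite size_aword /= size_st.
move=> [|j] //= lt; rewrite ltnS in lt.
have /compatP[_ /(_ j.+1)] := okt; rewrite /= ltnS lt => /(_ isT).
have jm : (j < m)%N by rewrite -size_st ltnS ltnW.
have j1m : (j.+1 < m)%N by rewrite -size_st ltnS.
have nk r := nth_aword r (Ordinal jm); have nl r := nth_aword r (Ordinal j1m).
rewrite /= in nk nl; rewrite !nk !nl.
set k := Ordinal jm; set l := Ordinal j1m.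
have kl : (k < l)%N by [].
have kl' : k != l by rewrite neq_ltn kl.
have kl2 : (k, l) != (q, p) by apply/eqP => -[e1 e2]; rewrite e1 e2 in kl; move: qp kl; clear; lia.
have lk2 : (l, k) != (p, q) by apply/eqP => -[e1 e2]; rewrite e1 e2 in kl; move: qp kl; clear; lia.
(* If p and q are neighbours, the step between them is not to the right because their rows differ,
   and the exchanged entries decrease as a step up requires. *)
have [/eqP[e1 e2]|kl3] := boolP ((k, l) == (p, q)).
  have : nth None st j != Some false.
    apply/eqP => e; apply: ne; rewrite -e1 -e2 !arowE row_boxes // e /=; by rewrite addn0.
  case: (nth None st j) => [[|]|] //= _; rewrite e1 e2 pE qE.
  by move: lt_pred; clear; lia.
have s1 := swap _ _ kl' kl3 kl2.
have lk3 : (l, k) != (q, p) by apply: contra kl3 => /eqP[-> ->].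
have s2 := swap l k _ lk2 lk3; rewrite eq_sym in s2; have {}s2 := s2 kl'.
by case: (nth None st j) => [[|]|] //=; rewrite !ltz_nat !ltnS ?s1 ?s2.
Qed.

End TypeAWords.

(** * Tensor products of tableau spaces *)

Section TensorLift.
Variables (A B : nzRingType) (M : bimod A B) (N : lmodType B).
Local Notation TQ := (ring_quotient.Quotient.quot (@tensor_sub A B M N)).

Lemma tensor_ind (S : tensor M N -> Prop) : S 0 -> (forall t t', S t -> S t' -> S (t - t')) ->
  (forall m x, S (tpure m x)) -> forall t, S t.
Proof.
move=> S0 SB Sp t; rewrite -[t](@generic_quotient.reprK _ TQ).
set f := generic_quotient.repr _; rewrite [f]monalgE raddf_sum /=.
elim: (msupp f : seq _) => [|k s IH]; first by rewrite big_nil.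
have SN t' : S t' -> S (- t') by move=> h; rewrite -[- t']add0r; apply: SB.
have SD t1 t2 : S t1 -> S t2 -> S (t1 + t2).
  by move=> h1 h2; rewrite -[t2]opprK; apply: (SB) => //; apply: SN.
rewrite big_cons; apply: (fun h => SD _ _ h IH).
have -> : << f@_k *g k >> = << k >> *~ f@_k :> {malg int[(M * N)%type]}.
  apply/malgP => j; rewrite -[RHS]/(mcoeff j _) raddfMz /= !mcoeffU.
  by case: (k == j); rewrite ?mul0rz // !mulr1n intz.
rewrite raddfMz /=; have h : S (tpure k.1 k.2) by [].
have hn n : S (tpure k.1 k.2 *+ n) by elim: n => [|n IHn]; rewrite ?mulr0n // mulrS; apply: SD.
have -> : generic_quotient.pi TQ << k >> = tpure k.1 k.2 by case: (k).
by case: f@_k => n; [apply: hn | apply: SN; apply: hn].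
Qed.

Variables (V : zmodType) (h : M * N -> V).
Hypothesis hDl : forall m m' x, h (m + m', x) = h (m, x) + h (m', x).
Hypothesis hDr : forall m x x', h (m, x + x') = h (m, x) + h (m, x').
Hypothesis hM : forall m b x, h (bact m b, x) = h (m, b *: x).

Definition tlift (t : tensor M N) : V := zext h (generic_quotient.repr (t : TQ)).

Lemma tlift_pi f : tlift (generic_quotient.pi TQ f) = zext h f.
Proof. exact: zext_tensor_sub. Qed.

Lemma tlift_pure m x : tlift (tpure m x) = h (m, x).
Proof. by rewrite [LHS]tlift_pi zextU. Qed.

Lemma tliftB t u : tlift (t - u) = tlift t - tlift u.
Proof.
rewrite -[t](@generic_quotient.reprK _ TQ) -[u](@generic_quotient.reprK _ TQ).
by rewrite -(raddfB (generic_quotient.pi TQ)) !tlift_pi raddfB.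
Qed.

Lemma tlift0 : tlift 0 = 0.
Proof. by have := tliftB 0 0; rewrite subr0 subrr. Qed.
Lemma tliftD t u : tlift (t + u) = tlift t + tlift u.
Proof.
have tN v : tlift (- v) = - tlift v by rewrite -[- v]sub0r tliftB tlift0 sub0r.
by rewrite -[u]opprK tliftB !tN.
Qed.

End TensorLift.

Section TensorF.
Variables (F : fieldType) (X Y : lmodType F).
Local Notation T := (tensor_F X Y).
Local Notation pure := (@tpure F F (scalar_bimod X) Y).

Lemma pureZ c (x : X) y : c *: (pure x y : T) = pure (c *: x) y.
Proof. exact: tscale_pure. Qed.
Lemma pureZr c (x : X) y : c *: (pure x y : T) = pure x (c *: y).
Proof. by rewrite pureZ; exact: (@tpureM F F (scalar_bimod X) Y x c y). Qed.
Lemma pure_suml (I : Type) (r : seq I) (f : I -> X) y :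
  pure (\sum_(i <- r) f i) y = \sum_(i <- r) pure (f i) y :> T.
Proof.
elim: r => [|i r IH]; last by rewrite !big_cons [LHS]tpureDl IH.
rewrite !big_nil; have := tpureDl (0 : scalar_bimod X) 0 y; rewrite addr0.
by move/(congr1 (fun t => t - pure 0 y)); rewrite subrr addrK.
Qed.
Lemma pure_sumr (I : Type) (r : seq I) (f : I -> Y) x :
  pure x (\sum_(i <- r) f i) = \sum_(i <- r) pure x (f i) :> T.
Proof.
elim: r => [|i r IH]; last by rewrite !big_cons [LHS]tpureDr IH.
rewrite !big_nil; have := tpureDr (x : scalar_bimod X) 0 (0 : Y); rewrite addr0.
by move/(congr1 (fun t => t - pure x 0)); rewrite subrr addrK.
Qed.

Lemma tmap_F_lin (f : X -> X) (g : Y -> Y) :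
  (forall c x y, f (c *: x + y) = c *: f x + f y) ->
  (forall c x y, g (c *: x + y) = c *: g x + g y) ->
  (forall x y, tmap_F f g (pure x y) = pure (f x) (g y)) /\
  (forall c t u, tmap_F f g (c *: t + u) = c *: tmap_F f g t + tmap_F f g u).
Proof.
move=> fl gl.
have f0 : f 0 = 0.
  by have := fl 1 0 0; rewrite !scale1r addr0 => /(congr1 (fun x => x - f 0)); rewrite subrr addrK.
have g0 : g 0 = 0.
  by have := gl 1 0 0; rewrite !scale1r addr0 => /(congr1 (fun x => x - g 0)); rewrite subrr addrK.
have fD x y : f (x + y) = f x + f y by have := fl 1 x y; rewrite !scale1r.
have gD x y : g (x + y) = g x + g y by have := gl 1 x y; rewrite !scale1r.
have fZ c x : f (c *: x) = c *: f x by have := fl c x 0; rewrite !addr0 f0 addr0.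
have gZ c x : g (c *: x) = c *: g x by have := gl c x 0; rewrite !addr0 g0 addr0.
have P x y : tmap_F f g (pure x y) = pure (f x) (g y).
  by apply: (@tmap_pure F F (scalar_bimod X) Y) => // *; apply: fZ.
have B t u : tmap_F f g (t - u) = tmap_F f g t - tmap_F f g u.
  by apply: (@tmap_is_zmod_morphism F F (scalar_bimod X) Y) => // *; apply: fZ.
have T0 : tmap_F f g 0 = 0 by have := B 0 0; rewrite !subrr.
have TN t : tmap_F f g (- t) = - tmap_F f g t by rewrite -sub0r B T0 sub0r.
have D t u : tmap_F f g (t + u) = tmap_F f g t + tmap_F f g u.
  by rewrite -{1}[u]opprK B TN opprK.
have Z c t : tmap_F f g (c *: t) = c *: tmap_F f g t.
  elim/tensor_ind: t => [|t t' IH IH'|x y]; first by rewrite scaler0 T0 scaler0.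
    by rewrite [c *: (t - t')]scalerBr B IH IH' B scalerBr.
  by rewrite [in LHS]pureZ !P fZ pureZ.
by split=> [|c t u]; [exact: P | rewrite -Z; exact: D].
Qed.

End TensorF.

(** * Tensor bases labelled by concatenated words *)

Section TensorBasis.
Variables (F : fieldType) (X Y : lmodType F) (LX LY : seq (seq int)) (m : nat).
Variables (BX : wbasis X LX) (BY : wbasis Y LY).
Hypothesis szX : forall u, u \in LX -> size u = m.

Definition shiftw (u : seq int) : seq int := [seq z + m%:Z | z <- u].
Definition unshiftw (u : seq int) : seq int := [seq z - m%:Z | z <- u].
Lemma shiftwK : cancel shiftw unshiftw.
Proof. by move=> u; rewrite /shiftw /unshiftw -map_comp map_id_in // => z _ /=; rewrite addrK. Qed.
Lemma unshiftwK : cancel unshiftw shiftw.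
Proof. by move=> u; rewrite /shiftw /unshiftw -map_comp map_id_in // => z _ /=; rewrite subrK. Qed.

(** Raising the second word by m keeps the absolute values of the concatenation distinct. *)
Definition tensor_words : seq (seq int) := [seq w ++ shiftw w' | w <- LX, w' <- LY].

Lemma mem_tensor_words w w' : w \in LX -> (w ++ shiftw w' \in tensor_words) = (w' \in LY).
Proof.
move=> wX; apply/allpairsP/idP => [[[v v'] /= [vX vY /eqP]]|w'Y]; last by exists (w, w').
by rewrite eqseq_cat ?szX // => /andP[_ /eqP/(can_inj shiftwK) ->].
Qed.

Local Notation T := (tensor_F X Y).
Definition tensor_vec (u : seq int) : T :=
  tpure (wvec BX (take m u) : scalar_bimod X) (wvec BY (unshiftw (drop m u))).
Definition tensor_pairing (u : seq int) (p : scalar_bimod X * Y) : F :=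
  wcoef BX p.1 (take m u) * wcoef BY p.2 (unshiftw (drop m u)).
Definition tensor_coef (t : T) (u : seq int) : F := tlift (tensor_pairing u) t.

Lemma wcoefD (Z : lmodType F) L (B : wbasis Z L) x y u : wcoef B (x + y) u = wcoef B x u + wcoef B y u.
Proof. by have := wcoef_lin B 1 x y u; rewrite scale1r mul1r. Qed.
Lemma wcoef0 (Z : lmodType F) L (B : wbasis Z L) u : wcoef B 0 u = 0.
Proof.
by have := wcoefD B 0 0 u; rewrite addr0 => /(congr1 (fun x => x - wcoef B 0 u)); rewrite subrr addrK.
Qed.
Lemma wcoefZ (Z : lmodType F) L (B : wbasis Z L) c x u : wcoef B (c *: x) u = c * wcoef B x u.
Proof. by have := wcoef_lin B c x 0 u; rewrite !addr0 wcoef0 addr0. Qed.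

Fact pairDl u m1 m2 x : tensor_pairing u (m1 + m2, x) = tensor_pairing u (m1, x) + tensor_pairing u (m2, x).
Proof. by rewrite /tensor_pairing /= wcoefD mulrDl. Qed.
Fact pairDr u m1 x y : tensor_pairing u (m1, x + y) = tensor_pairing u (m1, x) + tensor_pairing u (m1, y).
Proof. by rewrite /tensor_pairing /= wcoefD mulrDr. Qed.
Fact pairM u m1 c x : tensor_pairing u (bact m1 c, x) = tensor_pairing u (m1, c *: x).
Proof. by rewrite /tensor_pairing /= !wcoefZ mulrCA mulrA. Qed.

Lemma tensor_coef_pure x y u : tensor_coef (tpure (x : scalar_bimod X) y) u = tensor_pairing u (x, y).
Proof. exact: tlift_pure (pairDl u) (pairDr u) (pairM u) x y. Qed.
Lemma tensor_coefB t t' u : tensor_coef (t - t') u = tensor_coef t u - tensor_coef t' u.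
Proof. exact: tliftB (pairDl u) (pairDr u) (pairM u) t t'. Qed.
Lemma tensor_coefD t t' u : tensor_coef (t + t') u = tensor_coef t u + tensor_coef t' u.
Proof. exact: tliftD (pairDl u) (pairDr u) (pairM u) t t'. Qed.
Lemma tensor_coef0 u : tensor_coef 0 u = 0.
Proof. exact: tlift0 (pairDl u) (pairDr u) (pairM u). Qed.

Fact tensor_words_uniq : uniq tensor_words.
Proof.
apply: allpairs_uniq; [exact: wuniq BX | exact: wuniq BY|].
move=> [w1 w1'] [w2 w2'] /allpairsP[[? ?] /= [h1 _ [-> ->]]] /allpairsP[[? ?] /= [h2 _ [-> ->]]].
by move/eqP; rewrite eqseq_cat ?szX // => /andP[/eqP -> /eqP/(can_inj shiftwK) ->].
Qed.
Fact tensor_coef_lin c t t' u : tensor_coef (c *: t + t') u = c * tensor_coef t u + tensor_coef t' u.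
Proof.
rewrite tensor_coefD; congr (_ + _).
elim/tensor_ind: t => [|t1 t2 IH IH'|x y]; first by rewrite scaler0 tensor_coef0 mulr0.
  by rewrite scalerBr !tensor_coefB IH IH' mulrBr.
by rewrite [c *: _]pureZ !tensor_coef_pure /tensor_pairing /= wcoefZ mulrA.
Qed.

Lemma tensor_vecE w w' : w \in LX -> tensor_vec (w ++ shiftw w') = tpure (wvec BX w : scalar_bimod X) (wvec BY w').
Proof. by move=> wX; rewrite /tensor_vec take_size_cat ?drop_size_cat ?szX // shiftwK. Qed.
Lemma tensor_pairingE w w' x y : w \in LX ->
  tensor_pairing (w ++ shiftw w') (x, y) = wcoef BX x w * wcoef BY y w'.
Proof. by move=> wX; rewrite /tensor_pairing take_size_cat ?drop_size_cat ?szX // shiftwK. Qed.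

Fact tensor_coefE u v : u \in tensor_words -> v \in tensor_words -> tensor_coef (tensor_vec u) v = (u == v)%:R.
Proof.
move=> /allpairsP[[w1 w1'] /= [h1 h1' ->]] /allpairsP[[w2 w2'] /= [h2 h2' ->]].
rewrite tensor_vecE // tensor_coef_pure tensor_pairingE // !wcoefE // eqseq_cat ?szX //.
rewrite (inj_eq (can_inj shiftwK)); by do 2!case: eqP; rewrite ?mulr0 ?mulr1 ?mul0r.
Qed.

Fact tensor_span t : t = \sum_(u <- tensor_words) tensor_coef t u *: tensor_vec u.
Proof.
elim/tensor_ind: t => [|t t' IH IH'|x y].
- by rewrite big1 // => u _; rewrite tensor_coef0 scale0r.
- rewrite {1}IH {1}IH' -sumrB; apply: eq_bigr => u _; by rewrite tensor_coefB scalerBl.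
rewrite /tensor_words big_allpairs_dep {1}(wspan BX x) pure_suml big_seq [RHS]big_seq; apply: eq_bigr => w wX.
rewrite {1}(wspan BY y) pure_sumr; apply: eq_bigr => w' _.
by rewrite tensor_coef_pure tensor_pairingE // tensor_vecE // -pureZ -pureZr scalerA.
Qed.

Definition tensor_basis : wbasis T tensor_words :=
  WBasis tensor_words_uniq tensor_coef_lin tensor_coefE tensor_span.

End TensorBasis.

Lemma sgword_mem m (w : seq int) (z : int) : sgword m w -> (0 < `|z| <= m)%N -> (z \in w) = (- z \notin w).
Proof.
move=> /sgwordP[p pW <-] /sintP[x <-].
by rewrite mem_rw // -sint_opp mem_rw // (WP _ (WV pW)) negbK.
Qed.

(** * Descents and exchanges in concatenated words *)

Section Concatenation.
Variables (m k : nat).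
Implicit Types (w u : seq int) (i : nat) (z : int).

Definition posword (w : seq int) := all (fun z => 0 < z) w.

Lemma shiftw_gt w z : posword w -> z \in shiftw m w -> m%:Z < z.
Proof. by move=> /allP h /mapP[y /h y0 ->]; lia. Qed.

Lemma mem_shiftw w z : (z \in shiftw m w) = (z - m%:Z \in w).
Proof.
apply/mapP/idP => [[y yw ->]|h]; first by rewrite addrK.
by exists (z - m%:Z); rewrite ?subrK.
Qed.

Lemma wpos_catl w u z : sgword m w -> posword u -> 0 < z <= m%:Z ->
  wpos (w ++ shiftw m u) z = wpos w z.
Proof.
move=> sw pu zb; rewrite /wpos mem_cat.
have -> : (z \in shiftw m u) = false by apply/negbTE/negP => /(shiftw_gt pu); lia.
have hm : (- z \in w) = ~~ (z \in w) by rewrite (sgword_mem sw) ?negbK //; lia.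
by rewrite orbF !index_cat hm; case: (z \in w).
Qed.

Lemma wdesc_catl w u i : sgword m w -> posword u -> (i < m)%N ->
  wdesc i (w ++ shiftw m u) = wdesc i w.
Proof.
move=> sw pu im; rewrite /wdesc; case: eqP => i0; last by rewrite !wpos_catl //; lia.
rewrite mem_cat; have -> : (-1 \in shiftw m u) = false; last by rewrite orbF.
by apply/negbTE/negP => /(shiftw_gt pu); lia.
Qed.

Lemma sI_catl w u i : posword u -> (i < m)%N ->
  [seq sI i z | z <- w ++ shiftw m u] = [seq sI i z | z <- w] ++ shiftw m u.
Proof.
move=> pu im; rewrite map_cat; congr (_ ++ _); apply: map_id_in => z /(shiftw_gt pu) zm.
by rewrite /sI; do ![case: eqP]; lia.
Qed.

Lemma wpos_catr w u z : sgword m w -> sgword k u -> posword u -> m%:Z < z <= (m + k)%:Z ->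
  wpos (w ++ shiftw m u) z = m%:Z + wpos u (z - m%:Z).
Proof.
move=> sw su pu zb; rewrite /wpos mem_cat mem_shiftw.
have /and3P[/eqP sz _ /allP wb] := sw.
have -> : (z \in w) = false by apply/negbTE/negP => /wb; lia.
have zu : z - m%:Z \in u.
  rewrite (sgword_mem su); last by lia.
  by apply/negP => /(allP pu); lia.
rewrite zu /= index_cat; have -> : (z \in w) = false by apply/negbTE/negP => /wb; lia.
have -> : index z (shiftw m u) = index (z - m%:Z) u.
  have inj : injective (fun y : int => y + m%:Z) by exact: addIr.
  by rewrite -[RHS](index_map inj) /= subrK.
by rewrite sz -addnS PoszD.
Qed.

Lemma wdesc_catr w u i : sgword m w -> sgword k u -> posword u -> (m < i < m + k)%N ->
  wdesc i (w ++ shiftw m u) = wdesc (i - m) u.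
Proof.
move=> sw su pu ib; rewrite /wdesc; have -> : (i == 0%N) = false by lia.
have -> : (i - m == 0)%N = false by lia.
rewrite !(wpos_catr sw su) //; try lia.
have -> : i.+1%:Z - m%:Z = (i - m).+1%:Z by lia.
have -> : i%:Z - m%:Z = (i - m)%N%:Z by lia.
by rewrite ltrD2l.
Qed.

Lemma sI_catr w u i : sgword m w -> posword u -> (m < i)%N ->
  [seq sI i z | z <- w ++ shiftw m u] = w ++ shiftw m [seq sI (i - m) z | z <- u].
Proof.
move=> /and3P[_ _ /allP wb] /allP pu mi; rewrite map_cat; congr (_ ++ _).
  by apply: map_id_in => z /wb zb; rewrite /sI; do ![case: eqP]; lia.
rewrite /shiftw -!map_comp; apply/eq_in_map => z /pu z0 /=.
by rewrite /sI; do ![case: eqP]; lia.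
Qed.

End Concatenation.

Section TensorOps.
Variables (F : fieldType) (X Y : opspace F) (LX LY : seq (seq int)) (m k : nat).
Variables (BX : wbasis X LX) (BY : wbasis Y LY) (okX okY : pred nat).
Hypothesis opX : wop BX okX (@oop _ X).
Hypothesis opY : wop BY okY (@oop _ Y).
Hypothesis okXm : forall i, okX i -> (i < m)%N.
Hypothesis okYk : forall i, okY i -> (0 < i < k)%N.
Hypothesis sgX : forall u, u \in LX -> sgword m u.
Hypothesis sgY : forall u, u \in LY -> sgword k u.
Hypothesis posY : forall u, u \in LY -> posword u.

Lemma sizeX u : u \in LX -> size u = m.
Proof. by move=> /sgX/and3P[/eqP]. Qed.

Lemma pureN (x : X) (y : Y) : tpure (- x : scalar_bimod X) y = - tpure (x : scalar_bimod X) y :> tensor_F X Y.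
Proof. by rewrite -scaleN1r -[RHS]scaleN1r pureZ. Qed.
Lemma pureNr (x : X) (y : Y) : tpure (x : scalar_bimod X) (- y) = - tpure (x : scalar_bimod X) y :> tensor_F X Y.
Proof. by rewrite -scaleN1r -[RHS]scaleN1r pureZr. Qed.
Lemma pure0 (y : Y) : tpure (0 : scalar_bimod X) y = 0 :> tensor_F X Y.
Proof. by have := pure_suml [::] (fun _ : nat => 0 : X) y; rewrite !big_nil. Qed.
Lemma pure0r (x : X) : tpure (x : scalar_bimod X) (0 : Y) = 0 :> tensor_F X Y.
Proof. by have := pure_sumr [::] (fun _ : nat => 0 : Y) x; rewrite !big_nil. Qed.

(** For i < m, and likewise for i > m, the values moved by s_i all occur in one factor, so descents
    and exchanges are decided there; only i = m would mix the factors. *)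
Lemma tensor_wop : wop (tensor_basis BX BY sizeX) (fun i => okX i || ((m < i) && okY (i - m)))%N
  (@oop _ (opspace_tensor m X Y)).
Proof.
have tv := tensor_vecE BX BY sizeX; have mt := mem_tensor_words LY sizeX.
move=> i; case: (boolP (okX i)) => [oki _|_ /= /andP[mi oki]].
  have im := okXm oki; rewrite /= im; have [lin act] := opX oki.
  have [P L] := tmap_F_lin lin (fun c (x y : Y) => erefl (c *: x + y)).
  split=> [c x y|u /allpairsP[[w w'] /= [wX wY ->]]]; first exact: L.
  rewrite tv // [LHS]P act // wdesc_catl ?sgX ?posY // sI_catl ?posY //.
  case: ifP => _; first exact: pureN.
  have -> : ([seq sI i z | z <- w] ++ shiftw m w' \in tensor_words LX LY m) = ([seq sI i z | z <- w] \in LX).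
    apply/idP/idP => [|h]; last by rewrite mt.
    move=> /allpairsP[[v v'] /= [vX vY /eqP]].
    by rewrite eqseq_cat ?(sizeX vX) ?size_map ?(sizeX wX) // => /andP[/eqP -> _].
  case: ifP => h; last exact: pure0.
  by rewrite tv.
have im : (i < m)%N = false by apply/negbTE; rewrite -leqNgt ltnW.
rewrite /= im; have [lin act] := opY oki.
have [P L] := tmap_F_lin (fun c (x y : X) => erefl (c *: x + y)) lin.
split=> [c x y|u /allpairsP[[w w'] /= [wX wY ->]]]; first exact: L.
have ib : (m < i < m + k)%N by have := okYk oki; lia.
rewrite tv // [LHS]P act // (wdesc_catr (sgX wX) (sgY wY)) ?posY // (sI_catr (sgX wX)) ?posY //.
case: ifP => _; first exact: pureNr.
rewrite mt //.
case: ifP => h; last exact: pure0r.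
by rewrite tv.
Qed.

End TensorOps.

(** Each d in D splits u into letters of absolute value at most d and positive letters above d. By
    [blockok_WI] this is membership in the parabolic subgroup that omits the indices in D. *)
Definition blockok (D : seq nat) (u : seq int) : bool :=
  all (fun d : nat => all (fun z : int => `|z|%N <= d)%N (take d u) &&
                      all (fun z : int => d%:Z < z) (drop d u)) D.

Definition blockword (m : nat) (a : seq nat) (s : seq (seq nat)) (u : seq int) : bool :=
  [&& sgword m u, compat 0 (gsteps a s) u & blockok (seps a s) u].

Lemma dlist_rcons m t k : dlist m (rcons t k) = rcons (dlist m t) (m + sumn t)%N.
Proof.
elim: t m => [|x t IH] m; first by rewrite /= dlist_cons /dlist /= addn0.
by rewrite rcons_cons !dlist_cons IH /= addnA.
Qed.

(** * Adding one ribbon to a tensor product *)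

Section Stage.
Variables (a : seq nat) (s : seq (seq nat)) (b : seq nat).
Hypotheses (ap : is_pcomp a) (sc : all is_comp s) (bc : is_comp b).
Local Notation m := (sumn a + sumn [seq sumn c | c <- s])%N.
Local Notation k := (sumn b).

Lemma seps_rcons : seps a (rcons s b) = rcons (seps a s) m.
Proof. by rewrite /seps map_rcons dlist_rcons. Qed.

Lemma seps_lt d : d \in seps a s -> (d < m)%N.
Proof.
clear bc b; rewrite /seps => dd; have ge := dlist_ge dd; move: dd; rewrite -(subnKC ge).
elim: s (sumn a) (d - sumn a)%N sc => [|c t IH] x y //= /andP[cc tc].
rewrite dlist_cons in_cons -[X in _ == X]addn0 eqn_add2l; have c0 := comp_sumn cc.
case/predU1P => [->|yd]; first by lia.
have yc : (sumn c <= y)%N by have := dlist_ge yd; rewrite leq_add2l.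
move: yd; rewrite -{1}(subnKC yc) addnA => /(IH _ _ tc).
by lia.
Qed.

Lemma compat_None x y st u : compat x (None :: st) u = compat y (None :: st) u.
Proof. by case: u. Qed.

Lemma compat_shift w st : compat 0 (None :: st) (shiftw m w) = compat 0 (None :: st) w.
Proof.
rewrite -[RHS](@compat_mono (fun z => z + m%:Z)); first exact: compat_None.
by move=> y z; rewrite ltrD2r.
Qed.

Lemma sgword_catE w w' : size w = m -> posword w' ->
  all (fun z : int => `|z| <= m)%N w ->
  sgword (m + k) (w ++ shiftw m w') = sgword m w && sgword k w'.
Proof.
move=> sw pw wm; rewrite /sgword size_cat size_map sw eqn_add2l eqxx /=.
rewrite map_cat cat_uniq all_cat.
have abs_shift : [seq `|z|%N | z <- shiftw m w'] = [seq (x + m)%N | x <- [seq `|z|%N | z <- w']].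
  rewrite /shiftw -!map_comp; apply/eq_in_map => z /(allP pw) /=; lia.
have -> : uniq [seq `|z|%N | z <- shiftw m w'] = uniq [seq `|z|%N | z <- w'].
  by rewrite abs_shift map_inj_uniq // => x y; apply: addIn.
have -> : all (fun z : int => (0 < `|z| <= m + k)%N) w = all (fun z : int => (0 < `|z| <= m)%N) w.
  by apply: eq_in_all => z /(allP wm); lia.
have -> : all (fun z : int => (0 < `|z| <= m + k)%N) (shiftw m w') =
    all (fun z : int => (0 < `|z| <= k)%N) w'.
  by rewrite all_map; apply: eq_in_all => z /(allP pw) /=; lia.
have -> : has (mem [seq `|z|%N | z <- w]) [seq `|z|%N | z <- shiftw m w'] = false.
  apply/hasPn => x /mapP[z /(shiftw_gt pw) zm ->]; apply/mapP => -[y /(allP wm) ym e].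
  by move: zm ym e => /=; lia.
by rewrite /= -!andbA; do !bool_congr.
Qed.

(** The separator m cuts u into a part bounded by m and a part above m, which becomes a positive
    word on subtracting m; the earlier separators then constrain only the first part. *)
Lemma mem_blockword LX (u : seq int) : (forall u, (u \in LX) = blockword m a s u) ->
  (u \in tensor_words LX (tabwords (standardA (m := k) b) (@aword b)) m) =
  blockword (m + k) a (rcons s b) u.
Proof.
move=> LXE; rewrite /blockword gsteps_rcons seps_rcons.
have sg : size (gsteps a s) = m by rewrite size_gsteps.
have bo_cat w w' : size w = m -> posword w' -> all (fun z : int => `|z| <= m)%N w ->
    blockok (rcons (seps a s) m) (w ++ shiftw m w') = blockok (seps a s) w.
  move=> sw pw wm; have gt : all (fun z : int => m%:Z < z) (shiftw m w').
    by apply/allP => z /(shiftw_gt pw).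
  rewrite /blockok all_rcons take_size_cat // drop_size_cat // wm gt /=.
  apply: eq_in_all => d /seps_lt dm.
  rewrite takel_cat ?sw ?(ltnW dm) // drop_cat sw dm all_cat andbA andbC andbA.
  have -> : all (fun z : int => d%:Z < z) (shiftw m w') = true.
    by apply/allP => z /(allP gt); lia.
  by rewrite /= andbC.
apply/allpairsP/and3P => [[[w w'] /= [wX wY ->]]|[us uc ub]].
  move: wX wY; rewrite LXE mem_wordsA // => /and3P[sw cw bw] /and3P[sw' pw' cw'].
  have /and3P[/eqP szw _ /allP wb] := sw.
  have wm : all (fun z : int => `|z| <= m)%N w by apply/allP => z /wb /andP[].
  split; first by rewrite sgword_catE // sw sw'.
  - by rewrite compat_cat ?szw ?sg // cw (compat_None _ 0) compat_shift cw'.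
  - by rewrite bo_cat.
have /and3P[/eqP szu uu /allP ubd] := us.
move: (ub); rewrite /blockok all_rcons => /andP[/andP[tm dm] _].
pose w := take m u; pose w' := unshiftw m (drop m u).
have uE : u = w ++ shiftw m w' by rewrite /w' unshiftwK cat_take_drop.
have szw : size w = m by rewrite size_takel // szu leq_addr.
have pw' : posword w'.
  by apply/allP => z /mapP[y /(allP dm) ym ->]; lia.
rewrite uE in us uc ub; exists (w, w') => /=; rewrite LXE mem_wordsA // /blockword.
rewrite sgword_catE // in us; case/andP: us => -> ->.
rewrite bo_cat // in ub; rewrite ub -/(posword w') pw'.
move: uc; rewrite compat_cat ?szw ?sg // (compat_None _ 0) compat_shift => /andP[-> ->].
by split.
Qed.

End Stage.

Section TensorSpace.
Variables (F : fieldType) (a : seq nat).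
Hypothesis ap : is_pcomp a.

Definition blockgen m a s : pred nat := fun i => (i < m)%N && (i \notin seps a s).

Lemma wop_weak (X : lmodType F) L (B : wbasis X L) (ok ok' : pred nat) op :
  (forall i, ok' i -> ok i) -> wop B ok op -> wop B ok' op.
Proof. by move=> h H i /h /H. Qed.

(** [opspace_tensors] accumulates on the left, so the induction on the remaining components t needs
    an arbitrary space X that already carries the basis for the components s. *)
Lemma tensor_stage t s m (X : opspace F) L (B : wbasis X L) :
  m = (sumn a + sumn [seq sumn c | c <- s])%N -> all is_comp s -> all is_comp t ->
  (forall u, (u \in L) = blockword m a s u) -> wop B (blockgen m a s) (@oop _ X) ->
  exists L' (B' : wbasis (opspace_tensors m X t) L'),
    let m' := (sumn a + sumn [seq sumn c | c <- s ++ t])%N in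
    (forall u, (u \in L') = blockword m' a (s ++ t) u) /\
    wop B' (blockgen m' a (s ++ t)) (@oop _ (opspace_tensors m X t)).
Proof.
elim: t s m X L B => [|b t IH] s m X L B mE sc tc LE opX.
  by exists L, B; rewrite cats0 -mE.
case/andP: tc => bc tc; rewrite -cat_rcons.
have sc' : all is_comp (rcons s b) by rewrite all_rcons bc.
have mE' : (m + sumn b = sumn a + sumn [seq sumn c | c <- rcons s b])%N.
  by rewrite map_rcons sumn_rcons addnA mE.
have sgX u : u \in L -> sgword m u by rewrite LE => /and3P[].
have sgY u : u \in tabwords (standardA (m := sumn b) b) (@aword b) -> sgword (sumn b) u.
  by rewrite mem_wordsA // => /and3P[].
have posY u : u \in tabwords (standardA (m := sumn b) b) (@aword b) -> posword u.
  by rewrite mem_wordsA // => /and3P[].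
have okX i : blockgen m a s i -> (i < m)%N by case/andP.
have W := @tensor_wop F X (opspace_of (@opA F (sumn b) b)) L _ m (sumn b) B (spaceA_basis F b) _ _ opX
  (opA_basis F bc) okX (fun i h => h) sgX sgY posY.
apply: (IH (rcons s b) (m + sumn b)%N (opspace_tensor m X (opspace_of (@opA F (sumn b) b))) _ _ mE' sc' tc _
  (wop_weak _ W)).
  by move=> u; rewrite mE; apply: mem_blockword => //; rewrite -mE.
move=> i /andP[im]; rewrite seps_rcons mem_rcons in_cons negb_or -mE => /andP[i1 i2].
rewrite /blockgen i2 andbT; move: i1 im; clear; case: ltngtP => //=; lia.
Qed.

Lemma tensor_space_basis s : all is_comp s ->
  let n := (sumn a + sumn [seq sumn c | c <- s])%N in
  exists L (B : wbasis (tensor_space F a s) L),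
    (forall u, (u \in L) = blockword n a s u) /\ wop B (blockgen n a s) (@oop _ (tensor_space F a s)).
Proof.
move=> sc; have gp : is_gpribbon (sumn a) a [::] by rewrite /is_gpribbon ap /= addn0.
have W := opB_basis F gp.
apply: (@tensor_stage s [::] (sumn a) (opspace_of (@opB F (sumn a) a [::])) _ (spaceB_basis F (sumn a) a [::])) => //.
- by rewrite addn0.
- by move=> u; rewrite mem_wordsB // /blockword andbT.
- by apply: wop_weak W => i /andP[].
Qed.

End TensorSpace.

(** * Comparison with the ideals of the Hecke algebra *)

Lemma inj_surj_bij (X Y : Type) (f : X -> Y) :
  injective f -> (forall y, exists x, f x = y) -> bijective f.
Proof.
move=> fi fs; exists (fun y => sval (cid (fs y))) => [x|y]; last by case: (cid _).
by apply: fi; case: (cid _).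
Qed.

Section Isomorphisms.
Variables (A : nzRingType) (M N : lmodType A) (f : M -> N).
Hypothesis fl : forall a x y, f (a *: x + y) = a *: f x + f y.
Hypotheses (fi : injective f) (fs : forall y, exists x, f x = y).

Lemma lmod_isoI : lmod_iso M N.
Proof.
pose F : {linear M -> N} := HB.pack f (GRing.isLinear.Build _ _ _ _ f fl).
by exists F; apply: inj_surj_bij.
Qed.
End Isomorphisms.

Lemma lmod_isoI_sym (A : nzRingType) (M N : lmodType A) (f : N -> M) :
  (forall a x y, f (a *: x + y) = a *: f x + f y) -> injective f ->
  (forall y, exists x, f x = y) -> lmod_iso M N.
Proof.
move=> fl fi fs; have [g fK gK] := inj_surj_bij fi fs.
apply: (@lmod_isoI _ _ _ g) => [a x y||x]; last by exists (f x).
  by apply: fi; rewrite fl !gK.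
exact: can_inj gK.
Qed.

(** * Transport of the Hecke action to a space with a word basis *)

Section BasisModule.
Variables (F : fieldType) (n : nat) (V : lmodType F) (L : seq (seq int)) (B : wbasis V L).
Variable K : {set 'I_n}.
Local Notation W := (signed_perms n).
Local Notation H := (hecke F n).
Implicit Types (p q : {perm signed n}) (v : V) (h : H).

Hypothesis LW : forall u, u \in L -> exists2 p, p \in W & rw p = u.
Hypothesis LK : forall p, p \in W -> rw p \in L -> minI K p.

Definition inL : pred {perm signed n} := [pred p | (p \in W) && (rw p \in L)].
Definition bvecH p : H := hpibar F p * hpi F (longest K).
Definition toH v : H := \sum_(p | inL p) wcoef B v (rw p) *: bvecH p.
(** A left inverse of [toH]: the words of L belong to minimal representatives for K, at which
    [bvecH p] has the same coefficients as [hpibar F p]. *)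
Definition ofH h : V := \sum_(p | inL p) hcoord h p *: wvec B (rw p).

Lemma sumL (Z : zmodType) (X : seq int -> Z) : \sum_(u <- L) X u = \sum_(p | inL p) X (rw p).
Proof.
rewrite -[RHS]big_filter -(big_map (@rw n) xpredT X); apply: perm_big.
apply: uniq_perm; first exact: wuniq B.
  rewrite map_inj_in_uniq ?filter_uniq ?index_enum_uniq // => p q.
  rewrite !mem_filter => /andP[/andP[pW _] _] /andP[/andP[qW _] _]; exact: rw_inj.
move=> u; apply/idP/mapP => [uL|[p + ->]]; last by rewrite mem_filter => /andP[/andP[]].
have [p pW pu] := LW uL; exists p => //.
by rewrite mem_filter mem_index_enum andbT /inL /= pW pu uL.
Qed.

Lemma toH_lin c x y : toH (c *: x + y) = c *: toH x + toH y.
Proof.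
rewrite /toH scaler_sumr -big_split; apply: eq_bigr => p _ /=.
by rewrite wcoef_lin scalerDl scalerA.
Qed.
Lemma ofH_lin c x y : ofH (c *: x + y) = c *: ofH x + ofH y.
Proof.
rewrite /ofH scaler_sumr -big_split; apply: eq_bigr => p _ /=.
by rewrite hcoord_lin scalerDl scalerA.
Qed.
Lemma toHD x y : toH (x + y) = toH x + toH y.
Proof. by have := toH_lin 1 x y; rewrite !scale1r. Qed.
Lemma toH0 : toH 0 = 0.
Proof. by have := toHD 0 0; rewrite addr0 => /(congr1 (fun x => x - toH 0)); rewrite subrr addrK. Qed.
Lemma toHZ c x : toH (c *: x) = c *: toH x.
Proof. by have := toH_lin c x 0; rewrite !addr0 toH0 addr0. Qed.
Lemma toH_sum (T : Type) (r : seq T) (P : pred T) (X : T -> V) :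
  toH (\sum_(i <- r | P i) X i) = \sum_(i <- r | P i) toH (X i).
Proof. by elim/big_rec2: _ => [|i y1 y2 _ <-]; rewrite ?toH0 ?toHD. Qed.
Lemma ofHD x y : ofH (x + y) = ofH x + ofH y.
Proof. by have := ofH_lin 1 x y; rewrite !scale1r. Qed.
Lemma ofH0 : ofH 0 = 0.
Proof. by have := ofHD 0 0; rewrite addr0 => /(congr1 (fun x => x - ofH 0)); rewrite subrr addrK. Qed.
Lemma ofHZ c x : ofH (c *: x) = c *: ofH x.
Proof. by have := ofH_lin c x 0; rewrite !addr0 ofH0 addr0. Qed.

Lemma hcoord_bvecH p q : p \in W -> q \in W -> minI K q -> hcoord (bvecH p) q = (q == p)%:R.
Proof. by move=> pW qW mq; rewrite /bvecH hcoord_hpi_longest // hcoord_bar //. Qed.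

Lemma hcoord_toH v q : inL q -> hcoord (toH v) q = wcoef B v (rw q).
Proof.
move=> /[dup] qL /andP[qW qL']; rewrite /toH hcoord_sum (bigD1 q) //= big1 => [|p /andP[/andP[pW _] pq]].
  by rewrite addr0 hcoordZ hcoord_bvecH ?LK // eqxx mulr1.
by rewrite hcoordZ hcoord_bvecH ?LK // eq_sym (negbTE pq) mulr0.
Qed.

Lemma toHK v : ofH (toH v) = v.
Proof.
rewrite [RHS](wspan B v) sumL; apply: eq_bigr => p pL; by rewrite hcoord_toH.
Qed.

Lemma toH_vec p : inL p -> toH (wvec B (rw p)) = bvecH p.
Proof.
move=> /[dup] pL /andP[pW pL']; rewrite /toH (bigD1 p) //= wcoefE // eqxx scale1r big1 ?addr0 //.
move=> q /andP[/andP[qW qL] qp]; rewrite wcoefE //.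
case: eqP => [e|_]; last by rewrite scale0r.
by rewrite (rw_inj pW qW e) eqxx in qp.
Qed.

Lemma bvecH0 p : p \in W -> ~~ minI K p -> bvecH p = 0.
Proof.
move=> pW; rewrite negb_forall_in => /exists_inP[j jK]; rewrite negbK => d.
exact: hpi_longest_kill d.
Qed.

Lemma hgenbar_bvecH i p : p \in W ->
  hgenbar F i * bvecH p = if DL i p then - bvecH p else bvecH (p * sgen i)%g.
Proof. by move=> pW; rewrite /bvecH mulrA hpibarL //; case: ifP; rewrite ?mulNr. Qed.

Section Module.
Variables (A : algType F) (iota : {rmorphism A -> H}) (T : Type) (gen : T -> A).
Variables (idx : T -> 'I_n) (op : T -> V -> V).
Hypothesis iotaZ : forall c x, iota (c *: x) = c *: iota x.
Hypothesis iota_gen : forall t, iota (gen t) = hgenbar F (idx t).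
Hypothesis op_lin : forall t c x y, op t (c *: x + y) = c *: op t x + op t y.
Hypothesis op_vec : forall t u, u \in L -> op t (wvec B u) =
  if wdesc (idx t) u then - wvec B u
  else if [seq sI (idx t) z | z <- u] \in L then wvec B [seq sI (idx t) z | z <- u] else 0.
Hypothesis Lup : forall t p, inL p -> ~~ DL (idx t) p -> ~~ inL (p * sgen (idx t))%g ->
  ~~ minI K (p * sgen (idx t))%g.
Hypothesis Agen : forall P : A -> Prop, P 1 -> (forall c x y, P x -> P y -> P (c *: x + y)) ->
  (forall x y, P x -> P y -> P (x * y)) -> (forall t, P (gen t)) -> forall x, P x.

(** If the exchanged word leaves L, the operator gives 0; [Lup] then exhibits a descent in K, and
    [bvecH0] gives 0 on the side of the algebra. *)
Lemma toH_op t v : toH (op t v) = hgenbar F (idx t) * toH v.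
Proof.
have op0 : op t 0 = 0.
  by have := op_lin t 1 0 0; rewrite !scale1r addr0 => /(congr1 (fun x => x - op t 0)); rewrite subrr addrK.
have -> : op t v = \sum_(p | inL p) wcoef B v (rw p) *: op t (wvec B (rw p)).
  rewrite {1}(wspan B v) sumL; elim/big_rec2: _ => [//|p x y _ <-]; exact: op_lin.
rewrite toH_sum [in RHS]/toH mulr_sumr; apply: eq_bigr => p /[dup] pL /andP[pW pL'].
rewrite toHZ -scalerAr; congr (_ *: _); rewrite op_vec // hgenbar_bvecH // wdesc_rw //.
case: ifPn => d; first by rewrite -scaleN1r toHZ toH_vec // scaleN1r.
rewrite -rw_sgen; case: ifPn => pL2; first by rewrite toH_vec // /inL /= WMg pW.
rewrite toH0 bvecH0 ?WMg //; apply: Lup => //.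
by rewrite /inL /= WMg pW.
Qed.

Lemma toH_stable a v : exists v', iota a * toH v = toH v'.
Proof.
move: a v; apply: Agen => [v|c x y hx hy v|x y hx hy v|t v].
- by exists v; rewrite rmorph1 mul1r.
- have [v1 e1] := hx v; have [v2 e2] := hy v; exists (c *: v1 + v2).
  by rewrite toH_lin rmorphD iotaZ mulrDl -scalerAl e1 e2.
- have [v2 e2] := hy v; have [v1 e1] := hx v2; exists v1.
  by rewrite rmorphM -mulrA e2.
- by exists (op t v); rewrite toH_op iota_gen.
Qed.

(** The action is pulled back along [toH], whose image is stable. The map [iota] is the identity for
    the tableau modules and the inclusion of the parabolic subalgebra for the tensor module. *)
Definition basis_act a v : V := ofH (iota a * toH v).

Lemma toH_act a v : toH (basis_act a v) = iota a * toH v.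
Proof. by rewrite /basis_act; have [v' ->] := toH_stable a v; rewrite toHK. Qed.

Fact basis_actDl v : {morph basis_act^~ v : a b / a + b}.
Proof. by move=> a b; rewrite /basis_act rmorphD mulrDl ofHD. Qed.
Fact basis_actDr : right_distributive basis_act +%R.
Proof. by move=> a x y; rewrite /basis_act toHD mulrDr ofHD. Qed.
Fact basis_act1 : left_id 1 basis_act.
Proof. by move=> v; rewrite /basis_act rmorph1 mul1r toHK. Qed.
Fact basis_actM a b v : basis_act a (basis_act b v) = basis_act (a * b) v.
Proof. by rewrite {1}/basis_act toH_act mulrA -rmorphM. Qed.
Fact basis_actZ (c : F) a v : basis_act (c *: a) v = c *: basis_act a v.
Proof. by rewrite /basis_act iotaZ -scalerAl ofHZ. Qed.
Fact basis_act_gen t : basis_act (gen t) =1 op t.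
Proof. by move=> v; rewrite /basis_act iota_gen -toH_op toHK. Qed.

Definition basis_module : hmod_on gen op :=
  HmodOn basis_actDl basis_actDr basis_act1 basis_actM basis_actZ basis_act_gen.

Lemma toH_module a (v : basis_module) : toH (a *: v) = iota a * toH v.
Proof. exact: toH_act. Qed.

End Module.
End BasisModule.

(** * Forced descents and block subgroups *)

Section StepSets.
Variable n : nat.
Local Notation W := (signed_perms n).
Implicit Types (st : seq step) (p : {perm signed n}).

Definition upset st : {set 'I_n} := [set j : 'I_n | nth None st j == Some true].
Definition rightset st : {set 'I_n} := [set j : 'I_n | nth None st j == Some false].

Lemma goodE st p : good st p = [forall j in upset st, DR j p] && minI (rightset st) p.
Proof.
apply/goodP/andP => [h|[/forall_inP h1 /minIP h2] j b e].
  split; first by apply/forall_inP => j; rewrite inE => /eqP/h.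
  by apply/minIP => j; rewrite inE => /eqP/h ->.
case: b e => e; first by apply: h1; rewrite inE e.
by apply/negbTE/h2; rewrite inE e.
Qed.

(** Forced descents survive by [DR_up], so only the forced non-descents have to be assumed. *)
Lemma good_up st p i : p \in W -> good st p -> ~~ DL i p -> minI (rightset st) (p * sgen i)%g ->
  good st (p * sgen i)%g.
Proof.
move=> pW; rewrite !goodE => /andP[/forall_inP h _] d ->; rewrite andbT.
by apply/forall_inP => j /h; apply: DR_up.
Qed.

Lemma cnt_lt (J : {set 'I_n}) (k d : 'I_n) : d \notin J -> (k < d)%N -> (cnt J k < cnt J d)%N.
Proof.
move=> dJ kd; apply: proper_card; apply/properP; split.
  by apply/subsetP => e; rewrite !inE => /andP[-> /leq_trans]; apply; apply: ltnW.
by exists d; rewrite inE dJ /= ?leqnn // -ltnNge.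
Qed.

Lemma size_rw p : size (rw p) = n.
Proof. exact: size_tword. Qed.

Lemma blockok_WI (D : seq nat) p : all (fun d => d < n)%N D -> p \in W ->
  blockok D (rw p) = (p \in WI [set j : 'I_n | val j \notin D]).
Proof.
move=> Dn pW; set J := [set j | _]; have pN := WP _ pW.
have JE (d : 'I_n) : (d \in J) = (val d \notin D) by rewrite inE.
apply/idP/idP => [/allP bo|/WIP[_ lp]]; last first.
  apply/allP => d dD; have dn := allP Dn _ dD; pose e := Ordinal dn.
  have eJ : e \notin J by rewrite JE negbK.
  (* Preserved labels mean that absolute values stay in their block and that a positive letter can
     become negative only in the block of label 0. *)
  have labE k : cnt J (p (k, false)).1 = cnt J k /\ (0 < cnt J k -> (p (k, false)).2 = false)%N.
    have := lp (k, false); rewrite /lab /=; case: ifP => _; lia.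
  have sd : (d <= size (rw p))%N by rewrite size_rw; exact: ltnW dn.
  apply/andP; split; apply/(all_nthP 0) => k.
    rewrite (size_takel sd).
    move=> kd; rewrite nth_take //; have kn := ltn_trans kd dn.
    rewrite -[k]/(val (Ordinal kn)) nth_rw abs_sint ltnNge; apply/negP => h.
    have := cnt_lt (k := Ordinal kn) eJ kd; rewrite -(labE (Ordinal kn)).1.
    by rewrite ltnNge cnt_mono.
  rewrite size_drop size_rw => lt; have kn : (d + k < n)%N by move: lt; clear; lia.
  rewrite nth_drop -[(d + k)%N]/(val (Ordinal kn)) nth_rw.
  have [l1 l2] := labE (Ordinal kn).
  have c1 : (0 < cnt J e)%N by rewrite card_gt0; apply/set0Pn; exists e; rewrite inE eJ /=.
  have c2 : (cnt J e <= cnt J (Ordinal kn))%N by apply: cnt_mono; rewrite /= leq_addr.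
  rewrite /sint l2 ?(leq_trans c1) // ltz_nat ltnS leqNgt; apply/negP => h.
  by have := cnt_lt eJ h; rewrite l1; lia.
apply/WIP; split=> //; suff h k : lab J (p (k, false)) = lab J (k, false).
  by case=> k [|] //; rewrite -[(k, true)]/(sopp (k, false)) pN !lab_opp h.
(* The two halves of [blockok] at d: the positions from d on carry the values above d, with positive
   sign. *)
have bo' (d : 'I_n) : d \notin J -> (d <= k = (d <= (p (k, false)).1) /\ (d <= k -> (p (k, false)).2 = false))%N.
  rewrite JE negbK => /bo /andP[/allP b1 /allP b2].
  have [dk|kd] := leqP d k.
    have : d%:Z < sint (p (k, false)).
      apply: b2; rewrite -nth_rw -(subnKC dk) -nth_drop mem_nth // size_drop size_rw.
      by have := ltn_ord k; lia.
    by rewrite /sint; case: ifP => _ h; split; lia.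
  have : (`|sint (p (k, false))| <= d)%N.
    by apply: b1; rewrite -nth_rw -(@nth_take d) // mem_nth // size_takel ?size_rw // ltnW.
  by rewrite abs_sint; split; lia.
have cE : cnt J (p (k, false)).1 = cnt J k.
  congr #|pred_of_set _|; apply/setP => d; rewrite !in_set.
  rewrite -JE; case: (boolP (d \in J)) => //= dJ.
  by have [<-] := bo' d dJ.
rewrite /lab cE /=; case: ifP => // y2.
have : ~~ (0 < cnt J k)%N.
  rewrite card_gt0 negbK; apply/eqP/setP => d; rewrite in_set [in RHS]in_set0; apply/negbTE/negP => /andP[dJ dk].
  by have [_ /(_ dk)] := bo' d dJ; rewrite y2.
by rewrite -eqn0Ngt => /eqP ->.
Qed.

End StepSets.

(** * The tableau module as a left ideal *)

Section TypeBModule.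
Variables (F : fieldType) (n : nat).
Local Notation W := (signed_perms n).
Local Notation H := (hecke F n).
Implicit Types (p q : {perm signed n}).

Lemma hecke_gen (P : H -> Prop) : P 1 -> (forall c x y, P x -> P y -> P (c *: x + y)) ->
  (forall x y, P x -> P y -> P (x * y)) -> (forall i, P (hgenbar F i)) -> forall x, P x.
Proof.
move=> P1 PD PM Pg; elim/hecke_ind => //= i x Px; apply: (PM) => //.
by rewrite hgenE -[hgenbar F i]scale1r; apply: PD.
Qed.

Variables (a : seq nat) (s : seq (seq nat)).
Hypothesis gp : is_gpribbon n a s.
Local Notation st := (gsteps a s).
Local Notation K := (rightset n st).
Local Notation B := (spaceB_basis F n a s).
Local Notation L := (tabwords (standardB (n := n) a s) (@tword n)).

Lemma inL_B p : inL L p = (p \in W) && good st p.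
Proof.
rewrite /inL /= mem_wordsB //; case: (boolP (p \in W)) => pW //=.
by rewrite rw_sgword // compat_good // (size_gsteps_n gp).
Qed.

Fact LW_B u : u \in L -> exists2 p, p \in W & rw p = u.
Proof. by rewrite mem_wordsB // => /andP[/sgwordP[p]]; exists p. Qed.
Fact LK_B p : p \in W -> rw p \in L -> minI K p.
Proof.
move=> pW pL; have : inL L p by rewrite /inL /= pW.
by rewrite inL_B goodE => /and3P[].
Qed.
Fact op_lin_B i c (x y : spaceB F n a s) : opB i (c *: x + y) = c *: opB i x + opB i y.
Proof. exact: linext_lin. Qed.
Fact op_vec_B (i : 'I_n) u : u \in L -> opB i (wvec B u) =
  if wdesc i u then - wvec B u
  else if [seq sI i z | z <- u] \in L then wvec B [seq sI i z | z <- u] else 0.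
Proof.
move=> uL; have [_ /(_ u uL)] := opB_basis F gp (ltn_ord i).
by rewrite /= valK.
Qed.
Fact Lup_B (i : 'I_n) p : inL L p -> ~~ DL i p -> ~~ inL L (p * sgen i)%g -> ~~ minI K (p * sgen i)%g.
Proof.
rewrite !inL_B => /andP[pW pg] d; rewrite WMg pW /=; apply: contra; exact: good_up.
Qed.

Definition PBmod : PB F n a s :=
  basis_module LW_B LK_B (iota := idfun) (idx := id) (fun _ _ => erefl) (fun _ => erefl)
    op_lin_B op_vec_B Lup_B hecke_gen.

Local Notation toP := (toH B K).

Lemma toP_act h (v : PBmod) : toP (h *: v) = h * toP v.
Proof. exact: toH_module. Qed.

Lemma toP_inj : injective toP.
Proof.
by move=> v w e; rewrite -(toHK B LW_B LK_B v) e (toHK B LW_B LK_B).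
Qed.

Lemma toP_vec p : p \in W -> good st p -> toP (wvec B (rw p)) = bvecH F K p.
Proof. by move=> pW pg; apply: toH_vec; rewrite inL_B pW. Qed.

Local Notation I := (upset n st).
Local Notation x0 := (hpibar F (longest I) * hpi F (longest K)).

(** When [h * hpibar F (longest I)] is expanded, elements lacking a forced descent have coefficient
    0 by [hcoord_longest0], and those with a forbidden descent are killed by the second factor of
    [x0]. *)
Lemma toP_image h : exists v, toP v = h * x0.
Proof.
exists (\sum_(p | inL L p) hcoord (h * hpibar F (longest I)) p *: wvec B (rw p)).
rewrite toH_sum mulrA {2}(hcoordP (h * hpibar F (longest I))) mulr_suml.
rewrite [RHS](bigID (good st)) /= [X in _ = _ + X]big1 ?addr0.
  apply: eq_big => [p|p pL]; first exact: inL_B.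
  by rewrite toHZ (toH_vec B K pL) -scalerAl.
move=> p /andP[pW]; rewrite goodE negb_and => /orP[|mp].
  rewrite negb_forall_in => /exists_inP[j jI d].
  by rewrite (hcoord_longest0 _ pW jI d) scale0r mul0r.
by rewrite -scalerAl -/(bvecH F K p) bvecH0 // scaler0.
Qed.

Lemma toP_ideal v : exists h, toP v = h * x0.
Proof.
rewrite /toH; elim/big_rec: _ => [|p x pL [h ->]]; first by exists 0; rewrite mul0r.
move: pL; rewrite inL_B goodE => /and3P[pW /forall_inP pI _].
have [u uW e] := hpibar_longest_fact F pW pI.
exists (wcoef B v (rw p) *: hpibar F u + h); rewrite mulrDl; congr (_ + _).
by rewrite /bvecH e -scalerAl mulrA.
Qed.

Lemma PBmod_calP (J : {set 'I_n}) : J :\: I = K -> lmod_iso PBmod (calP F I J).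
Proof.
move=> JE; rewrite /calP JE.
have fP (v : PBmod) : (toP v : H^o) \in lideal_pred x0 by apply/asboolP; apply: toP_ideal.
apply: (@lmod_isoI _ _ _ (fun v => LIdeal (fP v))) => [h v w|v w e|[y yP]].
- apply: val_inj; rewrite linearP /=.
  by apply: etrans (toHD B K _ _) _; congr (_ + _); apply: toP_act.
- by apply: toP_inj; apply: (congr1 val e).
have /asboolP[h yE] := yP; have [v vE] := toP_image h; exists v; apply: val_inj => /=.
by rewrite vE.
Qed.

End TypeBModule.

(** * The direct sum *)

Lemma completes_nth st t j c : completes st t -> nth None st j = Some c -> nth None t j = Some c.
Proof.
elim: st t j => [|d st IH] [|e t] [|j] //= /andP[/andP[_ h] ct]; last exact: IH.
by move=> dE; move: h; rewrite dE /= => /eqP <-.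
Qed.

Lemma completes_nthN st t j : completes st t -> (j < size st)%N -> nth None t j != None.
Proof. by elim: st t j => [|d st IH] [|e t] [|j] //= /andP[/andP[]] // _ _ ct; apply: IH. Qed.

Section BracketSum.
Variables (F : fieldType) (n : nat) (a : seq nat) (s : seq (seq nat)).
Hypothesis gp : is_gpribbon n a s.
Local Notation W := (signed_perms n).
Local Notation H := (hecke F n).
Local Notation st := (gsteps a s).
Local Notation K := (rightset n st).
Local Notation I := (upset n st).
Local Notation "'ix'" := (seq_sub (bracket a s)).
Local Notation B := (spaceB_basis F n a s).
Local Notation Bb b := (spaceB_basis F n (val b) [::]).
Local Notation sb b := (gsteps (val b) [::]).
Implicit Types (p q : {perm signed n}) (b : ix).

Let ap : is_pcomp a. Proof. by case/and3P: gp. Qed.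
Let sc : all is_comp s. Proof. by case/and3P: gp. Qed.

Fact bracket_comp b : completes st (sb b).
Proof. by have [] := bracketP ap sc (valP b). Qed.

Fact gp_bracket b : is_gpribbon n (val b) [::].
Proof.
have [cp ce _] := bracketP ap sc (valP b).
by rewrite /is_gpribbon cp /= ce addn0; case/and3P: gp.
Qed.

Lemma good_bracket b p : good (sb b) p -> good st p.
Proof.
move=> /goodP h; apply/goodP => j c e; apply: h.
exact: completes_nth (bracket_comp b) e.
Qed.

(** A completed sequence has no gap left, so the descents of p determine all its steps. *)
Lemma good_bracket_uniq b b' p : good (sb b) p -> good (sb b') p -> b = b'.
Proof.
move=> /goodP h /goodP h'; apply: val_inj.
have cb := bracket_comp b; have cb' := bracket_comp b'.
have sz := size_gsteps_n (gp_bracket b); have sz' := size_gsteps_n (gp_bracket b').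
apply: gsteps_inj; try by case/and3P: (gp_bracket b) (gp_bracket b') => ? _ _ /and3P[].
apply: (@eq_from_nth _ None) => [|j]; rewrite sz ?sz' // => jn.
have js : (j < size st)%N by rewrite (size_gsteps_n gp).
have := completes_nthN cb js; have := completes_nthN cb' js.
case e: (nth _ _ j) => [c|] //; case e': (nth _ _ j) => [c'|] // _ _.
by rewrite -(h' (Ordinal jn) _ e) -(h (Ordinal jn) _ e').
Qed.

Lemma good_bracket_ex p : good st p -> exists b, good (sb b) p.
Proof.
(* The gaps are filled according to the descents of p, with which the other steps already agree. *)
move=> gd; pose t := mkseq (fun j => if insub j is Some i then Some (DR (i : 'I_n) p) else None) n.
have tj (j : 'I_n) : nth None t j = Some (DR j p) by rewrite nth_mkseq // valK.
have ct : completes st t.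
  have sz : size t = size st by rewrite size_mkseq (size_gsteps_n gp).
  have /goodP h := gd.
  have {}h j : (j < size st)%N -> (nth None t j != None) &&
      ((nth None st j == None) || (nth None st j == nth None t j)).
    rewrite (size_gsteps_n gp) => jn; rewrite -[j]/(val (Ordinal jn)) tj /=.
    by case e: (nth None st j) => [c|] //=; rewrite -(h (Ordinal jn) _ e).
  elim: st t sz h {gd tj} => [|c st' IH] [|d t] //= [sz] h; rewrite (h 0 isT).
  by apply: (IH _ sz) => j jn; apply: (h j.+1).
have [c cb cE] := bracket_ex ap sc ct; exists (SeqSub cb) => /=.
by apply/goodP => j x; rewrite cE tj => -[].
Qed.

Local Notation Q := (fun b => PBmod F (gp_bracket b) : lmodType H).
Local Notation sgn b := ((-1) ^+ len (longest (upset n (sb b))) : F).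

Definition zb b : H := hpibar F (longest (upset n (sb b))) * hpi F (longest K).

(** The two factors pi keep the leading coefficient, as p has no descent at the steps to the right
    of b or of alpha; the factor between them, over steps that are descents of p, contributes the
    sign. *)
Lemma leads_zb b p : p \in W -> good (sb b) p ->
  leads (bvecH F (rightset n (sb b)) p * zb b) (sgn b) p.
Proof.
move=> pW /[dup] /good_bracket gd; rewrite !goodE in gd *.
case/andP: gd => _ mK /andP[/forall_inP up mr].
rewrite /zb mulrA; apply: leads_hpi_longest => //.
rewrite -[sgn b]mulr1; apply: leads_hpibar_longest => //.
exact/leads_hpi_longest/mr/leads_bar.
Qed.

Definition sumH (v : dsum Q) : H :=
  \sum_b toH (Bb b) (rightset n (sb b)) (v b) * zb b.

Lemma sumH_lin h v w : sumH (h *: v + w) = h * sumH v + sumH w.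
Proof.
rewrite /sumH mulr_sumr -big_split; apply: eq_bigr => b _ /=.
rewrite ffunE ffunE [X in _ = X + _]mulrA -mulrDl; congr (_ * _).
by apply: etrans (toHD _ _ _ _) _; congr (_ + _); apply: toP_act.
Qed.

Lemma sumHB v w : sumH (v - w) = sumH v - sumH w.
Proof. by rewrite addrC -scaleN1r sumH_lin mulN1r addrC. Qed.

(** Steps up in alpha are steps up in its completion b, so the longest element for b ends in the
    longest element for I, and the summand lies in the ideal of alpha. *)
Lemma sumH_image v : exists x, toH B K x = sumH v.
Proof.
rewrite /sumH; elim/big_rec: _ => [|b y _ [x <-]]; first by exists 0; rewrite toH0.
have DI j : j \in I -> DR j (longest (upset n (sb b))).
  rewrite inE => /eqP e; apply: longest_DR.
  by rewrite inE (completes_nth (bracket_comp b) e).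
have [u _ e] := hpibar_longest_fact F (WI_W (longest_WI _)) DI.
rewrite /zb e; set g := toH _ _ _.
have [x' x'E] := toP_image gp (g * hpibar F u).
by exists (x' + x); rewrite toHD x'E -!mulrA.
Qed.

Lemma hcoord_sumH v p : hcoord (sumH v) p =
  \sum_b \sum_(q | inL (tabwords (standardB (n := n) (val b) [::]) (@tword n)) q)
    wcoef (Bb b) (v b) (rw q) *
    hcoord (bvecH F (rightset n (sb b)) q * zb b) p.
Proof.
rewrite /sumH hcoord_sum; apply: eq_bigr => b _; rewrite /toH mulr_suml hcoord_sum.
by apply: eq_bigr => q _; rewrite -scalerAl hcoordZ.
Qed.

(** In the coefficient of the sum at p, elements shorter than p are absent by induction and the
    leading terms remove every other element but p, which is good for a single b. *)
Lemma sumH_eq0 v : sumH v = 0 -> v = 0.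
Proof.
move=> v0; suff h m p b : (len p < m)%N -> p \in W -> good (sb b) p ->
    wcoef (Bb b) (v b) (rw p) = 0.
  apply/ffunP => b; rewrite ffunE; rewrite [LHS](wspan (Bb b)).
  rewrite (sumL (Bb b) (LW_B (gp_bracket b))) big1 // => p.
  rewrite (inL_B (gp_bracket b)) => /andP[pW gd].
  by rewrite (h (len p).+1) // scale0r.
elim: m p b => // m IH p b lt pW gd.
have := congr1 (fun x => hcoord x p) v0; rewrite hcoord0 hcoord_sumH.
have term b' q : q \in W -> good (sb b') q ->
    wcoef (Bb b') (v b') (rw q) *
    hcoord (bvecH F (rightset n (sb b')) q * zb b') p =
    wcoef (Bb b') (v b') (rw q) * (sgn b' * (p == q)%:R).
  move=> qW gq; have [lqp|lpq] := ltnP (len q) (len p).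
    by rewrite (IH q b') ?mul0r //; apply: leq_trans lqp lt.
  by rewrite (leads_zb qW gq).
rewrite (bigD1 b) //= [X in _ + X]big1 ?addr0 => [|b' bb']; last first.
  apply: big1 => q; rewrite (inL_B (gp_bracket b')) => /andP[qW gq]; rewrite term //.
  case: eqP => [e|]; rewrite ?mulr0 //; rewrite -e in gq.
  by rewrite (good_bracket_uniq gq gd) eqxx in bb'.
rewrite (bigD1 p) ?(inL_B (gp_bracket b)) ?pW //= big1 ?addr0 => [|q /andP[qL qp]]; last first.
  move: qL; rewrite (inL_B (gp_bracket b)) => /andP[qW gq]; rewrite term //.
  by rewrite eq_sym (negbTE qp) !mulr0.
rewrite term // eqxx mulr1 => /eqP; rewrite mulf_eq0 => /orP[/eqP //|].
by rewrite signr_eq0.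
Qed.

(** Descending induction on the length, which [#|pairs n|] bounds: the image of the basis vector of
    p is a sign times [bvecH F K p] plus longer terms, already attained. *)
Lemma sumH_surj p : p \in W -> good st p -> exists v, sumH v = bvecH F K p.
Proof.
have imZD c x y : (exists v, sumH v = x) -> (exists v, sumH v = y) ->
    exists v, sumH v = c *: x + y.
  (* The direct sum is a module over the Hecke algebra, so a scalar of F acts through its image
     [c%:A]. *)
  move=> [v <-] [w <-]; exists (c%:A *: v + w).
  by rewrite sumH_lin -scalerAl mul1r.
have im0 : exists v, sumH v = 0.
  by exists 0; have := sumHB 0 0; rewrite !subrr.
have [m] := ubnP (#|pairs n| - len p); elim: m p => // m IH p lm pW gd.
have [b gb] := good_bracket_ex gd.
pose Lb b' := inL (n := n) (tabwords (standardB (n := n) (val b') [::]) (@tword n)).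
pose u0 : dsum Q := finfun (fun b' => (if Lb b' p
  then wvec (Bb b') (rw p) else 0) : PBmod F (gp_bracket b')).
set Y := bvecH F (rightset n (sb b)) p * zb b.
have u0E : sumH u0 = Y.
  rewrite /sumH (bigD1 b) //= big1 ?addr0 => [|b' bb'].
    rewrite ffunE /Lb (inL_B (gp_bracket b)) pW gb /=.
    by rewrite (toP_vec F (gp_bracket b)).
  rewrite ffunE /Lb (inL_B (gp_bracket b')) pW /=; case: ifP => gb'; last by rewrite toH0 mul0r.
  by rewrite (good_bracket_uniq gb' gb) eqxx in bb'.
have [w wE] := sumH_image u0; rewrite u0E in wE.
have YE : Y = \sum_(q | (q \in W) && good st q) hcoord Y q *: bvecH F K q.
  rewrite -{1}wE /toH; apply: eq_big => q; first exact: inL_B.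
  by move=> qL; rewrite -wE hcoord_toH // => *; apply: (LK_B gp).
have lY q : q \in W -> (len q <= len p)%N -> hcoord Y q = sgn b * (q == p)%:R.
  by move=> qW lq; apply: (leads_zb pW gb).
rewrite (bigD1 p) ?pW //= lY // eqxx mulr1 in YE.
(* The expansion of Y is solved for its leading term; the sign is its own inverse, so any field will
   do. *)
have -> : bvecH F K p = sgn b *: Y +
    \sum_(q | (q \in W) && good st q && (q != p)) (- (sgn b * hcoord Y q)) *: bvecH F K q.
  rewrite {1}YE scalerDr scalerA -expr2 sqrr_sign scale1r -addrA [X in _ = _ + X](_ : _ = 0) ?addr0 //.
  rewrite scaler_sumr -big_split big1 // => q _ /=.
  by rewrite scalerA scaleNr subrr.
apply: (imZD); first by exists u0.
elim/big_rec: _ => // q y /andP[/andP[qW gq] qp] iy.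
have [lq|lp] := leqP (len q) (len p).
  by rewrite (lY q) // (negbTE qp) !mulr0 oppr0 scale0r add0r.
apply: (imZD) => //; apply: IH => //.
have : (len q <= #|pairs n|)%N.
  by apply: subset_leq_card; apply/subsetP => x; rewrite inE => /andP[].
by move: lp lm; clear; lia.
Qed.

Theorem bracket_sum_iso : lmod_iso (PBmod F gp) (dsum Q).
Proof.
pose T (v : dsum Q) : PBmod F gp := ofH B (sumH v).
have TE v : toH B K (T v) = sumH v.
  by rewrite /T; have [x <-] := sumH_image v; rewrite (toHK B (LW_B gp) (LK_B gp)).
apply: (@lmod_isoI_sym _ _ _ T) => [h v w|v w e|y].
- apply: (toP_inj gp); rewrite TE sumH_lin -!TE.
  by apply/esym; apply: etrans (toHD _ _ _ _) _; congr (_ + _); apply: toP_act.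
- apply/eqP; rewrite -subr_eq0; apply/eqP/sumH_eq0.
  by rewrite sumHB -!TE e subrr.
suff [v vE] : exists v, sumH v = toH B K y.
  by exists v; apply: (toP_inj gp); rewrite TE.
rewrite /toH; elim/big_rec: _ => [|p y' pL [v <-]].
  by exists 0; have := sumHB 0 0; rewrite !subrr.
move: pL; rewrite (inL_B gp) => /andP[pW gd]; have [u <-] := sumH_surj pW gd.
exists ((wcoef B y (rw p))%:A *: u + v).
by rewrite sumH_lin -scalerAl mul1r.
Qed.

End BracketSum.

(** * The induced module *)

Section Parabolic.
Variables (F : fieldType) (n : nat) (G : {set 'I_n}).
Local Notation A := (parabolic F G).

Lemma parabolic_gen (P : A -> Prop) : P 1 -> (forall c x y, P x -> P y -> P (c *: x + y)) ->
  (forall x y, P x -> P y -> P (x * y)) -> (forall i, P (pgenbar F i)) -> forall x, P x.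
Proof.
move=> P1 PD PM Pg x; suff [y yx Py] : exists2 y : A, val y = val x & P y.
  by rewrite -(val_inj yx).
(* Membership in the subalgebra is tested by predicates on the whole algebra, so P is transferred to
   the values of its elements. *)
have /asboolP := valP x; move=> /(_ (fun z => exists2 y : A, val y = z & P y)); apply.
- by exists 1.
- by move=> c _ _ [y <- Py] [z <- Pz]; exists (c *: y + z); [rewrite linearP | apply: (PD)].
- by move=> _ _ [y <- Py] [z <- Pz]; exists (y * z); [rewrite rmorphM | apply: (PM)].
move=> i iG; exists (1 *: pgenbar F (exist _ i iG) + 1); last exact: PD.
by rewrite linearP rmorph1 scale1r hgenE.
Qed.

Lemma hpibar_parabolic v : v \in WI G -> exists b : A, block_incl F G b = hpibar F v.
Proof.
move=> vG; have [r rG [-> _]] := hpibar_word F vG.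
elim: r rG => [_|i r IH /andP[iG /IH[b bE]]]; first by exists 1; rewrite bw_nil.
exists (pgenbar F (exist _ i iG) * b); rewrite rmorphM bE bw_cons; congr (_ * _).
Qed.

Lemma block_inclZ c (x : A) : block_incl F G (c *: x) = c *: block_incl F G x.
Proof. by rewrite -[LHS]/(val (c *: x)) linearZ. Qed.

Lemma block_incl_gen (i : {i | i \in G}) : block_incl F G (pgenbar F i) = hgenbar F (val i).
Proof. by []. Qed.

End Parabolic.

Lemma alg_scaleD (F : fieldType) (A : algType F) (M : lmodType A) (c x y : F) (m : M) :
  (c * x + y)%:A *: m = c%:A *: (x%:A *: m) + y%:A *: m.
Proof. by rewrite scalerA -scalerDl -scalerAl mul1r scalerA scalerDl. Qed.

Section Induction.
Variables (F : fieldType) (n : nat) (a : seq nat) (s : seq (seq nat)).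
Hypothesis gp : is_gpribbon n a s.
Local Notation W := (signed_perms n).
Local Notation H := (hecke F n).
Local Notation st := (gsteps a s).
Local Notation K := (rightset n st).
Local Notation G := (block_gens n a s).
Local Notation V := (tensor_space F a s).
Local Notation B := (spaceB_basis F n a s).
Implicit Types (p q u v : {perm signed n}).

Let ap : is_pcomp a. Proof. by case/and3P: gp. Qed.
Let sc : all is_comp s. Proof. by case/and3P: gp. Qed.
Let nE : n = (sumn a + sumn [seq sumn b | b <- s])%N. Proof. by case/and3P: gp => _ _ /eqP. Qed.

Lemma block_gensE (j : 'I_n) : (j \in G) = (val j \notin seps a s).
Proof. by rewrite inE descentsE. Qed.

Lemma block_gens_step (j : 'I_n) : (j \in G) = (nth None st j != None).
Proof.
have lt : (j < sumn a + sumn [seq sumn b | b <- s])%N by rewrite -nE.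
by rewrite block_gensE (seps_None ap sc lt).
Qed.

(** [good] only constrains the steps that are not gaps, whose indices form G; by [DR_par] the
    descents there depend on the parabolic factor alone. *)
Lemma good_par u v : u \in W -> minI G u -> v \in WI G -> good st (v * u)%g = good st v.
Proof.
move=> uW /minIP mu vG; apply: eq_forallb => j.
have [jG|] := boolP (j \in G); first by rewrite (DR_par uW mu vG jG).
by rewrite block_gens_step negbK => /eqP ->.
Qed.

Variables (LN : seq (seq int)) (BN : wbasis V LN).
Hypothesis LNE : forall u : seq int, (u \in LN) = blockword n a s u.
Hypothesis opN : wop BN (blockgen n a s) (@oop _ V).

Lemma inL_N p : inL LN p = [&& p \in W, good st p & p \in WI G].
Proof.
rewrite /inL /= LNE; case: (boolP (p \in W)) => pW //=.
rewrite /blockword rw_sgword //= compat_good ?(size_gsteps_n gp) // blockok_WI //; last first.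
  by apply/allP => d /(seps_lt ap sc) ds; rewrite nE.
by have -> : [set j : 'I_n | val j \notin seps a s] = G by apply/setP => j; rewrite block_gensE inE.
Qed.

Fact LW_N w : w \in LN -> exists2 p, p \in W & rw p = w.
Proof. by rewrite LNE => /and3P[/sgwordP[p]]; exists p. Qed.
Fact LK_N p : p \in W -> rw p \in LN -> minI K p.
Proof.
move=> pW pL; have : inL LN p by rewrite /inL /= pW.
by rewrite inL_N goodE => /and3P[_ /andP[]].
Qed.
Fact blockgen_G (t : {i | i \in G}) : blockgen n a s (val (val t)).
Proof. by rewrite /blockgen ltn_ord -block_gensE (valP t). Qed.
Fact op_lin_N (t : {i | i \in G}) c (x y : V) :
  oop (o := V) (val (val t)) (c *: x + y) = c *: oop (val (val t)) x + oop (val (val t)) y.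
Proof. by have [h _] := opN (blockgen_G t); apply: h. Qed.
Fact op_vec_N (t : {i | i \in G}) (u : seq int) : u \in LN -> oop (val (val t)) (wvec BN u) =
  if wdesc (val t) u then - wvec BN u
  else if [seq sI (val t) z | z <- u] \in LN then wvec BN [seq sI (val t) z | z <- u] else 0.
Proof. by have [_ h] := opN (blockgen_G t); apply: h. Qed.
Fact Lup_N (t : {i | i \in G}) p : inL LN p -> ~~ DL (val t) p -> ~~ inL LN (p * sgen (val t))%g ->
  ~~ minI K (p * sgen (val t))%g.
Proof.
rewrite !inL_N => /and3P[pW pg pG] d; rewrite WMg pW (WI_M pG (WI_gen (valP t))) andbT /=.
by apply: contra; apply: good_up.
Qed.

Definition Nmod : tensor_module F n a s :=
  basis_module LW_N LK_N (iota := block_incl F G) (idx := val)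
    (@block_inclZ F n G) (@block_incl_gen F n G) op_lin_N op_vec_N Lup_N (@parabolic_gen F n G).

Local Notation toN := (toH BN K).
Local Notation toP := (toH B K).
Local Notation M := (restr_bimod (block_incl F G)).
Local Notation T := (induced (block_incl F G) Nmod).
Local Notation pure := (@tpure H (parabolic F G) (restr_bimod (block_incl F G)) Nmod).

Lemma toN_act b (x : Nmod) : toN (b *: x) = block_incl F G b * toN x.
Proof. exact: toH_module. Qed.

(** Both modules are compared with the algebra through the same K, so a basis word of the tensor
    module has the same image as the type B tableau with that word. *)
Lemma toN_image h x : exists v : PBmod F gp, toP v = h * toN x.
Proof.
suff [v vE] : exists v : PBmod F gp, toP v = toN x by exists (h *: v); rewrite toP_act vE.
rewrite /(toN x); elim/big_rec: _ => [|p y pL [v <-]]; first by exists 0; exact: toH0.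
move: pL; rewrite inL_N => /and3P[pW pg _].
exists (wcoef BN x (rw p) *: wvec B (rw p) + v).
by rewrite toH_lin (toP_vec F gp).
Qed.

Definition ind_map (m : (M * Nmod)%type) : PBmod F gp := ofH B ((m.1 : H) * toN m.2).

Lemma toP_ind_map m : toP (ind_map m) = (m.1 : H) * toN m.2.
Proof.
rewrite /ind_map; have [v <-] := toN_image (m.1 : H) m.2.
by rewrite (toHK B (LW_B gp) (LK_B gp)).
Qed.

Fact ind_mapDl (m m' : M) (x : Nmod) : ind_map (m + m', x) = ind_map (m, x) + ind_map (m', x).
Proof. by apply: (toP_inj gp); rewrite toHD !toP_ind_map /= mulrDl. Qed.
Fact ind_mapDr (m : M) (x x' : Nmod) : ind_map (m, x + x') = ind_map (m, x) + ind_map (m, x').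
Proof.
apply: (toP_inj gp); rewrite toHD !toP_ind_map /= -mulrDr; congr (_ * _).
exact: toHD.
Qed.
Fact ind_mapM (m : M) b (x : Nmod) : ind_map (bact m b, x) = ind_map (m, b *: x).
Proof. by apply: (toP_inj gp); rewrite !toP_ind_map /= toN_act mulrA. Qed.

Definition ind_iso : T -> PBmod F gp := tlift ind_map.

Lemma toP_ind_iso m x : toP (ind_iso (pure m x)) = m * toN x.
Proof. by rewrite /ind_iso (tlift_pure ind_mapDl ind_mapDr ind_mapM) toP_ind_map. Qed.

Lemma ind_iso_lin h (t u : T) : ind_iso (h *: t + u) = h *: ind_iso t + ind_iso u.
Proof.
rewrite /ind_iso (tliftD ind_mapDl ind_mapDr ind_mapM) -/ind_iso; congr (_ + _).
elim/tensor_ind: t => [|t t' e e'|m x].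
- by rewrite scaler0 /ind_iso (tlift0 ind_mapDl ind_mapDr ind_mapM) scaler0.
- rewrite scalerBr /ind_iso !(tliftB ind_mapDl ind_mapDr ind_mapM) -/ind_iso e e'.
  by rewrite scalerBr.
have -> : h *: (pure m x : T) = pure (h * m) x by exact: tscale_pure.
apply: (toP_inj gp); transitivity (h * m * toN x); first exact: toP_ind_iso.
apply/esym; apply: etrans (toP_act h (ind_iso (pure m x))) _.
by rewrite -mulrA; congr (_ * _); apply: toP_ind_iso.
Qed.

Lemma fact_choice : exists uv : {perm signed n} -> {perm signed n} * {perm signed n},
  forall p, p \in W -> [/\ (uv p).1 \in W, minI G (uv p).1, (uv p).2 \in WI G,
    p = ((uv p).2 * (uv p).1)%g & hpibar F p = hpibar F (uv p).1 * hpibar F (uv p).2].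
Proof.
have ex p : exists uv : {perm signed n} * {perm signed n}, p \in W ->
    [/\ uv.1 \in W, minI G uv.1, uv.2 \in WI G, p = (uv.2 * uv.1)%g &
        hpibar F p = hpibar F uv.1 * hpibar F uv.2].
  case: (boolP (p \in W)) => [pW|_]; last by exists (1%g, 1%g).
  have [u [v [uW mu vG pE h]]] := factI G pW; exists (u, v) => _; split=> //=.
  by rewrite !hpibarE; apply/h/hgenbar_braided.
by have [uv uvP] := choice ex; exists uv.
Qed.

(** A scalar of F crosses the tensor sign because it lies in the parabolic subalgebra and is central
    in the Hecke algebra. *)
Lemma tpure_scale c (m : M) (x : Nmod) : pure m (c *: (x : V)) = c%:A *: (pure m x : T).
Proof.
have -> : c *: (x : V) = (c%:A : parabolic F G) *: x.
  by rewrite [RHS](hactZ Nmod) (hact1 Nmod).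
apply: etrans (esym (@tpureM H _ M Nmod m c%:A x)) _.
apply: etrans _ (esym (@tscale_pure H _ M Nmod c%:A m x)).
apply: (congr1 (fun m' : M => pure m' x)).
transitivity ((m : H) * block_incl F G c%:A); first exact: erefl.
transitivity ((c%:A : H) * m); last exact: erefl.
by rewrite block_inclZ rmorph1 -scalerAr mulr1 -scalerAl mul1r.
Qed.

Section TensorInduction.
Variable R : T -> Prop.
Hypothesis R0 : R 0.
Hypothesis Rlin : forall (c : F) (t u : T), R t -> R u -> R (c%:A *: t + u).

Lemma tpure0r (m : M) : pure m 0 = 0.
Proof.
have e := @tpureDr H _ M Nmod m 0 0; rewrite addr0 in e.
by apply: (@addrI _ (pure m 0)); rewrite [RHS]addr0; exact: esym e.
Qed.

Lemma tpure0l (x : Nmod) : pure 0 x = 0.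
Proof.
have e := @tpureDl H _ M Nmod 0 0 x; rewrite addr0 in e.
by apply: (@addrI _ (pure 0 x)); rewrite [RHS]addr0; exact: esym e.
Qed.

Lemma tpure_ind_r (m : M) : (forall q, inL LN q -> R (pure m (wvec BN (rw q)))) ->
  forall x, R (pure m x).
Proof.
move=> Rq x; rewrite (wspan BN x) (sumL BN LW_N).
elim/big_rec: _ => [|q y qL Ry]; first by rewrite tpure0r.
rewrite [X in R X](@tpureDr H _ M Nmod m) tpure_scale.
apply: (Rlin); last exact: Ry.
exact: Rq.
Qed.

Lemma tpure_ind_l (x : Nmod) : (forall w, w \in W -> R (pure (hpibar F w) x)) ->
  forall m, R (pure m x).
Proof.
move=> Rw m; rewrite (hcoordP (m : H)).
elim/big_rec: _ => [|w h wW Rh]; first by rewrite tpure0l.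
rewrite [X in R X](@tpureDl H _ M Nmod).
have -> : pure (hcoord (m : H) w *: hpibar F w) x =
    (hcoord (m : H) w)%:A *: (pure (hpibar F w) x : T).
  apply: etrans _ (esym (@tscale_pure H _ M Nmod _ _ x)).
  apply: (congr1 (fun m' : M => pure m' x)).
  transitivity (((hcoord (m : H) w)%:A : H) * hpibar F w); last exact: erefl.
  by rewrite -scalerAl mul1r.
apply: (Rlin); last exact: Rh.
exact: Rw.
Qed.

End TensorInduction.

(** No dimension count is made: [t = lc (hcoord (tau t))] says both that the tensors [g p] span and
    that t is recovered from its image. Being F-linear, it is checked on products of basis
    elements. *)
Theorem induced_iso : lmod_iso (PBmod F gp) T.
Proof.
have [uv uvP] := fact_choice.
pose tau (t : T) : H := toP (ind_iso t).
have tau_lin (h : H) (t u : T) : tau (h *: t + u) = h * tau t + tau u.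
  by rewrite /tau ind_iso_lin; apply: etrans (toHD _ _ _ _) _; congr (_ + _); apply: toP_act.
have tau0 : tau 0 = 0.
  by have := tau_lin (-1) 0 0; rewrite scaleN1r addNr mulN1r addNr.
(* The minimal representative of p goes to the left factor, its parabolic part to the right one as a
   basis word of the tensor module. *)
pose g p : T := pure (hpibar F (uv p).1) (wvec BN (rw (uv p).2)).
have tau_g p : p \in W -> good st p -> tau (g p) = bvecH F K p.
  move=> pW pg; have [uW mu vG pE hE] := uvP p pW.
  rewrite /tau toP_ind_iso toH_vec; last first.
    by rewrite inL_N (WI_W vG) vG andbT /= -(good_par uW mu vG) -pE.
  by rewrite /bvecH hE mulrA.
pose lc (c : {perm signed n} -> F) : T := \sum_(p | (p \in W) && good st p) (c p)%:A *: g p.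
have tau_lc c : tau (lc c) = \sum_(p | (p \in W) && good st p) c p *: bvecH F K p.
  rewrite /lc; elim/big_rec2: _ => [|p x t /andP[pW pg] <-]; first exact: tau0.
  by rewrite tau_lin tau_g // -scalerAl mul1r.
have lcZD c x y : lc (fun p => c * x p + y p) = c%:A *: lc x + lc y.
  rewrite /lc scaler_sumr -big_split; apply: eq_bigr => p _ /=.
  exact: alg_scaleD.
suff Rt (t : T) : t = lc (hcoord (tau t)).
  apply: (@lmod_isoI_sym _ _ _ ind_iso) => [h t u|t u e|y].
  - exact: ind_iso_lin.
  - have tu : tau t = tau u := congr1 (fun x => toP x) e.
    exact: etrans (Rt t) (etrans (congr1 (fun x => lc (hcoord x)) tu) (esym (Rt u))).
  exists (lc (fun p => wcoef B y (rw p))); apply: (toP_inj gp).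
  apply: etrans (tau_lc _) _; rewrite /toH; apply: eq_bigl => p; exact/esym/inL_B.
have R0 : 0 = lc (hcoord (tau 0)) :> T.
  by rewrite /lc big1 // => p _; rewrite tau0 hcoord0 scale0r scale0r.
have Rl (c : F) (x y : T) : x = lc (hcoord (tau x)) ->
    y = lc (hcoord (tau y)) ->
    c%:A *: x + y = lc (hcoord (tau (c%:A *: x + y))).
  move=> e e'; rewrite {1}e {1}e' -lcZD; congr lc; apply/funext => p.
  by rewrite tau_lin hcoordD -scalerAl mul1r hcoordZ.
have Rg p : p \in W -> good st p -> g p = lc (hcoord (tau (g p))).
  move=> pW pg; rewrite /lc (bigD1 p) ?pW //= tau_g // hcoord_bvecH //; last first.
    by move: pg; rewrite goodE => /andP[].
  rewrite eqxx scale1r scale1r big1 ?addr0 // => q /andP[/andP[qW qg] qp].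
  rewrite hcoord_bvecH //; last by move: qg; rewrite goodE => /andP[].
  by rewrite (negbTE qp) scale0r scale0r.
elim/tensor_ind: t => [|t t' e e'|m x]; first exact: R0.
  have -> : t - t' = (-1)%:A *: t' + t by rewrite scaleN1r scaleN1r addrC.
  exact: Rl.
apply: (tpure_ind_l R0 Rl) => w wW.
(* The parabolic part of w crosses the tensor sign and is absorbed by x, which leaves a minimal
   representative on the left. *)
have [u [v [uW mu vG _ h]]] := factI G wW.
have [b bE] := hpibar_parabolic F vG.
have hw : hpibar F w = hpibar F u * block_incl F G b.
  by rewrite bE !hpibarE; apply/h/hgenbar_braided.
have e : pure (hpibar F w) x = pure (hpibar F u) (b *: x).
  apply: etrans (congr1 (fun m' : M => pure m' x) hw) _.
  exact: (@tpureM H _ M Nmod (hpibar F u) b x).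
apply: (eq_ind_r (fun t : T => t = lc (hcoord (tau t))) _ e).
apply: (tpure_ind_r R0 Rl) => q; rewrite inL_N => /and3P[qW qg qG].
have qu : (q * u)%g \in W by rewrite WM.
have [uW' mu' vG' pE _] := uvP _ qu.
(* The factors chosen for [q * u] are u and q themselves, so the tensor is one of the [g p]. *)
have [e1 e2] := fact_uniq uW uW' mu mu' qG vG' pE.
have e' : pure (hpibar F u) (wvec BN (rw q)) = g (q * u)%g :=
  congr2 (fun x y : {perm signed n} => pure (hpibar F x) (wvec BN (rw y))) e1 e2.
apply: (eq_ind_r (fun t : T => t = lc (hcoord (tau t))) _ e').
by apply: (Rg _ qu); rewrite good_par.
Qed.

End Induction.

Theorem theorem3p6 (F : fieldType) (n : nat) :
  (forall a : seq nat, is_pcomp a -> sumn a = n ->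
     exists P : PB F n a [::],
       lmod_iso P (calP F [set i : 'I_n | val i \in descents a] setT)) /\
  (forall (a : seq nat) (s : seq (seq nat)), is_gpribbon n a s ->
     let I := [set i : 'I_n | val i \in descents (foldl ncat a s)] in
     let J := [set j : 'I_n | val j \in
       descents (foldl ncat (0%N :: nseq (sumn a) 1%N)
                            [seq nseq (sumn b) 1%N | b <- s])] in
     exists P : PB F n a s,
       [/\ lmod_iso P (calP F I J),
           exists N : tensor_module F n a s,
             lmod_iso P (induced (block_incl F (block_gens n a s)) N)
         & exists Q : forall b : seq_sub (bracket a s), PB F n (val b) [::],
             lmod_iso P (dsum Q)]).
Proof.
have IE a s : is_pcomp a -> all is_comp s ->
    [set i : 'I_n | val i \in descents (foldl ncat a s)] = upset n (gsteps a s).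
  by move=> ap sc; apply/setP => i; rewrite !inE descents_ncat.
split=> [a ap an|a s gp I J].
  have gp : is_gpribbon n a [::] by rewrite /is_gpribbon ap /= addn0 an.
  exists (PBmod F gp); have -> := IE a [::] ap isT.
  apply: PBmod_calP; apply/setP => i; rewrite !inE andbT.
  (* A single pseudo-ribbon has no gaps, so the complement of its steps up consists of its steps to
     the right. *)
  have := rsteps_Some (pos a); rewrite -gsteps0 => /memPn /(_ (nth None (gsteps a [::]) i)).
  by rewrite mem_nth ?(size_gsteps_n gp) // => /(_ isT); case: nth => [[]|].
have /and3P[ap sc /eqP nE] := gp; exists (PBmod F gp); split.
- rewrite /I IE //; apply: PBmod_calP; apply/setP => j; rewrite !inE.
  have lt : (j < sumn a + sumn [seq sumn b | b <- s])%N by rewrite -nE.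
  (* J consists of the steps that are not gaps, so removing the steps up leaves the steps to the
     right. *)
  by rewrite (descents_ones ap sc lt); case: nth => [[]|].
- have [L [B [LE opE]]] := tensor_space_basis F ap sc.
  rewrite -nE in LE opE.
  by exists (Nmod gp LE opE); apply: induced_iso.
by exists (fun b => PBmod F (gp_bracket gp b)); apply: bracket_sum_iso.
Qed.
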